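(* Fix $d$, $\delta\in(0,\frac12]$, $\theta=1-2\delta$, and a (possibly trivial) BMS channel $W$. Let $$C_1=d\theta^2\left(1-\frac{(d\theta^2-1)_+}{d-1}\right)^{\frac{d-1}{2}}Z(W),\qquad C_2=d\theta^2\exp\left(-d\left(1-\sqrt{1-\frac{(d\theta^2-1)_+}{d}}\right)\right)Z(W).$$ Consider BP fixed points (in the sense of distributions $P_\Delta$ on $[0,\frac12]$, see context) for the broadcasting-on-tree-with-survey model $(d,\theta,W)$, $d$ a positive integer. 1. If $W$ is non-trivial ($P_e(W)<\frac12$) and $C_1<1$, there is exactly one BP fixed point. 2. If $W$ is trivial and $d\theta^2\le1$, there is exactly one BP fixed point, which is the trivial one (the point mass at $\Delta=\frac12$). 3. If $W$ is trivial, $d\theta^2>1$ and $C_1<1$, there are exactly two BP fixed points; one is trivial and the other is non-trivial. The same three statements about the number of fixed points hold for the model $(\mathrm{Poi}(d),\theta,W)$, $d>0$ real, with $C_1$ replaced by $C_2$.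
   Context: Notation: $x_+=\max\{x,0\}$. For $d=1$ (where $d\theta^2<1$) the second factor in $C_1$ is read as $1$. BMS channels: a channel $P$ from $\{\pm1\}$ to a measurable space $\mathcal Y$ is a BMS channel if there is a measurable involution $\tau$ of $\mathcal Y$ with $P(\tau^{-1}(E)|+)=P(E|-)$ for all measurable $E$. Every BMS channel is equivalent to a channel $X\mapsto(\Delta,Z)$ with $\Delta\in[0,\frac12]$ independent of $X$ and, given $(\Delta,X)$, $Z=X$ with probability $1-\Delta$ and $Z=-X$ with probability $\Delta$; $\Delta$ is its $\Delta$-component. For $W$ with $\Delta$-component $\Delta_W$: $P_e(W)=\mathbb{E}\Delta_W$, $Z(W)=\mathbb{E}[2\sqrt{\Delta_W(1-\Delta_W)}]$. $W$ is trivial if $P_e(W)=\frac12$, i.e. $\Delta_W=\frac12$ a.s. From $\Delta$ to log-likelihood ratio: given a distribution $P_\Delta$ on $[0,\frac12]$, let $\mu=\mu(P_\Delta)$ be the law on $\mathbb{R}\cup\{\pm\infty\}$ of the random variable obtained by sampling $\Delta\sim P_\Delta$ and then taking the value $\log\frac{1-\Delta}{\Delta}$ with probability $1-\Delta$ and $-\log\frac{1-\Delta}{\Delta}$ with probability $\Delta$. BP fixed point: let $F_\theta(r)=2\operatorname{arctanh}\left(\theta\tanh(r/2)\right)$ for $r\in\mathbb{R}\cup\{\pm\infty\}$. $P_\Delta$ is a BP fixed point of $(d,\theta,W)$ if, with $\mu=\mu(P_\Delta)$ and independent random variables $R_1^+,\dots,R_d^+\sim\mu$, $Z_1,\dots,Z_d\in\{\pm1\}$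 with $\mathbb{P}[Z_i=+1]=1-\delta$, and $R_W\sim\mu(P_{\Delta_W})$ (where $P_{\Delta_W}$ is the law of $\Delta_W$), the random variable $$R^+=\sum_{i=1}^{d}Z_iF_\theta(R_i^+)+R_W$$ also has law $\mu$. For $(\mathrm{Poi}(d),\theta,W)$ the definition is the same with the number of summands $d$ replaced by an independent $b\sim\mathrm{Poisson}(d)$. Only such symmetric distributions (those coming from some $P_\Delta$) are considered. *)

(* Defs.v *)
From HB Require Import structures.
From mathcomp Require Import all_boot all_order all_algebra.
From mathcomp Require Import all_classical all_reals all_analysis.
From mathcomp Require Import measurable_realfun giry.
From mathcomp Require Import ring lra.

Set Implicit Arguments.
Unset Strict Implicit.
Unset Printing Implicit Defensive.

Import Order.TTheory GRing.Theory Num.Theory.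
Import numFieldNormedType.Exports.

Local Open Scope classical_set_scope.
Local Open Scope ring_scope.

(* The alphabet {+1, -1} is [bool], with [true] for +1.

   Laws are compared by [measure_eq] (notation [_ ≡μ _]), i.e. on measurable
   sets: the values of a [probability] on non-measurable sets are irrelevant,
   so Leibniz equality would be too fine. *)

Section channels.
Context {R : realType}.

Definition is_BMS d (Y : measurableType d) (W : R.-pker bool ~> Y) : Prop :=
  exists tau : Y -> Y,
    [/\ measurable_fun [set: Y] tau, involutive tau &
        forall E, measurable E -> W true (tau @^-1` E) = W false E].

Definition degraded d1 d2 (Y1 : measurableType d1) (Y2 : measurableType d2)
    (V : R.-pker bool ~> Y1) (W : R.-pker bool ~> Y2) : Prop :=
  exists K : R.-pker Y2 ~> Y1, forall x E, measurable E ->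
    V x E = (\int[W x]_y K y E)%E.

Definition channel_equiv d1 d2 (Y1 : measurableType d1)
    (Y2 : measurableType d2) (V : R.-pker bool ~> Y1)
    (W : R.-pker bool ~> Y2) : Prop :=
  degraded V W /\ degraded W V.

End channels.

Record delta_dist (R : realType) := DeltaDist {
  delta_law :> probability R R ;
  delta_law_supp : delta_law `[0, 2^-1]%classic = 1%E }.

Section trivial_delta.
Context (R : realType).

Let trivial_supp : (\d_(2^-1 : R) : probability R R) `[0, 2^-1]%classic = 1%E.
Proof. by rewrite /= diracE mem_set//= in_itv/= lexx invr_ge0 ler0n. Qed.

Definition trivial_delta : delta_dist R := DeltaDist trivial_supp.

End trivial_delta.

Section delta_channel.
Context {R : realType} (P : delta_dist R).
Local Open Scope ereal_scope.

(* The law of (Delta, Z) given X = x. *)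
Definition delta_channel (x : bool) (E : set (R * bool)) : \bar R :=
  \int[P]_(t in `[0%R, 2^-1%R])
    ((1 - t)%:E * \d_(t, x) E + t%:E * \d_(t, ~~ x) E).

Let I : set R := `[0%R, 2^-1%R]%classic.

Let I01 t : I t -> (0 <= 1 - t)%R /\ (0 <= t)%R.
Proof. by rewrite /I/= in_itv/= => /andP[]; lra. Qed.

Let term_ge0 x E t : I t ->
  0 <= (1 - t)%:E * \d_(t, x) E + t%:E * \d_(t, ~~ x) E.
Proof.
by move=> /I01[? ?]; apply: adde_ge0; apply: mule_ge0; rewrite ?lee_fin.
Qed.

Let measurable_term x E : measurable E -> measurable_fun I
  (fun t : R => (1 - t)%:E * \d_(t, x) E + t%:E * \d_(t, ~~ x) E : \bar R).
Proof.
move=> mE; apply: measurable_funTS.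
have md b : measurable_fun [set: R] (fun t : R => \d_(t, b) E : \bar R).
  rewrite [X in measurable_fun _ X](_ : _ = fun t => (\1_E (t, b))%:E)//.
  apply/measurable_EFinP; apply: (measurableT_comp (f := \1_E : R * bool -> R)).
    exact: measurable_indic.
  exact: measurable_fun_pair.
by apply: emeasurable_funD; apply: emeasurable_funM => //;
  apply/measurable_EFinP => //; apply: measurable_funB.
Qed.

Let delta_channel0 x : delta_channel x set0 = 0.
Proof.
by apply: integral0_eq => t _; rewrite !measure0 !mule0 adde0.
Qed.

Let delta_channel_ge0 x E : 0 <= delta_channel x E.
Proof. by apply: integral_ge0 => t; exact: term_ge0. Qed.

Let delta_channel_sigma_additive x : semi_sigma_additive (delta_channel x).
Proof.
move=> F mF tF mUF; apply: cvg_toP.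
  apply: ereal_nondecreasing_is_cvgn => m n mn.
  by apply: lee_sum_nneg_natr => // k _ _; exact: delta_channel_ge0.
rewrite /delta_channel -integral_nneseries//.
- apply: eq_integral => t /set_mem It.
  have [? ?] := I01 It.
  rewrite nneseriesD//.
  + rewrite !nneseriesZl//.
    by rewrite !measure_semi_bigcup.
  + by move=> i _ _; rewrite mule_ge0.
  + by move=> i _ _; rewrite mule_ge0.
- by move=> n; apply: measurable_term.
- by move=> n t; exact: term_ge0.
Qed.

HB.instance Definition _ x := isMeasure.Build _ _ _ (delta_channel x)
  (delta_channel0 x) (delta_channel_ge0 x) (@delta_channel_sigma_additive x).

Let delta_channelT x : delta_channel x [set: _] = 1.
Proof.
transitivity (\int[P]_(t in I) cst 1 t).
  apply: eq_integral => t _.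
  by rewrite !diracT !mule1 -EFinD subrK.
rewrite integral_cst; last exact: measurable_itv.
by rewrite mul1e; exact: delta_law_supp.
Qed.

HB.instance Definition _ x := Measure_isProbability.Build _ _ _
  (delta_channel x) (delta_channelT x).

Definition delta_kernel (x : bool) : {measure set (R * bool) -> \bar R} :=
  delta_channel x.

Let measurable_delta_kernel E : measurable E ->
  measurable_fun [set: bool] (delta_kernel ^~ E).
Proof. by []. Qed.

HB.instance Definition _ :=
  isKernel.Build _ _ _ _ R delta_kernel measurable_delta_kernel.

HB.instance Definition _ :=
  Kernel_isProbability.Build _ _ _ _ R delta_kernel delta_channelT.

End delta_channel.

Section messages.
Context {R : realType}.

(* tanh (r / 2), extended to infinite r by continuity. *)
Definition tanh_half (r : \bar R) : R :=
  match r with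
  | s%:E => (expR (s / 2) - expR (- (s / 2))) / (expR (s / 2) + expR (- (s / 2)))
  | +oo%E => 1
  | -oo%E => -1
  end.

Definition arctanh (x : R) : R := ln ((1 + x) / (1 - x)) / 2.

(* Real-valued: for |theta| < 1 the argument of arctanh stays in ]-1, 1[, even
   for infinite r. *)
Definition F_theta (theta : R) (r : \bar R) : R :=
  2 * arctanh (theta * tanh_half r).

(* ln 0 = 0 and division by 0 is 0 in the library, hence the case t = 0. *)
Definition llr (t : R) : \bar R :=
  if t == 0 then +oo%E else (ln ((1 - t) / t))%:E.

Definition signed_llr (tz : R * bool) : \bar R :=
  if tz.2 then llr tz.1 else (- llr tz.1)%E.

Definition edge_message (theta : R) (rz : \bar R * bool) : R :=
  (if rz.2 then 1 else -1) * F_theta theta rz.1.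

Definition add_pair (xy : R * R) : R := xy.1 + xy.2.

Definition add_survey (xr : R * \bar R) : \bar R := (xr.1%:E + xr.2)%E.

Let measurable_inv : measurable_fun [set: R] (GRing.inv : R -> R).
Proof.
rewrite -(setUv [set 0]) measurable_funU//; last exact: measurableC.
split; first exact: measurable_fun_set1.
apply: open_continuous_measurable_fun.
  by apply: closed_openC; exact: closed_eq.
by move=> x; rewrite inE => /eqP x0; exact: inv_continuous.
Qed.

Let measurable_tanh_half : measurable_fun [set: \bar R] tanh_half.
Proof.
pose f (s : R) : R :=
  (expR (s / 2) - expR (- (s / 2))) / (expR (s / 2) + expR (- (s / 2))).
rewrite [tanh_half](_ : _ = fun r : \bar R => if r == +oo%E then 1 else
    if r == -oo%E then -1 else f (fine r)); last first.
  by apply/funext => -[].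
have mf : measurable_fun [set: R] f.
  have ms : measurable_fun [set: R] (fun s : R => s / 2).
    exact: measurable_funM.
  have m1 : measurable_fun [set: R] (fun s : R => expR (s / 2)).
    exact: measurableT_comp.
  have m2 : measurable_fun [set: R] (fun s : R => expR (- (s / 2))).
    by apply: measurableT_comp => //; exact: measurableT_comp.
  apply: measurable_funM; first exact: measurable_funB.
  by apply: measurableT_comp => //; exact: measurable_funD.
apply: measurable_fun_ifT => //; first exact: measurable_fun_eqe.
apply: measurable_fun_ifT => //; first exact: measurable_fun_eqe.
by apply: measurableT_comp.
Qed.

Lemma measurable_signed_llr : measurable_fun [set: R * bool] signed_llr.
Proof.
have mllr : measurable_fun [set: R] llr.
  apply: measurable_fun_ifT => //.
    exact: measurable_fun_eqr.
  apply/measurable_EFinP; apply: measurableT_comp => //.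
  by apply: measurable_funM => //; exact: measurable_funB.
apply: measurable_fun_ifT => //=.
  exact: measurableT_comp.
by apply: measurableT_comp => //; exact: measurableT_comp.
Qed.

HB.instance Definition _ := isMeasurableFun.Build _ _ _ _ signed_llr
  measurable_signed_llr.

Lemma measurable_edge_message theta :
  measurable_fun [set: \bar R * bool] (edge_message theta).
Proof.
have mt : measurable_fun [set: \bar R * bool] (fun rz => tanh_half rz.1).
  exact: measurableT_comp.
have mtt : measurable_fun [set: \bar R * bool]
    (fun rz => theta * tanh_half rz.1) by exact: measurable_funM.
apply: measurable_funM; first exact: measurable_fun_ifT.
apply: measurable_funM => //; apply: measurable_funM => //.
apply: measurableT_comp => //; apply: measurable_funM.
  exact: measurable_funD.
by apply: measurableT_comp => //; exact: measurable_funB.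
Qed.

HB.instance Definition _ theta := isMeasurableFun.Build _ _ _ _
  (edge_message theta) (measurable_edge_message theta).

Lemma measurable_add_pair : measurable_fun [set: R * R] add_pair.
Proof. exact: measurable_funD. Qed.

HB.instance Definition _ := isMeasurableFun.Build _ _ _ _ add_pair
  measurable_add_pair.

Lemma measurable_add_survey : measurable_fun [set: R * \bar R] add_survey.
Proof.
apply: emeasurable_funD => //.
by apply/measurable_EFinP.
Qed.

HB.instance Definition _ := isMeasurableFun.Build _ _ _ _ add_survey
  measurable_add_survey.

End messages.

Section BP.
Context {R : realType}.

(* mu (P_Delta) is the law of the signed log-likelihood ratio when X = +1. *)
Definition llr_law (P : delta_dist R) : probability (\bar R) R :=
  distribution (delta_channel P true) signed_llr.

Definition theta_of (delta : R) : R := 1 - 2 * delta.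

(* The law of Z F_theta(R^+), for R^+ ~ mu (P) and an independent sign Z. *)
Definition edge_law (delta : R) (P : delta_dist R) : probability R R :=
  distribution (llr_law P \x bernoulli_prob (1 - delta))%E
    (edge_message (theta_of delta)).

Fixpoint iid_sum_law (nu : probability R R) (n : nat) : probability R R :=
  if n is m.+1 then distribution (iid_sum_law nu m \x nu)%E add_pair
  else \d_(0 : R).

(* The law of the sum of n independent edge messages and the independent
   survey R_W. *)
Definition bp_law (delta : R) (PW P : delta_dist R) (n : nat) :
    probability (\bar R) R :=
  distribution (iid_sum_law (edge_law delta P) n \x llr_law PW)%E add_survey.

Definition bp_fixed_point (d : nat) (delta : R) (PW P : delta_dist R) : Prop :=
  bp_law delta PW P d ≡μ llr_law P.

(* Conditioning on b, the law of R^+ is the Poisson mixture of the laws with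
   exactly n summands. *)
Definition poisson_bp_fixed_point (d delta : R) (PW P : delta_dist R) : Prop :=
  forall E : set (\bar R), measurable E ->
    (\sum_(0 <= n <oo) (poisson_pmf d n)%:E * bp_law delta PW P n E)%E =
    llr_law P E.

End BP.

Section channel_parameters.
Context {R : realType}.

Definition Pe (P : delta_dist R) : R := \int[P]_t t.

Definition Bhattacharyya (P : delta_dist R) : R :=
  \int[P]_t (2 * Num.sqrt (t * (1 - t))).

Definition pos_part (x : R) : R := Num.max x 0.

(* For d = 1 the base is 1 - 0 / 0 = 1, so the power is 1 as required. *)
Definition C1 (d : nat) (theta : R) (PW : delta_dist R) : R :=
  d%:R * theta ^+ 2 *
  (1 - pos_part (d%:R * theta ^+ 2 - 1) / (d%:R - 1)) `^ ((d%:R - 1) / 2) *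
  Bhattacharyya PW.

Definition C2 (d theta : R) (PW : delta_dist R) : R :=
  d * theta ^+ 2 *
  expR (- (d * (1 - Num.sqrt (1 - pos_part (d * theta ^+ 2 - 1) / d)))) *
  Bhattacharyya PW.

End channel_parameters.

Definition exactly_one {R : realType} (S : delta_dist R -> Prop) : Prop :=
  exists2 P, S P & forall Q, S Q -> Q ≡μ P.

Definition only_trivial {R : realType} (S : delta_dist R -> Prop) : Prop :=
  S (trivial_delta R) /\ forall Q, S Q -> Q ≡μ trivial_delta R.

Definition trivial_and_one_nontrivial {R : realType}
    (S : delta_dist R -> Prop) : Prop :=
  S (trivial_delta R) /\
  exists P, [/\ S P, ~ (P ≡μ trivial_delta R) &
    forall Q, S Q -> Q ≡μ trivial_delta R \/ Q ≡μ P].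

(* Main.v *)
Require Import Defs.
From HB Require Import structures.
From mathcomp Require Import all_boot all_order all_algebra.
From mathcomp Require Import all_classical all_reals all_analysis.
From mathcomp Require Import measurable_realfun giry.
From mathcomp Require Import ring lra.

Set Implicit Arguments.
Unset Strict Implicit.
Unset Printing Implicit Defensive.

Import Order.TTheory GRing.Theory Num.Theory.
Import numFieldNormedType.Exports.

Local Open Scope classical_set_scope.
Local Open Scope ring_scope.

(* Write u = 1 - 2 Delta and order the laws of Delta by the expectations of even
   convex functions of u, i.e. by degradation. BP is monotone, so iterating it
   from the noiseless channel decreases to a greatest fixed point L. For a fixed
   point P, Z P = Z(W) g (b P), where g is the generating function of the number
   of summands and b P = E sqrt (1 - theta^2 u^2). As
   sqrt (1 - theta^2 u^2) - theta^2 sqrt (1 - u^2) is convex in u, P <= L gives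
   b P - b L <= theta^2 (Z P - Z L), hence
     Z P - Z L <= Z(W) theta^2 g' (b P) (Z P - Z L).
   If P is non-trivial, comparing the optimal estimator of the root with a linear
   one bounds E u^2 from below, hence b P from above, and Z(W) theta^2 g' (b P)
   is at most C1 (or C2), so less than 1. Then Z P = Z L, and two comparable laws
   with the same Z are equal because -sqrt (1 - u^2) is strongly convex. *)

(** The obstacle is the vertical tangent of -sqrt (1 - u^2) at u = 1 and u = -1: there is no
    subgradient there, so convexity is expressed by affine minorants that touch up to an arbitrary
    e. This form survives rescaling u and adding an independent observation. Both models are
    mixtures over the number of summands. They enter only through the mean D, the second factorial
    moment D kappa (kappa = d - 1 for the regular tree, kappa = d for the Poisson one) and tangent
    inequalities for the generating function g. The limit L is a pointwise limit of quantile
    functions along an ultrafilter. For trivial W and D theta^2 > 1, L is non-trivial because the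
    second moments of the iterates stay above a positive barrier. At D theta^2 = 1 the linear
    comparison of Z is only an equality at first order, and a gap of order u^4 decides. *)

(** * Calculus of [tanh_half], [F_theta] and [llr] *)

Section tanh_half.
Context {R : realType}.
Implicit Types (x y z : R) (r s : \bar R).

Notation th := (@tanh_half R).

Lemma tanh_half_fin x : th x%:E = (expR x - 1) / (expR x + 1).
Proof.
rewrite /tanh_half expRN; set e := expR (x / 2).
have e0 : 0 < e := expR_gt0 _.
have -> : expR x = e * e by rewrite -expRD; congr expR; field.
have e1 : e * e + 1 != 0 by rewrite gt_eqF// addr_gt0// mulr_gt0.
by field; rewrite e1 gt_eqF.
Qed.

Lemma tanh_half0 : th 0%:E = 0.
Proof. by rewrite tanh_half_fin expR0 subrr mul0r. Qed.

Lemma tanh_halfN r : th (- r)%E = - th r.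
Proof.
case: r => [x||]; rewrite ?opprK//.
rewrite -EFinN !tanh_half_fin expRN; set e := expR x.
have e0 : 0 < e := expR_gt0 _.
have e1 : e + 1 != 0 by rewrite gt_eqF// addr_gt0.
by field; rewrite e1 gt_eqF //= addrC.
Qed.

Lemma tanh_half_lt1 x : -1 < th x%:E < 1.
Proof.
rewrite tanh_half_fin; have e0 := expR_gt0 x.
by rewrite ltr_pdivlMr ?ltr_pdivrMr ?addr_gt0//; lra.
Qed.

Lemma tanh_half_le1 r : -1 <= th r <= 1.
Proof.
case: r => [x||]; rewrite ?lexx/=; [|lra|lra].
by have /andP[/ltW -> /ltW ->] := tanh_half_lt1 x.
Qed.

(** Strict although r may be infinite, because the first factor comes from a finite argument; so the
    denominators of the addition formula never vanish. *)
Lemma tanh_half_mul_le1 x r : -1 < th x%:E * th r < 1.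
Proof.
have := tanh_half_lt1 x; have := tanh_half_le1 r.
move: (th x%:E) (th r) => a b.
rewrite -ler_norml -!ltr_norml normrM => h1; apply: le_lt_trans.
exact: ler_piMr.
Qed.

Lemma tanh_halfD x r :
  th (x%:E + r)%E = (th x%:E + th r) / (1 + th x%:E * th r).
Proof.
have /andP[h1 h2] := tanh_half_lt1 x.
case: r => [y||].
- rewrite -EFinD !tanh_half_fin expRD.
  have := expR_gt0 x; have := expR_gt0 y.
  move: (expR x) (expR y) => a b b0 a0.
  have ? : a + 1 != 0 by rewrite gt_eqF// addr_gt0.
  have ? : b + 1 != 0 by rewrite gt_eqF// addr_gt0.
  have ? : a * b + 1 != 0 by rewrite gt_eqF// addr_gt0// mulr_gt0.
  have E : 1 + (a - 1) / (a + 1) * ((b - 1) / (b + 1)) =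
           2 * (a * b + 1) / ((a + 1) * (b + 1)).
    by field; apply/andP.
  by rewrite E; field; do ! (apply/andP; split).
- by rewrite addey//= -/(th x%:E) mulr1 addrC divff//; lra.
- rewrite addeNy -/(th -oo%E) [th -oo%E]/(-1) mulrN1.
  rewrite -opprB mulNr divff//; lra.
Qed.

Lemma tanh_half_F_theta theta r : 0 <= theta < 1 ->
  th (F_theta theta r)%:E = theta * th r.
Proof.
move=> /andP[t0 t1]; have /andP[h1 h2] := tanh_half_le1 r.
rewrite tanh_half_fin /F_theta /arctanh.
set z := theta * th r.
have /andP[z1 z2] : -1 < z < 1.
  have := mulr_ge0 t0 (_ : 0 <= 1 - th r); have := mulr_ge0 t0 (_ : 0 <= 1 + th r).
  by rewrite /z !subr_ge0 h2 -lerBlDl sub0r h1 => /(_ isT) ? /(_ isT) ?; apply/andP; split; lra.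
rewrite (_ : 2 * (ln ((1 + z) / (1 - z)) / 2) = ln ((1 + z) / (1 - z))); last by field.
rewrite lnK; last by rewrite posrE divr_gt0//; lra.
have ? : 1 - z != 0 by lra.
have E : (1 + z) / (1 - z) + 1 = 2 / (1 - z) by field.
by rewrite E; field.
Qed.

Lemma tanh_half_llr t : 0 <= t <= 2^-1 -> th (llr t) = 1 - 2 * t.
Proof.
move=> /andP[t0 t1]; rewrite /llr; case: eqVneq => [->|tn0]; first by rewrite /=; lra.
have t0' : 0 < t by rewrite lt_def tn0.
rewrite tanh_half_fin lnK; last by rewrite posrE divr_gt0//; lra.
have E : (1 - t) / t + 1 = t^-1 by field.
by rewrite E; field.
Qed.

Lemma tanh_half_ge0 r : (0 <= r)%E -> 0 <= th r.
Proof.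
case: r => [x||]//; rewrite lee_fin => x0; rewrite tanh_half_fin.
have e1 : 1 <= expR x by rewrite -expR0 ler_expR.
by apply: divr_ge0; lra.
Qed.

(** Lets a symmetric law be rebuilt from the law of |tanh|. At infinite r the crossover probability
    is 0, the value that [llr] singles out. *)
Lemma llr_tanh_half r : llr ((1 - `|th r|) / 2) = `|r|%E.
Proof.
have -> : `|th r| = th `|r|%E.
  case: r => [x||]; rewrite ?normrN ?normr1//.
  have [x0|x0] := leP 0 x.
    rewrite (_ : `|x%:E|%E = x%:E); last by rewrite /= ger0_norm.
    by rewrite ger0_norm// tanh_half_ge0// lee_fin.
  rewrite (_ : `|x%:E|%E = (- x%:E)%E); last by rewrite /= ltr0_norm.
  rewrite ler0_norm ?tanh_halfN// -oppr_ge0 -tanh_halfN tanh_half_ge0//.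
  by rewrite -EFinN lee_fin oppr_ge0 ltW.
case: (`|r|%E) (abse_ge0 r) => [x||]//=; last by rewrite subrr mul0r /llr eqxx.
rewrite lee_fin => x0; rewrite -/(th x%:E) tanh_half_fin.
have := expR_gt0 x; set e := expR x => e0.
have e1 : e + 1 != 0 by lra.
have -> : (1 - (e - 1) / (e + 1)) / 2 = (e + 1)^-1 by field.
rewrite /llr invr_eq0 (negbTE e1).
have -> : (1 - (e + 1)^-1) / (e + 1)^-1 = e by field.
by rewrite expRK.
Qed.

Lemma measurable_invr : measurable_fun [set: R] (GRing.inv : R -> R).
Proof.
rewrite -(setUv [set 0]) measurable_funU//; last exact: measurableC.
split; first exact: measurable_fun_set1.
apply: open_continuous_measurable_fun.
  by apply: closed_openC; exact: closed_eq.
by move=> x; rewrite inE => /eqP x0; exact: inv_continuous.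
Qed.

Lemma measurable_tanh_half : measurable_fun [set: \bar R] th.
Proof.
pose f (s : R) : R := (expR s - 1) / (expR s + 1).
rewrite [th](_ : _ = fun r : \bar R => if r == +oo%E then 1 else
    if r == -oo%E then -1 else f (fine r)); last first.
  by apply/funext => -[x||]//; rewrite tanh_half_fin.
have mf : measurable_fun [set: R] f.
  apply: measurable_funM; first by apply: measurable_funB => //; exact: measurableT_comp.
  apply: measurableT_comp; first exact: measurable_invr.
  by apply: measurable_funD => //; exact: measurableT_comp.
apply: measurable_fun_ifT => //; first exact: measurable_fun_eqe.
apply: measurable_fun_ifT => //; first exact: measurable_fun_eqe.
by apply: measurableT_comp.
Qed.

Lemma measurable_llr : measurable_fun [set: R] (@llr R).
Proof.
apply: measurable_fun_ifT => //; first exact: measurable_fun_eqr.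
apply/measurable_EFinP; apply: measurableT_comp => //.
by apply: measurable_funM => //; [exact: measurable_funB|exact: measurable_invr].
Qed.

End tanh_half.

#[global] Arguments tanh_half {R} r : simpl never.

(** * The uniform law on [0, 1] as a source of randomness *)

Section uniform01.
Context {R : realType}.

(* The library's uniform law and [probability R R] use two different displays
   for the Borel sets of R, hence the image by the identity. *)
Let id_borel (x : measurableTypeR R) : R := x.

Let measurable_id_borel : measurable_fun setT id_borel.
Proof. by move=> _ Y mY; rewrite setTI. Qed.

HB.instance Definition _ := isMeasurableFun.Build _ _ _ _ id_borel measurable_id_borel.

Definition unif01 : probability R R :=
  distribution (uniform_prob (@ltr01 R)) id_borel.

Lemma unif01E (A : set R) : measurable A ->
  unif01 A = lebesgue_measure (A `&` `[0, 1]).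
Proof.
move=> mA; rewrite /unif01/= /pushforward/= /uniform_prob integral_uniform_pdf.
rewrite (eq_integral (cst 1%E)); last first.
  move=> x /[!inE] -[_] /=; rewrite in_itv/= => x01.
  by rewrite /uniform_pdf x01 subr0 invr1.
by rewrite integral_cst ?mul1e//; exact: measurableI.
Qed.

Lemma unif01_lt (t : R) : 0 <= t <= 1 -> unif01 [set v | v < t] = t%:E.
Proof.
move=> /andP[t0 t1].
have -> : [set v | v < t] = `]-oo, t[%classic by apply/seteqP; split => v /=; rewrite in_itv.
rewrite unif01E//.
have -> : `]-oo, t[ `&` `[0, 1] = `[0, t[%classic.
  apply/seteqP; split => v /=; rewrite !in_itv/=; first by move=> [-> /andP[->]].
  by move=> /andP[v0 vt]; rewrite vt v0; split => //; rewrite (le_trans (ltW vt)).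
rewrite lebesgue_measure_itv/= lte_fin; case: ltP => [_|t0']; first by rewrite -EFinD subr0.
by congr EFin; apply/eqP; rewrite eq_le t0 t0'.
Qed.

Lemma unif01_le (t : R) : 0 <= t <= 1 -> unif01 [set v | v <= t] = t%:E.
Proof.
move=> /andP[t0 t1].
have -> : [set v | v <= t] = `]-oo, t]%classic by apply/seteqP; split => v /=; rewrite in_itv.
rewrite unif01E//.
have -> : `]-oo, t] `&` `[0, 1] = `[0, t]%classic.
  apply/seteqP; split => v /=; rewrite !in_itv/=; first by move=> [-> /andP[->]].
  by move=> /andP[v0 vt]; rewrite vt v0; split => //; rewrite (le_trans vt).
rewrite lebesgue_measure_itv/= lte_fin; case: ltP => [_|t0']; first by rewrite -EFinD subr0.
by congr EFin; apply/eqP; rewrite eq_le t0 t0'.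
Qed.

(** The event v < t is a coin of bias t: this is how a random sign is simulated by a uniform
    variable. *)
Lemma integral_unif01_if (t a b : R) : 0 <= t <= 1 -> 0 <= a -> 0 <= b ->
  (\int[unif01]_v (if (v < t)%R then a else b)%:E = (t * a + (1 - t) * b)%:E)%E.
Proof.
move=> t01 a0 b0; pose A := [set v : R | v < t].
have mA : measurable A.
  have -> : A = `]-oo, t[%classic by apply/seteqP; split => v /=; rewrite in_itv.
  exact: measurable_itv.
rewrite (eq_integral (fun v => a%:E * (\1_A v)%:E + b%:E * (\1_(~` A) v)%:E)%E); last first.
  move=> v _; rewrite !indicE in_setC; case: ifPn => vt.
    by rewrite mem_set//= mule1 mule0 adde0.
  by rewrite memNset//= ?mule0 ?mule1 ?add0e//; exact/negP.
rewrite ge0_integralD//; last 4 first.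
- by move=> v _; rewrite mule_ge0.
- by apply/measurable_EFinP/measurable_funM => //; exact: measurable_indic.
- by move=> v _; rewrite mule_ge0.
- by apply/measurable_EFinP/measurable_funM => //; apply: measurable_indic; exact: measurableC.
have mCA := measurableC mA.
rewrite !ge0_integralZl_EFin//; last 2 first.
- exact/measurable_EFinP/measurable_indic.
- exact/measurable_EFinP/measurable_indic.
have E1 : (\int[unif01]_v (\1_A v)%:E = t%:E)%E.
  by rewrite integral_indic// setIT; exact: unif01_lt.
have E2 : (\int[unif01]_v (\1_(~` A) v)%:E = (1 - t)%:E)%E.
  rewrite integral_indic// setIT; transitivity (1 - unif01 A)%E; first exact: probability_setC.
  by rewrite EFinB; congr (1 - _)%E; exact: unif01_lt.
by rewrite E1 E2 -!EFinM -EFinD; congr EFin; lra.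
Qed.

End uniform01.

(** * Integration against the laws of (Delta, Z) and of the log-likelihood ratio *)

Section delta_channel_integral.
Context {R : realType} (P : delta_dist R).

Lemma integral_delta_supp (f : R -> \bar R) : measurable_fun setT f ->
  (\int[P]_(t in `[0%R, 2^-1%R]) f t = \int[P]_t f t)%E.
Proof.
move=> mf; rewrite integral_mkcond; apply: ae_eq_integral => //.
- by apply/(measurable_restrictT _ _).1 => //; exact: measurable_funTS.
- exists (~` `[0%R, 2^-1%R]%classic); split => //.
  + exact: measurableC.
  + transitivity (1 - P `[0%R, 2^-1%R]%classic)%E; first exact: probability_setC.
    by rewrite delta_law_supp subee.
  + apply: subsetC => t /= It _; by rewrite patchE mem_set.
Qed.

(** A coupling of (Delta, Z): the input is flipped when an independent uniform variable falls below
    Delta. [delta_channel] is known only through its values on sets, whereas the image of a product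
    measure comes with change of variables and Tonelli. *)
Let flip x (tv : R * R) : R * bool := (tv.1, x (+) (tv.2 < tv.1)).

Let measurable_flip x : measurable_fun setT (flip x).
Proof.
apply: measurable_fun_pair => //.
apply: (measurableT_comp (f := addb x)) => //.
by apply: measurable_fun_ltr.
Qed.

HB.instance Definition _ x := isMeasurableFun.Build _ _ _ _ (flip x) (measurable_flip x).

Lemma integral_flip x (f : R * bool -> R) : measurable_fun setT f ->
  (forall z, 0 <= f z) ->
  (\int[distribution (P \x unif01)%E (flip x)]_z (f z)%:E =
  \int[P]_(t in `[0%R, 2^-1%R]) ((1 - t) * f (t, x) + t * f (t, ~~ x))%:E)%E.
Proof.
move=> mf f0.
rewrite ge0_integral_distribution; [|exact/measurable_EFinP|by move=> z; rewrite lee_fin].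
rewrite fubini_tonelli1; last 2 first.
- by apply/measurable_EFinP/measurableT_comp => //; exact: measurable_flip.
- by move=> z; rewrite lee_fin.
rewrite -integral_delta_supp; last first.
  apply: measurable_fun_fubini_tonelli_F => [|z]; last by rewrite lee_fin.
  by apply/measurable_EFinP/measurableT_comp => //; exact: measurable_flip.
apply: eq_integral => t /[!inE]/=; rewrite in_itv/= => /andP[t0 t1].
rewrite /fubini_F/= (eq_integral (fun v : R => (if v < t then f (t, ~~ x) else f (t, x))%:E)); last first.
  by move=> v _; rewrite /flip/=; case: ifP; rewrite ?addbT ?addbF.
rewrite integral_unif01_if//; last by rewrite t0 (le_trans t1)//; lra.
by rewrite addrC.
Qed.

Lemma integral_delta_channel x (f : R * bool -> R) : measurable_fun setT f ->
  (forall z, 0 <= f z) ->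
  (\int[delta_channel P x]_z (f z)%:E =
  \int[P]_(t in `[0%R, 2^-1%R]) ((1 - t) * f (t, x) + t * f (t, ~~ x))%:E)%E.
Proof.
(* On indicators, [integral_flip] says that the two measures agree on measurable sets; this
   transfers the formula to every f. *)
move=> mf f0; rewrite -integral_flip//; apply: eq_measure_integral => E mE _.
transitivity (\int[distribution (P \x unif01)%E (flip x)]_z (\1_E z)%:E)%E; last first.
  by rewrite (integral_indic _ measurableT mE) setIT; reflexivity.
by rewrite integral_flip.
Qed.

Lemma integral_llr_law (f : \bar R -> R) : measurable_fun setT f ->
  (forall r, 0 <= f r) ->
  (\int[llr_law P]_r (f r)%:E =
  \int[P]_(t in `[0%R, 2^-1%R]) ((1 - t) * f (llr t) + t * f (- llr t)%E)%:E)%E.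
Proof.
move=> mf f0; rewrite ge0_integral_distribution; [|exact/measurable_EFinP|by move=> r; rewrite lee_fin].
rewrite (integral_delta_channel true (f := f \o signed_llr))//.
  exact: measurableT_comp.
by move=> z; exact: f0.
Qed.

End delta_channel_integral.

(** * Symmetric log-likelihood ratios and their sums *)

Section symmetric_laws.
Context {R : realType}.
Implicit Types (phi : \bar R -> R).

Notation th := (@tanh_half R).

Definition symmetrize phi (r : \bar R) : R :=
  (1 + th r) / 2 * phi r + (1 - th r) / 2 * phi (- r)%E.

Lemma symmetrize_ge0 phi r : (forall r, 0 <= phi r) -> 0 <= symmetrize phi r.
Proof.
move=> phi0; have /andP[h1 h2] := tanh_half_le1 r.
by apply: addr_ge0; apply: mulr_ge0 => //; lra.
Qed.

Lemma measurable_symmetrize phi : measurable_fun setT phi ->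
  measurable_fun setT (symmetrize phi).
Proof.
move=> mphi; have mth := @measurable_tanh_half R.
apply: measurable_funD; apply: measurable_funM.
- by apply: measurable_funM => //; exact: measurable_funD.
- exact: mphi.
- by apply: measurable_funM => //; exact: measurable_funB.
- by apply: measurableT_comp.
Qed.

(** [symmetrize phi] is a conditional mean given |r|, hence already a function of |r|. A law whose
    integrals of phi can be written through [symmetrize phi] is therefore symmetric. *)
Lemma symmetrize_idem phi r : symmetrize (symmetrize phi) r = symmetrize phi r.
Proof. by rewrite {1}/symmetrize /symmetrize oppeK tanh_halfN; field. Qed.

(* X is the log-likelihood ratio of a BMS channel: its law satisfies
   dP(-r) = e^{-r} dP(r), so phi may be averaged over the two values r and -r
   given |r|. *)
Definition symmetric_llr d (T : measurableType d) (mu : probability T R)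
    (X : T -> \bar R) :=
  forall phi, measurable_fun setT phi -> (forall r, 0 <= phi r) ->
  (\int[mu]_t (phi (X t))%:E = \int[mu]_t (symmetrize phi (X t))%:E)%E.

Section sum.
Context d1 d2 (T1 : measurableType d1) (T2 : measurableType d2).
Variables (mu1 : probability T1 R) (mu2 : probability T2 R).
Variables (X1 : T1 -> R) (X2 : T2 -> \bar R).
Hypotheses (mX1 : measurable_fun setT X1) (mX2 : measurable_fun setT X2).
Hypotheses (sX1 : symmetric_llr mu1 (EFin \o X1)) (sX2 : symmetric_llr mu2 X2).

(** The conditional mean of phi (X1 + X2) given |X1| and |X2|: with u = th x and v = th r, the
    probability that the product of the two signs is the one shown by x and r is (1 + u v) / 2. *)
Definition symmetrize2 phi (x : R) (r : \bar R) : R :=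
  (1 + th x%:E * th r) / 2 * symmetrize phi (x%:E + r)%E +
  (1 - th x%:E * th r) / 2 * symmetrize phi (x%:E - r)%E.

(** Averaging over one sign at a time gives weights such as (1 + u) (1 + v) / 4; by the addition
    formula this is (1 + u v) / 2 times (1 + w) / 2 with w = (u + v) / (1 + u v). *)
Lemma symmetrize2E phi x r : symmetrize2 phi x r =
  symmetrize (fun q => symmetrize (fun s => phi (s + q)%E) x%:E) r.
Proof.
rewrite /symmetrize2 /symmetrize !tanh_halfD !tanh_halfN.
have -> : (- (x%:E + r) = (- x%:E)%E - r)%E by case: r => [y||]//; rewrite -!EFinN -!EFinD opprD.
have -> : (- (x%:E - r) = (- x%:E)%E + r)%E by case: r => [y||]//; rewrite -!EFinN -!EFinD opprB addrC.
have /andP[h1 h2] := tanh_half_mul_le1 x r.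
have ? : 1 + th x%:E * th r != 0 by rewrite gt_eqF//; lra.
have ? : 1 - th x%:E * th r != 0 by rewrite gt_eqF//; lra.
have ? : 1 + th x%:E * (- th r) != 0 by rewrite mulrN.
by field; rewrite ?mulrN; do ? (apply/andP; split).
Qed.

(** By independence each variable can be symmetrized with the other one frozen; Tonelli exchanges
    the integrals in between. *)
Lemma integral_sym_add phi : measurable_fun setT phi -> (forall r, 0 <= phi r) ->
  (\int[mu1 \x mu2]_z (phi ((X1 z.1)%:E + X2 z.2)%E)%:E =
   \int[mu1 \x mu2]_z (symmetrize2 phi (X1 z.1) (X2 z.2))%:E)%E.
Proof.
move=> mphi phi0.
have madd : measurable_fun setT (fun z : R * \bar R => phi (z.1%:E + z.2)%E).
  apply: (measurableT_comp (f := phi)) => //; apply: emeasurable_funD => //.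
  exact/measurable_EFinP.
have mphi1 x : measurable_fun setT (fun r : \bar R => phi (x%:E + r)%E).
  by apply: (measurableT_comp (f := phi)) => //; exact: emeasurable_funD.
have mphi2 r : measurable_fun setT (fun s : \bar R => phi (s + r)%E).
  by apply: (measurableT_comp (f := phi)) => //; exact: emeasurable_funD.
have mX12 : measurable_fun setT (fun z : T1 * T2 => (X1 z.1, X2 z.2)).
  by apply: measurable_fun_pair; exact: measurableT_comp.
pose psi x r := symmetrize (fun q => phi (x%:E + q)%E) r.
have mpsi : measurable_fun setT (fun z : R * \bar R => psi z.1 z.2).
  have mt2 : measurable_fun setT (fun z : R * \bar R => th z.2).
    by apply: measurableT_comp => //; exact: measurable_tanh_half.
  apply: measurable_funD; apply: measurable_funM => //.
  - by apply: measurable_funM => //; exact: measurable_funD.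
  - by apply: measurable_funM => //; exact: measurable_funB.
  - apply: (measurableT_comp (f := phi)) => //; apply: emeasurable_funD => //.
      exact/measurable_EFinP.
    exact: measurableT_comp.
rewrite fubini_tonelli1; last 2 first.
- by apply/measurable_EFinP; exact: (measurableT_comp madd mX12).
- by move=> z; rewrite lee_fin.
transitivity (\int[mu1]_x \int[mu2]_y (psi (X1 x) (X2 y))%:E)%E.
  apply: eq_integral => x _; rewrite /fubini_F/=.
  exact: (sX2 (mphi1 (X1 x)) (fun r => phi0 _)).
transitivity (\int[mu2]_y \int[mu1]_x (psi (X1 x) (X2 y))%:E)%E.
  apply: (@fubini_tonelli _ _ _ _ _ mu1 mu2 (fun z => (psi (X1 z.1) (X2 z.2))%:E)).
    by apply/measurable_EFinP; exact: (measurableT_comp mpsi mX12).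
  by move=> z; rewrite lee_fin; exact: symmetrize_ge0.
rewrite fubini_tonelli2; last 2 first.
- apply/measurable_EFinP.
  suff ms2 : measurable_fun setT (fun z : R * \bar R => symmetrize2 phi z.1 z.2).
    exact: (measurableT_comp ms2 mX12).
  have mt1 : measurable_fun setT (fun z : R * \bar R => th z.1%:E).
    apply: measurableT_comp; first exact: measurable_tanh_half.
    exact/measurable_EFinP.
  have mt2 : measurable_fun setT (fun z : R * \bar R => th z.2).
    by apply: measurableT_comp => //; exact: measurable_tanh_half.
  have mz1 : measurable_fun setT (fun z : R * \bar R => z.1%:E).
    exact/measurable_EFinP.
  have mz2 : measurable_fun setT (fun z : R * \bar R => (- z.2)%E).
    exact: measurableT_comp.
  have ms := measurable_symmetrize mphi.
  apply: measurable_funD; apply: measurable_funM => //.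
  + by apply: measurable_funM => //; apply: measurable_funD => //; exact: measurable_funM.
  + by apply: (measurableT_comp (f := symmetrize phi)) => //; exact: emeasurable_funD.
  + by apply: measurable_funM => //; apply: measurable_funB => //; exact: measurable_funM.
  + by apply: (measurableT_comp (f := symmetrize phi)) => //; exact: emeasurable_funD.
- move=> z; rewrite lee_fin symmetrize2E; apply: symmetrize_ge0 => q.
  by apply: symmetrize_ge0.
apply: eq_integral => y _; rewrite /fubini_G/=.
have /andP[h1 h2] := tanh_half_le1 (X2 y).
pose chi (s : \bar R) := symmetrize (fun q => phi (s + q)%E) (X2 y).
have mchi : measurable_fun setT chi.
  by apply: measurable_funD; apply: measurable_funM.
have chi0 s : 0 <= chi s by apply: symmetrize_ge0.
rewrite [LHS](sX1 mchi chi0); apply: eq_integral => x _; congr EFin.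
by rewrite symmetrize2E /chi /symmetrize/=; field.
Qed.

(** [symmetrize2 phi] depends on phi only through [symmetrize phi], so replacing phi by the latter
    leaves the integral unchanged. *)
Lemma symmetric_llr_add :
  symmetric_llr (mu1 \x mu2)%E (fun z => (X1 z.1)%:E + X2 z.2)%E.
Proof.
move=> phi mphi phi0; rewrite integral_sym_add//.
have := integral_sym_add (measurable_symmetrize mphi) (fun r => symmetrize_ge0 r phi0).
move=> ->; apply: eq_integral => z _; congr EFin.
by rewrite /symmetrize2 !symmetrize_idem.
Qed.

End sum.

Lemma symmetric_llr_distribution d d' (T : measurableType d) (T' : measurableType d')
    (mu : probability T R) (h : {RV mu >-> T'}) (X : T' -> \bar R) :
  measurable_fun setT X ->
  symmetric_llr mu (X \o h) -> symmetric_llr (distribution mu h) X.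
Proof.
move=> mX sX phi mphi phi0.
have mS := measurable_symmetrize mphi.
rewrite !ge0_integral_distribution; last 4 first.
- by apply/measurable_EFinP; exact: (measurableT_comp mS mX).
- by move=> y; rewrite lee_fin; exact: symmetrize_ge0.
- by apply/measurable_EFinP; exact: (measurableT_comp mphi mX).
- by move=> y; rewrite lee_fin.
exact: sX.
Qed.

Lemma symmetric_llr_llr_law (P : delta_dist R) : symmetric_llr (llr_law P) idfun.
Proof.
move=> phi mphi phi0; rewrite !integral_llr_law//; last 2 first.
- exact: measurable_symmetrize.
- by move=> r; exact: symmetrize_ge0.
apply: eq_integral => t /[!inE]/=; rewrite in_itv/= => t01; congr EFin.
by rewrite /symmetrize oppeK tanh_halfN tanh_half_llr//; field.
Qed.

End symmetric_laws.

(* For f even, the expectation of f (1 - 2 Delta) for the BMS channel whose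
   log-likelihood ratio is X. *)
HB.lock Definition llr_ex {R : realType} {d} {T : measurableType d}
    (mu : probability T R) (X : T -> \bar R) (f : R -> R) : R :=
  \int[mu]_t f (tanh_half (X t)).

(** * Even convex test functions and sums of two independent observations *)

Section expectation.
Context {R : realType}.
Implicit Types (f g : R -> R).

Notation th := (@tanh_half R).

(** Bounds are asked on [-1, 1] only, the range of [tanh_half], since test functions such as u^2 are
    unbounded on the line. *)
Definition bounded_fun11 f := measurable_fun setT f /\
  exists M, forall u : R, -1 <= u <= 1 -> `|f u| <= M.

Lemma bounded_fun11_cst c : bounded_fun11 (fun=> c).
Proof. by split; [exact: measurable_cst|exists `|c|]. Qed.

Lemma bounded_fun11_lin a b f g : bounded_fun11 f -> bounded_fun11 g ->
  bounded_fun11 (fun u => a * f u + b * g u).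
Proof.
move=> [mf [M fM]] [mg [N gN]]; split.
  by apply: measurable_funD; exact: measurable_funM.
exists (`|a| * M + `|b| * N) => u u11; rewrite (le_trans (ler_normD _ _))// !normrM.
by apply: lerD; apply: ler_wpM2l => //; [exact: fM|exact: gN].
Qed.

Section ex.
Context d (T : measurableType d) (mu : probability T R) (X : T -> \bar R).
Hypothesis mX : measurable_fun setT X.

Lemma exU f : llr_ex mu X f = \int[mu]_t f (th (X t)).
Proof. by rewrite llr_ex.unlock. Qed.

Local Notation E := (llr_ex mu X).

Lemma measurable_th_llr : measurable_fun setT (th \o X).
Proof. by apply: measurableT_comp => //; exact: measurable_tanh_half. Qed.

Lemma integrable_ex f : bounded_fun11 f ->
  mu.-integrable setT (EFin \o (fun t => f (th (X t)))).
Proof.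
move=> [mf [M fM]]; apply: measurable_bounded_integrable => //.
- exact: (le_lt_trans (probability_le1 _ measurableT) (ltry _)).
- exact: (measurableT_comp mf measurable_th_llr).
- exists M; split; first exact: num_real.
  by move=> N MN t _ /=; rewrite (le_trans (fM _ (tanh_half_le1 _)))// ltW.
Qed.

Lemma exE f : bounded_fun11 f -> (\int[mu]_t (f (th (X t)))%:E = (E f)%:E)%E.
Proof.
by move=> /integrable_ex/integrable_fin_num => /(_ measurableT) h; rewrite exU /Rintegral fineK.
Qed.

Lemma ex_lin a b f g : bounded_fun11 f -> bounded_fun11 g ->
  E (fun u => a * f u + b * g u) = a * E f + b * E g.
Proof.
move=> bf bg; have b0 := bounded_fun11_cst 0.
have Z c h : bounded_fun11 h -> mu.-integrable setT (EFin \o (fun t => c * h (th (X t)))).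
  move=> bh; have := integrable_ex (bounded_fun11_lin c 0 bh b0).
  by apply: eq_integrable => // t _ /=; rewrite mulr0 addr0.
rewrite !exU RintegralD//; [|exact: Z|exact: Z].
by rewrite !RintegralZl//; exact: integrable_ex.
Qed.

Lemma ex_cst c : E (fun=> c) = c.
Proof.
by rewrite exU /Rintegral integral_cst//= probability_setT mule1.
Qed.

Lemma ex_le f g : bounded_fun11 f -> bounded_fun11 g ->
  (forall u : R, -1 <= u <= 1 -> f u <= g u) -> E f <= E g.
Proof.
move=> bf bg fg; rewrite !exU; apply: le_Rintegral => //; [exact: integrable_ex|exact: integrable_ex|].
by move=> t _; apply: fg; exact: tanh_half_le1.
Qed.

Lemma eq_ex f g : (forall u : R, -1 <= u <= 1 -> f u = g u) -> E f = E g.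
Proof. by move=> fg; rewrite !exU; apply: eq_Rintegral => t _; apply: fg; exact: tanh_half_le1. Qed.

Lemma ex_ge0 f : (forall u : R, -1 <= u <= 1 -> 0 <= f u) -> 0 <= E f.
Proof. by move=> f0; rewrite exU; apply: Rintegral_ge0 => t _; apply: f0; exact: tanh_half_le1. Qed.

End ex.

(** The slack e is forced by 1 - sqrt (1 - u^2), which has no affine minorant touching it at u = 1.
    Being a supremum of affine functions also makes f continuous up to the end ([even_convex_near]).
    Nonnegativity serves Tonelli. *)
Definition even_convex f := [/\ measurable_fun setT f,
  forall u, f (- u) = f u, forall u : R, -1 <= u <= 1 -> 0 <= f u &
  forall a e : R, -1 <= a <= 1 -> 0 < e -> exists c s : R,
    f a - e <= c + s * a /\ forall u : R, -1 <= u <= 1 -> c + s * u <= f u].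

(** A near-minorant at u is affine and u lies between -v and v, so its value at v or at -v is at
    least its value at u; both are below f v. *)
Lemma even_convex_mono f (u v : R) : even_convex f -> 0 <= u -> u <= v -> v <= 1 -> f u <= f v.
Proof.
move=> [_ fN _ fc] u0 uv v1; apply/ler_addgt0Pr => e e0.
have u11 : -1 <= u <= 1 by apply/andP; split; lra.
have v11 : -1 <= v <= 1 by apply/andP; split; lra.
have w11 : -1 <= - v <= 1 by apply/andP; split; lra.
have [c [s [h1 h2]]] := fc u e u11 e0.
have h3 := h2 v v11; have := h2 (- v) w11; rewrite fN => h4.
have [s0|s0] := leP 0 s; nra.
Qed.

Lemma even_convex_norm f u : even_convex f -> f `|u| = f u.
Proof. by move=> [_ fN _ _]; case: (leP 0 u) => u0; rewrite ?(ger0_norm u0)// ltr0_norm. Qed.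

Lemma even_convex_le1 f u : even_convex f -> -1 <= u <= 1 -> f u <= f 1.
Proof.
move=> fc u11; rewrite -(even_convex_norm u fc); apply: even_convex_mono => //.
by rewrite ler_norml.
Qed.

Lemma even_convex_bounded f : even_convex f -> bounded_fun11 f.
Proof.
move=> fc; have [mf _ f0 _] := fc; split => //; exists (f 1) => u u11.
by rewrite ger0_norm ?f0// even_convex_le1.
Qed.

(* Conditionally on |th X1| = u and |th X2| = v, |th (X1 + X2)| is
   (u + v) / (1 + u v) with probability (1 + u v) / 2 and |u - v| / (1 - u v)
   otherwise. *)
Definition bms_add f u v : R :=
  (1 + u * v) / 2 * f ((u + v) / (1 + u * v)) +
  (1 - u * v) / 2 * f ((u - v) / (1 - u * v)).

Lemma bms_addC f u v : (forall u, f (- u) = f u) -> bms_add f u v = bms_add f v u.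
Proof.
move=> fN; rewrite /bms_add [v * u]mulrC [v + u]addrC; congr (_ + _ * _).
by rewrite -[RHS]fN; congr f; rewrite -[RHS]mulNr opprB.
Qed.

Lemma bms_addN f u v : (forall u, f (- u) = f u) -> bms_add f (- u) v = bms_add f u v.
Proof.
move=> fN; rewrite /bms_add mulNr opprK addrC; congr (_ * _ + _ * _).
  by rewrite -[RHS]fN; congr f; rewrite -[RHS]mulNr opprD.
by rewrite -[RHS]fN; congr f; rewrite -[RHS]mulNr opprB addrC.
Qed.

Lemma div_norm_le1 (a b : R) : `|a| <= b -> -1 <= a / b <= 1.
Proof.
move=> ab; rewrite -ler_norml normrM normfV.
have b0 : 0 <= b := le_trans (normr_ge0 _) ab.
rewrite (ger0_norm b0); move: b0; rewrite le_eqVlt => /predU1P[<-|b0].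
  by rewrite invr0 mulr0.
by rewrite ler_pdivrMr// mul1r.
Qed.

Lemma mul_affine (w x y c s : R) : w * x = y -> w * (c + s * x) = w * c + s * y.
Proof. by move=> <-; ring. Qed.

Section unit_square.
Variables (u v : R).
Hypotheses (u11 : -1 <= u <= 1) (v11 : -1 <= v <= 1).

Lemma weights_ge0 : 0 <= 1 + u * v /\ 0 <= 1 - u * v.
Proof.
have : `|u * v| <= 1 by rewrite normrM mulr_ile1// ler_norml.
by rewrite ler_norml => /andP[? ?]; split; lra.
Qed.

Lemma bms_arg_le1 : -1 <= (u + v) / (1 + u * v) <= 1 /\ -1 <= (u - v) / (1 - u * v) <= 1.
Proof.
move/andP: u11 => [u1 u2]; move/andP: v11 => [v1 v2].
by split; apply: div_norm_le1; rewrite ler_norml; apply/andP; split; nra.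
Qed.

(** Each denominator vanishes only at two corners of the square, where its numerator vanishes too;
    the convention 0 / 0 = 0 then keeps the identities true. *)
Lemma bms_argK : (1 + u * v) * ((u + v) / (1 + u * v)) = u + v /\
  (1 - u * v) * ((u - v) / (1 - u * v)) = u - v.
Proof.
move/andP: u11 => [u1 u2]; move/andP: v11 => [v1 v2].
split; rewrite mulrCA.
  have [E|E] := eqVneq (1 + u * v) 0; last by rewrite divff ?mulr1.
  have -> : u + v = 0 by nra.
  by rewrite mul0r.
have [E|E] := eqVneq (1 - u * v) 0; last by rewrite divff ?mulr1.
have -> : u - v = 0 by nra.
by rewrite mul0r.
Qed.

End unit_square.

(** Jensen: with weights (1 + u v) / 2 and (1 - u v) / 2 the two arguments average to u. *)
Lemma even_convex_bms_ge f u v : even_convex f -> -1 <= u <= 1 -> -1 <= v <= 1 ->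
  f u <= bms_add f u v.
Proof.
move=> [_ _ _ fc] u11 v11; apply/ler_addgt0Pr => e e0.
have [c [s [h1 h2]]] := fc u e u11 e0.
have [w1 w2] := weights_ge0 u11 v11; have [a1 a2] := bms_arg_le1 u11 v11.
have [k1 k2] := bms_argK u11 v11.
have := ler_wpM2l w1 (h2 _ a1); have := ler_wpM2l w2 (h2 _ a2).
rewrite (mul_affine _ _ k1) (mul_affine _ _ k2) /bms_add; lra.
Qed.

Lemma measurable_bms_add f : measurable_fun setT f ->
  measurable_fun setT (fun z : R * R => bms_add f z.1 z.2).
Proof.
move=> mf; have mM : measurable_fun setT (fun z : R * R => z.1 * z.2).
  exact: measurable_funM.
have mi := @measurable_invr R.
apply: measurable_funD; apply: measurable_funM.
- by apply: measurable_funM => //; exact: measurable_funD.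
- apply: measurableT_comp => //; apply: measurable_funM; first exact: measurable_funD.
  by apply: measurableT_comp => //; exact: measurable_funD.
- by apply: measurable_funM => //; exact: measurable_funB.
- apply: measurableT_comp => //; apply: measurable_funM; first exact: measurable_funB.
  by apply: measurableT_comp => //; exact: measurable_funB.
Qed.

(* The perspective of an affine minorant of f is affine in u. *)
Lemma even_convex_bms_add f v : even_convex f -> -1 <= v <= 1 ->
  even_convex (bms_add f ^~ v).
Proof.
move=> [mf fN f0 fc] v11; split.
- exact: (measurable_fun_pair1 (f := fun z => bms_add f z.1 z.2) _ (measurable_bms_add mf)).
- by move=> u; exact: bms_addN.
- move=> u u11; have [w1 w2] := weights_ge0 u11 v11; have [a1 a2] := bms_arg_le1 u11 v11.
  by apply: addr_ge0; apply: mulr_ge0; rewrite ?f0// divr_ge0.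
- move=> a e a11 e0.
  have [a1 a2] := bms_arg_le1 a11 v11; have [w1 w2] := weights_ge0 a11 v11.
  have [c1 [s1 [h1 h1']]] := fc _ e a1 e0; have [c2 [s2 [h2 h2']]] := fc _ e a2 e0.
  (* Coefficients of (1 + u v) / 2 times the first minorant at (u + v) / (1 + u v) plus (1 - u v) /
     2 times the second one at (u - v) / (1 - u v). *)
  exists ((c1 + c2 + s1 * v - s2 * v) / 2); exists ((c1 * v - c2 * v + s1 + s2) / 2).
  have [k1 k2] := bms_argK a11 v11; split.
    have := ler_wpM2l w1 h1; have := ler_wpM2l w2 h2.
    rewrite (mul_affine _ _ k1) (mul_affine _ _ k2) /bms_add !mulrBr; lra.
  move=> u u11; have [b1 b2] := bms_arg_le1 u11 v11; have [x1 x2] := weights_ge0 u11 v11.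
  have [l1 l2] := bms_argK u11 v11.
  have := ler_wpM2l x1 (h1' _ b1); have := ler_wpM2l x2 (h2' _ b2).
  rewrite (mul_affine _ _ l1) (mul_affine _ _ l2) /bms_add; lra.
Qed.

Lemma bounded_bms_add f v : bounded_fun11 f -> -1 <= v <= 1 ->
  bounded_fun11 (bms_add f ^~ v).
Proof.
move=> [mf [M fM]] v11; split.
  exact: (measurable_fun_pair1 (f := fun z => bms_add f z.1 z.2) _ (measurable_bms_add mf)).
exists M => u u11; have [w1 w2] := weights_ge0 u11 v11; have [a1 a2] := bms_arg_le1 u11 v11.
have x1 : `|(1 + u * v) / 2| = (1 + u * v) / 2 by rewrite ger0_norm//; lra.
have x2 : `|(1 - u * v) / 2| = (1 - u * v) / 2 by rewrite ger0_norm//; lra.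
rewrite (le_trans (ler_normD _ _))// (normrM ((1 + u * v) / 2)) (normrM ((1 - u * v) / 2)) x1 x2.
have := ler_wpM2l w1 (fM _ a1); have := ler_wpM2l w2 (fM _ a2); lra.
Qed.

Section ex_add.
Context d1 d2 (T1 : measurableType d1) (T2 : measurableType d2).
Variables (mu1 : probability T1 R) (mu2 : probability T2 R).
Variables (X1 : T1 -> R) (X2 : T2 -> \bar R).
Hypotheses (mX1 : measurable_fun setT X1) (mX2 : measurable_fun setT X2).
Hypotheses (sX1 : symmetric_llr mu1 (EFin \o X1)) (sX2 : symmetric_llr mu2 X2).
Variable f : R -> R.
Hypotheses (bf : bounded_fun11 f) (fN : forall u, f (- u) = f u).
Hypothesis f0 : forall u : R, -1 <= u <= 1 -> 0 <= f u.

Let mEX1 : measurable_fun setT (EFin \o X1).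
Proof. exact/measurable_EFinP. Qed.

Lemma measurable_llr_add :
  measurable_fun setT (fun z : T1 * T2 => ((X1 z.1)%:E + X2 z.2)%E).
Proof.
apply: emeasurable_funD; first by apply/measurable_EFinP; exact: measurableT_comp.
exact: measurableT_comp.
Qed.

Let mK : measurable_fun setT (fun z : T1 * T2 => bms_add f (th (X1 z.1)%:E) (th (X2 z.2))).
Proof.
have := measurable_bms_add bf.1 => mb.
apply: (measurableT_comp mb (g := fun z => (th (X1 z.1)%:E, th (X2 z.2)))).
apply: measurable_fun_pair.
  exact: (measurableT_comp (measurable_th_llr mEX1)).
exact: (measurableT_comp (measurable_th_llr mX2)).
Qed.

Let K0 (z : T1 * T2) : (0 <= (bms_add f (th (X1 z.1)%:E) (th (X2 z.2)))%:E)%E.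
Proof.
have u11 := tanh_half_le1 (X1 z.1)%:E; have v11 := tanh_half_le1 (X2 z.2).
have [w1 w2] := weights_ge0 u11 v11; have [a1 a2] := bms_arg_le1 u11 v11.
by rewrite lee_fin; apply: addr_ge0; apply: mulr_ge0; rewrite ?f0// divr_ge0.
Qed.

Let exK : ((llr_ex (mu1 \x mu2)%E (fun z => (X1 z.1)%:E + X2 z.2)%E f)%:E =
  \int[mu1 \x mu2]_z (bms_add f (th (X1 z.1)%:E) (th (X2 z.2)))%:E)%E.
Proof.
rewrite -exE//; last exact: measurable_llr_add.
have := @integral_sym_add R _ _ _ _ mu1 mu2 X1 X2 mX1 mX2 sX1 sX2 (f \o th).
move=> ->; last 2 first.
- exact: (measurableT_comp bf.1 (@measurable_tanh_half R)).
- by move=> r; apply: f0; exact: tanh_half_le1.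
apply: eq_integral => z _; congr EFin.
have S r : symmetrize (f \o th) r = f (th r).
  by rewrite /symmetrize/= tanh_halfN fN; field.
by rewrite /symmetrize2 !S !tanh_halfD tanh_halfN mulrN.
Qed.

(** Conditioning on X2: if f is even convex, so is the function of th X1 inside, and order
    statements about X1 apply under the outer integral. [ex_add1] conditions on X1 instead. *)
Lemma ex_add2 : ((llr_ex (mu1 \x mu2)%E (fun z => (X1 z.1)%:E + X2 z.2)%E f)%:E =
  \int[mu2]_y (llr_ex mu1 (EFin \o X1) (bms_add f ^~ (th (X2 y))))%:E)%E.
Proof.
rewrite exK fubini_tonelli2//; last exact/measurable_EFinP.
apply: eq_integral => y _; rewrite /fubini_G/= -exE//.
by apply: bounded_bms_add => //; exact: tanh_half_le1.
Qed.

Lemma ex_add1 : ((llr_ex (mu1 \x mu2)%E (fun z => (X1 z.1)%:E + X2 z.2)%E f)%:E =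
  \int[mu1]_x (llr_ex mu2 X2 (bms_add f ^~ (th (X1 x)%:E)))%:E)%E.
Proof.
rewrite exK fubini_tonelli1//; last exact/measurable_EFinP.
apply: eq_integral => x _; rewrite /fubini_F/= -exE//; last first.
  by apply: bounded_bms_add => //; exact: tanh_half_le1.
by apply: eq_integral => y _; rewrite bms_addC.
Qed.

Lemma integrable_ex_add2 : mu2.-integrable setT
  (EFin \o (fun y => llr_ex mu1 (EFin \o X1) (bms_add f ^~ (th (X2 y))))).
Proof.
have E : EFin \o (fun y => llr_ex mu1 (EFin \o X1) (bms_add f ^~ (th (X2 y)))) =
    fubini_G mu1 (fun z : T1 * T2 => (bms_add f (th (X1 z.1)%:E) (th (X2 z.2)))%:E).
  apply/funext => y; rewrite /fubini_G/= -exE//.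
  by apply: bounded_bms_add => //; exact: tanh_half_le1.
apply/integrableP; split.
  by rewrite E; apply: measurable_fun_fubini_tonelli_G => //; exact/measurable_EFinP.
rewrite (eq_integral (EFin \o (fun y => llr_ex mu1 (EFin \o X1) (bms_add f ^~ (th (X2 y)))))).
  by rewrite -ex_add2 ltry.
move=> y _; rewrite gee0_abs// E; apply: integral_ge0 => x _; exact: K0.
Qed.

Lemma integrable_ex_add1 : mu1.-integrable setT
  (EFin \o (fun x => llr_ex mu2 X2 (bms_add f ^~ (th (X1 x)%:E)))).
Proof.
have E : EFin \o (fun x => llr_ex mu2 X2 (bms_add f ^~ (th (X1 x)%:E))) =
    fubini_F mu2 (fun z : T1 * T2 => (bms_add f (th (X1 z.1)%:E) (th (X2 z.2)))%:E).
  apply/funext => x; rewrite /fubini_F/= -exE//; last first.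
    by apply: bounded_bms_add => //; exact: tanh_half_le1.
  by apply: eq_integral => y _; rewrite bms_addC.
apply/integrableP; split.
  by rewrite E; apply: measurable_fun_fubini_tonelli_F => //; exact/measurable_EFinP.
rewrite (eq_integral (EFin \o (fun x => llr_ex mu2 X2 (bms_add f ^~ (th (X1 x)%:E))))).
  by rewrite -ex_add1 ltry.
move=> x _; rewrite gee0_abs// E; apply: integral_ge0 => y _; exact: K0.
Qed.

Lemma Rintegral_ex_add2 : llr_ex (mu1 \x mu2)%E (fun z => (X1 z.1)%:E + X2 z.2)%E f =
  \int[mu2]_y llr_ex mu1 (EFin \o X1) (bms_add f ^~ (th (X2 y))).
Proof. by rewrite /Rintegral -ex_add2. Qed.

Lemma Rintegral_ex_add1 : llr_ex (mu1 \x mu2)%E (fun z => (X1 z.1)%:E + X2 z.2)%E f =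
  \int[mu1]_x llr_ex mu2 X2 (bms_add f ^~ (th (X1 x)%:E)).
Proof. by rewrite /Rintegral -ex_add1. Qed.

End ex_add.

End expectation.

(** * Test functions: Bhattacharyya, squared excess, and their convexity *)

Section test_functions.
Context {R : realType}.
Implicit Types (f g : R -> R) (a b t u v theta : R).

(** At u = 1 - 2 t this is 2 sqrt (t (1 - t)), the integrand of the Bhattacharyya parameter. *)
Definition bhatt u : R := Num.sqrt (1 - u ^+ 2).

(** For t >= 0 its second derivative is 2 where |u| > t and 0 where |u| < t: small enough for half
    of it to be subtracted from 1 - [bhatt] without losing convexity, and rich enough to recover
    tails by differences in t. *)
Definition sqr_excess t u : R := (Num.max 0 (`|u| - t)) ^+ 2.

Lemma bhatt_ge0 u : 0 <= bhatt u. Proof. exact: sqrtr_ge0. Qed.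

Lemma bhattN u : bhatt (- u) = bhatt u. Proof. by rewrite /bhatt sqrrN. Qed.

Lemma bhatt_sqr u : -1 <= u <= 1 -> bhatt u ^+ 2 = 1 - u ^+ 2.
Proof. by move=> /andP[? ?]; rewrite sqr_sqrtr//; nra. Qed.

Lemma bhatt_le1 u : bhatt u <= 1.
Proof. by rewrite -[leRHS]sqrtr1 ler_wsqrtr// gerBl sqr_ge0. Qed.

Lemma measurable_bhatt : measurable_fun setT bhatt.
Proof.
have ms : measurable_fun setT (@Num.sqrt R).
  by apply: continuous_measurable_fun; exact: sqrt_continuous.
apply: (measurableT_comp ms).
by apply: measurable_funB => //; exact: measurable_funX.
Qed.

Lemma bounded_bhatt : bounded_fun11 bhatt.
Proof.
split; first exact: measurable_bhatt.
by exists 1 => u _; rewrite ger0_norm ?bhatt_le1// bhatt_ge0.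
Qed.

Lemma measurable_scale f theta : measurable_fun setT f ->
  measurable_fun setT (fun u => f (theta * u)).
Proof. by move=> mf; apply: measurableT_comp => //; exact: measurable_funM. Qed.

Lemma scale11 theta u : 0 <= theta <= 1 -> -1 <= u <= 1 -> -1 <= theta * u <= 1.
Proof.
rewrite -!ler_norml normrM => /andP[t0 t1] u1.
by rewrite (ger0_norm t0) mulr_ile1.
Qed.

Lemma bounded_scale f theta : 0 <= theta <= 1 -> bounded_fun11 f ->
  bounded_fun11 (fun u => f (theta * u)).
Proof.
move=> t01 [mf [M fM]]; split; first exact: measurable_scale.
by exists M => u u11; apply: fM; exact: scale11.
Qed.

Lemma even_convex_scale f theta : 0 <= theta <= 1 -> even_convex f ->
  even_convex (fun u => f (theta * u)).
Proof.
move=> t01 [mf fN f0 fc]; split.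
- exact: measurable_scale.
- by move=> u; rewrite mulrN.
- by move=> u u11; apply: f0; exact: scale11.
- move=> a e a11 e0; have [c [s [h1 h2]]] := fc _ e (scale11 t01 a11) e0.
  exists c, (s * theta); split; first by rewrite -mulrA.
  by move=> u u11; rewrite -mulrA; apply: h2; exact: scale11.
Qed.

(** Slack is needed at the end a = 1 only; the other a >= 0 have a true subgradient, and evenness
    takes care of negative a. *)
Lemma even_convexI f : measurable_fun setT f -> (forall u, f (- u) = f u) ->
  (forall u, -1 <= u <= 1 -> 0 <= f u) ->
  (forall a, 0 <= a < 1 -> exists s, forall u, -1 <= u <= 1 ->
     f a + s * (u - a) <= f u) ->
  (forall e : R, 0 < e -> exists s, forall u, -1 <= u <= 1 ->
     f 1 - e + s * (u - 1) <= f u) ->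
  even_convex f.
Proof.
move=> mf fN f0 fin f1; split => //.
have pos a e : 0 <= a <= 1 -> 0 < e -> exists c s : R,
    f a - e <= c + s * a /\ forall u, -1 <= u <= 1 -> c + s * u <= f u.
  move=> /andP[a0]; rewrite le_eqVlt => /predU1P[->|a1] e0.
    have [s h] := f1 e e0; exists (f 1 - e - s), s; split; first by lra.
    by move=> u /h; lra.
  have [|s h] := fin a; first by rewrite a0.
  exists (f a - s * a), s; split; first by lra.
  by move=> u /h; lra.
move=> a e /andP[a1 a2] e0; have [a0|a0] := leP 0 a; first by apply: pos; rewrite ?a0.
have [|c [s [h1 h2]]] := pos (- a) e _ e0; first by apply/andP; split; lra.
exists c, (- s); split; first by rewrite mulNr -mulrN -fN.
by move=> u /andP[? ?]; rewrite mulNr -mulrN -fN; apply: h2; apply/andP; split; lra.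
Qed.

Lemma bhatt_gt0 a : -1 < a < 1 -> 0 < bhatt a.
Proof. by move=> /andP[? ?]; rewrite sqrtr_gt0; nra. Qed.

(* The Bregman divergence of -sqrt (1 - u^2), multiplied by sqrt (1 - a^2). *)
Lemma bhatt_bregman a u : -1 <= a <= 1 -> -1 <= u <= 1 ->
  bhatt a * (bhatt a - bhatt u) - a * (u - a) =
  ((a - u) ^+ 2 + (bhatt a - bhatt u) ^+ 2) / 2.
Proof.
move=> /bhatt_sqr + /bhatt_sqr; move: (bhatt a) (bhatt u) => A U hA hU.
have -> : (A - U) ^+ 2 = A ^+ 2 - 2 * A * U + U ^+ 2 by ring.
have -> : A * (A - U) = A ^+ 2 - A * U by ring.
by rewrite hA hU; field.
Qed.

(** The inequality of means gives sqrt (1 - u^2) <= e + (1 - u^2) / (4 e), and 1 + u <= 2; hence the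
    slope 1 / (2 e), which must blow up as e tends to 0. *)
Lemma bhatt_le_affine (e : R) : 0 < e -> exists s, forall u, -1 <= u <= 1 ->
  bhatt u <= e - s * (u - 1).
Proof.
move=> e0; exists (2 * e)^-1 => u /andP[u1 u2].
have i0 : 0 < (2 * e)^-1 by rewrite invr_gt0; lra.
have ie : (2 * e)^-1 * (2 * e) = 1 by rewrite mulVf//; lra.
move: i0 ie; set i := (2 * e)^-1 => i0 ie.
have r0 : 0 <= e - i * (u - 1) by nra.
rewrite -(ler_pXn2r (n := 2)) ?nnegrE ?bhatt_ge0//.
rewrite bhatt_sqr; last by rewrite u1.
have -> : (e - i * (u - 1)) ^+ 2 = (e + i * (u - 1)) ^+ 2 + (i * (2 * e)) * 2 * (1 - u) by ring.
rewrite ie; have := sqr_ge0 (e + i * (u - 1)); nra.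
Qed.

Lemma even_convex_sqr : even_convex (fun u : R => u ^+ 2).
Proof.
apply: even_convexI.
- exact: measurable_funX.
- by move=> u; rewrite sqrrN.
- by move=> u _; exact: sqr_ge0.
- by move=> a _; exists (2 * a) => u _; have := sqr_ge0 (u - a); nra.
- by move=> e e0; exists 2 => u _; have := sqr_ge0 (u - 1); nra.
Qed.

Lemma measurable_sqr_excess t : measurable_fun setT (sqr_excess t).
Proof.
apply: measurable_funX; apply: measurable_maxr => //.
by apply: measurable_funB => //; exact: measurableT_comp.
Qed.

Lemma sqr_excessN t u : sqr_excess t (- u) = sqr_excess t u.
Proof. by rewrite /sqr_excess normrN. Qed.

(** Convexity puts the tangent at a below the function, and the derivative is 2-Lipschitz, so the
    error of the tangent is at most (u - a)^2. *)
Lemma sqr_excess_bounds t a u : 0 <= t -> 0 <= a ->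
  sqr_excess t a + 2 * Num.max 0 (a - t) * (u - a) <= sqr_excess t u <=
  sqr_excess t a + 2 * Num.max 0 (a - t) * (u - a) + (u - a) ^+ 2.
Proof.
move=> t0 a0; rewrite /sqr_excess (ger0_norm a0).
set p := Num.max 0 (a - t); set P := Num.max 0 (`|u| - t).
have [p0 c0 ct] : [/\ 0 <= p, 0 <= a - p & a - p <= t].
  by rewrite /p; case: (leP (a - t) 0) => ?; split; lra.
have P0 : 0 <= P by rewrite /P le_max lexx.
have Pt : `|u| - t <= P by rewrite /P le_max lexx orbT.
have uP := le_trans (ler_norm u) (_ : `|u| <= P + t).
apply/andP; split.
  have {}uP : u <= P + t by apply: uP; lra.
  have pa : p = 0 \/ p = a - t by rewrite /p; case: (leP (a - t) 0) => ?; [left|right].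
  by case: pa => pa; [rewrite pa; nra|have := sqr_ge0 (P - p); nra].
(* The upper bound is the squared distance from u to the point a - p = min (a, t) of [-t, t]; the
   squared excess is the squared distance to that whole interval. *)
have -> : p ^+ 2 + 2 * p * (u - a) + (u - a) ^+ 2 = (u - (a - p)) ^+ 2 by ring.
move: (a - p) c0 ct => c c0 ct; rewrite /P; case: (leP (`|u| - t) 0) => h.
  by rewrite expr0n/= sqr_ge0.
by move: h; case: (leP 0 u) => u0; rewrite ?(ger0_norm u0) ?(ltr0_norm u0) => h; nra.
Qed.

Lemma sqr_excess_le t u : 0 <= t -> sqr_excess t u <= u ^+ 2.
Proof.
move=> t0; have /andP[_] := sqr_excess_bounds u t0 (lexx 0).
rewrite /sqr_excess normr0 sub0r.
have -> : Num.max 0 (- t) = 0 by apply: max_idPl; lra.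
by rewrite expr0n/= mulr0 mul0r !add0r subr0.
Qed.

Lemma sqr_excess_le1 t u : -1 <= u <= 1 -> sqr_excess t u <= sqr_excess t 1.
Proof.
rewrite -ler_norml => u1; rewrite /sqr_excess normr1.
by case: (leP (`|u| - t) 0) => P0; case: (leP (1 - t) 0) => p0; nra.
Qed.

Lemma even_convex_sqr_excess t : 0 <= t -> even_convex (sqr_excess t).
Proof.
move=> t0; apply: even_convexI.
- exact: measurable_sqr_excess.
- exact: sqr_excessN.
- by move=> u _; exact: sqr_ge0.
- move=> a /andP[a0 _]; exists (2 * Num.max 0 (a - t)) => u _.
  by have /andP[] := sqr_excess_bounds u t0 a0.
- move=> e e0; exists (2 * Num.max 0 (1 - t)) => u _.
  by have /andP[+ _] := sqr_excess_bounds u t0 ler01; lra.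
Qed.

Lemma bhatt_sub_le1 u : -1 <= u <= 1 -> u ^+ 2 / 2 <= 1 - bhatt u <= u ^+ 2.
Proof.
move=> u11; have := bhatt_sqr u11; have := bhatt_ge0 u; have := bhatt_le1 u.
by move: (bhatt u) => U U1 U0 E; apply/andP; split; nra.
Qed.

(* -sqrt (1 - u^2) is 1-strongly convex, whereas the convex function
   sqr_excess t / 2 has a 1-Lipschitz derivative. *)
Lemma even_convex_bhatt_excess t : 0 <= t ->
  even_convex (fun u => 1 - bhatt u - sqr_excess t u / 2).
Proof.
move=> t0; apply: even_convexI.
- apply: measurable_funB; last by apply: measurable_funM => //; exact: measurable_sqr_excess.
  by apply: measurable_funB => //; exact: measurable_bhatt.
- by move=> u; rewrite bhattN sqr_excessN.
- move=> u /bhatt_sub_le1/andP[+ _].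
  by have := sqr_excess_le u t0; lra.
- move=> a /andP[a0 a1]; exists (a / bhatt a - Num.max 0 (a - t)) => u u11.
  have A0 : 0 < bhatt a by apply: bhatt_gt0; apply/andP; split; lra.
  have /andP[_] := sqr_excess_bounds u t0 a0.
  have a11 : -1 <= a <= 1 by apply/andP; split; lra.
  have : bhatt a - bhatt u - a / bhatt a * (u - a) =
    ((a - u) ^+ 2 + (bhatt a - bhatt u) ^+ 2) / 2 / bhatt a.
    by rewrite -bhatt_bregman//; field; rewrite gt_eqF.
  have : (a - u) ^+ 2 / 2 <= ((a - u) ^+ 2 + (bhatt a - bhatt u) ^+ 2) / 2 / bhatt a.
    rewrite ler_pdivlMr// (@le_trans _ _ ((a - u) ^+ 2 / 2))//.
      by rewrite ler_piMr ?bhatt_le1// divr_ge0// sqr_ge0.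
    by rewrite ler_pM2r// lerDl sqr_ge0.
  have -> : (u - a) ^+ 2 = (a - u) ^+ 2 by rewrite -sqrrN opprB.
  by lra.
- move=> e e0; have [s h] := bhatt_le_affine e0; exists s => u u11.
  have := h u u11; have := sqr_excess_le1 t u11.
  have -> : bhatt 1 = 0 by rewrite /bhatt expr1n subrr sqrtr0.
  by lra.
Qed.

(** Write A, U for the values of [bhatt] at a, u and A', U' for those at theta a, theta u. Then A'^2
    - U'^2 = theta^2 (A^2 - U^2) while A' + U' >= A + U, so that |A' - U'| <= theta^2 |A - U|. *)
Lemma bhatt_scale_bregman theta a u : 0 <= theta <= 1 ->
  0 <= a < 1 -> -1 <= u <= 1 ->
  (bhatt (theta * a) - bhatt (theta * u)) ^+ 2 <= theta ^+ 2 * (bhatt a - bhatt u) ^+ 2.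
Proof.
move=> t01 a01 u11; have /andP[t0 t1] := t01; have /andP[a0 a1] := a01.
have a11 : -1 <= a <= 1 by apply/andP; split; lra.
have A0 : 0 < bhatt a by apply: bhatt_gt0; apply/andP; split; lra.
have le v : -1 <= v <= 1 -> bhatt v <= bhatt (theta * v).
  move=> _; rewrite ler_wsqrtr// lerD2l lerN2 exprMn ler_piMl ?sqr_ge0//.
  by rewrite expr_le1.
have := le _ a11; have := le _ u11; have := bhatt_ge0 u.
have := bhatt_sqr a11; have := bhatt_sqr u11.
have := bhatt_sqr (scale11 t01 a11); have := bhatt_sqr (scale11 t01 u11).
rewrite !exprMn; move: A0; move: (bhatt (theta * a)) (bhatt (theta * u)) (bhatt a) (bhatt u).
move=> A' U' A U A0 hU' hA' hU hA U0 UU' AA'.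
have E : (A' - U') * (A' + U') = theta ^+ 2 * ((A - U) * (A + U)).
  by rewrite -!subr_sqr hU' hA' hU hA; ring.
have S0 : 0 < (A' + U') ^+ 2 by rewrite exprn_gt0//; lra.
rewrite -(ler_pM2r S0) -exprMn E !exprMn.
have -> : theta ^+ 2 ^+ 2 * ((A - U) ^+ 2 * (A + U) ^+ 2) =
   theta ^+ 2 * (theta ^+ 2 * ((A - U) ^+ 2 * (A + U) ^+ 2)) by ring.
rewrite -[leRHS]mulrA; apply: ler_wpM2l; first exact: sqr_ge0.
apply: (@le_trans _ _ ((A - U) ^+ 2 * (A + U) ^+ 2)).
  apply: ler_piMl; first by rewrite mulr_ge0 ?sqr_ge0.
  by rewrite expr_le1.
by rewrite ler_wpM2l ?sqr_ge0// ler_sqr ?nnegrE; lra.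
Qed.

(** The Bregman divergence of the negative of [bhatt] after scaling by theta is at most theta^2
    times the original one: in [bhatt_bregman] both squares shrink at least by theta^2, and the
    divisor grows from [bhatt a] to [bhatt (theta * a)]. *)
Lemma even_convex_bhatt_scale theta : 0 <= theta < 1 ->
  even_convex (fun u => bhatt (theta * u) - theta ^+ 2 * bhatt u).
Proof.
move=> /andP[t0 t1]; have t01 : 0 <= theta <= 1 by rewrite t0 ltW.
have t21 : theta ^+ 2 <= 1 by rewrite expr_le1// ltW.
have le v : -1 <= v <= 1 -> bhatt v <= bhatt (theta * v).
  by move=> _; rewrite ler_wsqrtr// lerD2l lerN2 exprMn ler_piMl ?sqr_ge0.
apply: even_convexI.
- apply: measurable_funB; first exact: measurable_scale measurable_bhatt.
  by apply: measurable_funM => //; exact: measurable_bhatt.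
- by move=> u; rewrite mulrN !bhattN.
- move=> u /le; rewrite subr_ge0; apply: le_trans.
  by rewrite ler_piMl// bhatt_ge0.
- move=> a a01; have /andP[a0 a1] := a01.
  exists (theta ^+ 2 * (a / bhatt a) - theta * (theta * a / bhatt (theta * a))) => u u11.
  have a11 : -1 <= a <= 1 by apply/andP; split; lra.
  have A0 : 0 < bhatt a by apply: bhatt_gt0; apply/andP; split; lra.
  have AA' := le _ a11.
  have h1 : bhatt a - bhatt u - a / bhatt a * (u - a) =
    ((a - u) ^+ 2 + (bhatt a - bhatt u) ^+ 2) / 2 / bhatt a.
    by rewrite -bhatt_bregman//; field; rewrite gt_eqF.
  have h2 : bhatt (theta * a) - bhatt (theta * u) - theta * a / bhatt (theta * a) * (theta * u - theta * a) =
    ((theta * a - theta * u) ^+ 2 + (bhatt (theta * a) - bhatt (theta * u)) ^+ 2) / 2 / bhatt (theta * a).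
    rewrite -bhatt_bregman ?scale11//; field; rewrite gt_eqF//; exact: lt_le_trans AA'.
  have h3 := bhatt_scale_bregman t01 a01 u11.
  have : ((theta * a - theta * u) ^+ 2 + (bhatt (theta * a) - bhatt (theta * u)) ^+ 2) / 2 / bhatt (theta * a)
     <= theta ^+ 2 * (((a - u) ^+ 2 + (bhatt a - bhatt u) ^+ 2) / 2 / bhatt a).
    rewrite mulrA; apply: ler_pM.
    + by apply: divr_ge0 => //; apply: addr_ge0; exact: sqr_ge0.
    + by rewrite invr_ge0 bhatt_ge0.
    + rewrite -mulrBr exprMn; lra.
    + by rewrite lef_pV2 ?posrE// (lt_le_trans A0).
  rewrite -h1 -h2; lra.
(* At u = 1 the first term is minimal and [bhatt] vanishes, so the affine bound on [bhatt] alone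
   suffices. *)
- move=> e e0; have [s h] := bhatt_le_affine e0; exists s => u u11.
  have := h u u11; have := bhatt_ge0 u.
  have : bhatt (theta * 1) <= bhatt (theta * u).
    rewrite ler_wsqrtr// lerD2l lerN2 !exprMn ler_wpM2l ?sqr_ge0// expr1n.
    by move: u11 => /andP[? ?]; nra.
  have -> : bhatt 1 = 0 by rewrite /bhatt expr1n subrr sqrtr0.
  by nra.
Qed.

(** (1 + u v)^2 - (u + v)^2 and (1 - u v)^2 - (u - v)^2 both equal (1 - u^2) (1 - v^2), so each
    outcome contributes half of the product. *)
Lemma bms_add_bhatt u v : -1 <= u <= 1 -> -1 <= v <= 1 ->
  bms_add bhatt u v = bhatt u * bhatt v.
Proof.
move=> u11 v11; have /andP[u1 u2] := u11; have /andP[v1 v2] := v11.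
have [w1 w2] := weights_ge0 u11 v11; have [k1 k2] := bms_argK u11 v11.
have [a1 a2] := bms_arg_le1 u11 v11.
have E (w x y : R) : 0 <= w -> w * x = y -> w ^+ 2 - y ^+ 2 = (1 - u ^+ 2) * (1 - v ^+ 2) ->
    w * bhatt x = bhatt u * bhatt v.
  move=> w0 wx e; rewrite /bhatt -sqrtrM; last by nra.
  have <- : w ^+ 2 * (1 - x ^+ 2) = (1 - u ^+ 2) * (1 - v ^+ 2) by rewrite -e -wx; ring.
  by rewrite sqrtrM ?sqr_ge0// sqrtr_sqr ger0_norm.
rewrite /bms_add ![_ / 2 * _]mulrAC (E _ _ _ w1 k1); last by ring.
by rewrite (E _ _ _ w2 k2); [field|ring].
Qed.

(* Both sides are 1 minus a conditional mean square error in estimating the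
   input: on the left for the linear estimator a th X1 + b th X2, on the right
   for the optimal one. *)
Lemma bms_add_sqr_ge a b u v : -1 <= u <= 1 -> -1 <= v <= 1 ->
  2 * a * u ^+ 2 + 2 * b * v ^+ 2 - a ^+ 2 * u ^+ 2 - b ^+ 2 * v ^+ 2
    - 2 * a * b * (u ^+ 2 * v ^+ 2) <= bms_add (fun w => w ^+ 2) u v.
Proof.
move=> u11 v11; have [w1 w2] := weights_ge0 u11 v11; have [k1 k2] := bms_argK u11 v11.
have E (w x y z : R) : 0 <= w -> w * x = y -> y * z - w / 2 * z ^+ 2 <= w / 2 * x ^+ 2.
  by move=> w0 <-; have := mulr_ge0 w0 (sqr_ge0 (x - z)); lra.
have := E _ _ _ (a * u + b * v) w1 k1; have := E _ _ _ (a * u - b * v) w2 k2.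
rewrite /bms_add; lra.
Qed.

(** Bounds from below the rise of the preceding convex function above its value at 0; it decides the
    critical case d theta^2 = 1. With U, U' the values of [bhatt] at u, theta u and q = theta^2, w =
    u^2, the rise is q w (U' - U) / ((1 + U) (1 + U')). Here U' - U >= (1 - q) w / 2 because U + U'
    <= 2, and the divisor is at most 4, whence 1/8. *)
Lemma bhatt_scale_gap theta u : 0 <= theta <= 1 -> -1 <= u <= 1 ->
  theta ^+ 2 * (1 - theta ^+ 2) / 8 * u ^+ 4 <=
  theta ^+ 2 * (1 - bhatt u) - (1 - bhatt (theta * u)).
Proof.
move=> t01 u11; have /andP[t0 t1] := t01.
have t21 : theta ^+ 2 <= 1 by rewrite expr_le1.
have := bhatt_sqr u11; have := bhatt_sqr (scale11 t01 u11).
have : bhatt u <= bhatt (theta * u).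
  by rewrite ler_wsqrtr// lerD2l lerN2 exprMn ler_piMl ?sqr_ge0.
have := bhatt_ge0 u; have := bhatt_le1 u; have := bhatt_le1 (theta * u).
rewrite exprMn (exprM u 2 2).
move: (bhatt u) (bhatt _) (u ^+ 2) (theta ^+ 2) (sqr_ge0 theta) t21.
move=> U U' w q q0 q1 U'1 U1 U0 UU' hU' hU.
have hw : w = (1 - U) * (1 + U) by rewrite -[w](subKr 1) -hU; ring.
have d1 : (1 - q) * w <= 2 * (U' - U).
  have : (U' - U) * (U' + U) = (1 - q) * w by rewrite -subr_sqr hU hU'; ring.
  by move=> <-; nra.
have w0 : 0 <= w by rewrite hw; nra.
have e : (1 - U') * (1 + U') = q * w.
  have -> : (1 - U') * (1 + U') = 1 - U' ^+ 2 by ring.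
  by rewrite hU'; ring.
have P : 0 < (1 + U) * (1 + U') by nra.
have P4 : (1 + U) * (1 + U') <= 4 by nra.
have G : (q * (1 - U) - (1 - U')) * ((1 + U) * (1 + U')) = q * w * (U' - U).
  have -> : (q * (1 - U) - (1 - U')) * ((1 + U) * (1 + U')) =
    q * ((1 - U) * (1 + U)) * (1 + U') - (1 - U') * (1 + U') * (1 + U) by ring.
  by rewrite e -hw; ring.
rewrite -(ler_pM2r P) G.
have h0 : 0 <= q * (1 - q) / 8 * w ^+ 2.
  by rewrite mulr_ge0 ?sqr_ge0// divr_ge0// mulr_ge0// subr_ge0.
apply: (@le_trans _ _ (q * (1 - q) / 8 * w ^+ 2 * 4)); first exact: ler_wpM2l.
have := ler_wpM2l (mulr_ge0 q0 w0) d1; lra.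
Qed.

End test_functions.

(** * Equality of symmetric laws from expectations of squared excesses *)

Section separation.
Context {R : realType}.
Implicit Types (f g : R -> R) (t u : R).

Notation th := (@tanh_half R).

Lemma probability_rays_eq (P Q : probability R R) :
  (forall t, P `]t, +oo[%classic = Q `]t, +oo[%classic) -> P ≡μ Q.
Proof.
move=> PQ A mA.
pose G := [set B : set R | exists x, B = `]x, +oo[%classic].
apply: (measure_unique G (fun n => `](- n%:R), +oo[%classic)) => //.
- exact: RGenOInfty.measurableE.
- move=> _ _ [x ->] [y ->]; exists (Num.max x y).
  by apply/seteqP; split => z /=; rewrite !in_itv/= !andbT gt_max; [move=> [-> ->]|move=> /andP[]].
- by move=> n; exists (- n%:R).
- apply/seteqP; split => // x _; exists (Num.trunc `|x|).+1 => //=.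
  rewrite in_itv/= andbT ltrNl (le_lt_trans (ler_norm _))// normrN.
  by have := truncnS_gt `|x|.
- by move=> _ [x ->]; exact: PQ.
- by move=> n; exact: (le_lt_trans (probability_le1 _ (measurable_itv _)) (ltry _)).
Qed.

Lemma measurable_gt_fun d (T : measurableType d) (h : T -> R) t :
  measurable_fun setT h -> measurable [set x | t < h x].
Proof.
move=> mh; have := mh measurableT _ (measurable_itv `]t, +oo[).
by congr measurable; apply/seteqP; split => x /=; rewrite in_itv/= andbT => // -[].
Qed.

Lemma bounded_sqr_excess t : 0 <= t -> bounded_fun11 (sqr_excess t).
Proof. by move=> t0; apply: even_convex_bounded; exact: even_convex_sqr_excess. Qed.

Definition above t u : R := if t < `|u| then 1 else 0.

Lemma bounded_above t : bounded_fun11 (above t).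
Proof.
split; last by exists 1 => u _; rewrite /above; case: ltP; rewrite ?normr1 ?normr0.
have -> : above t = \1_[set u | t < `|u|].
  by apply/funext => u; rewrite indicE /above; case: ifPn => tu; [rewrite mem_set|rewrite memNset//; exact/negP].
by apply: measurable_indic; apply: measurable_gt_fun; exact: normr_measurable.
Qed.

(** A second difference in the threshold: as a function of s, the square of max (0, x - s) has
    second derivative 2 before x and 0 after it, so with step h the result is 2 h^2 times an
    indicator, up to where x lies in [t, t + 2 h]. *)
Definition diff2 t (h : R) u : R :=
  (1 * sqr_excess t u + (-2) * sqr_excess (t + h) u) + sqr_excess (t + 2 * h) u.

Lemma diff2_bounds t (h : R) u : 0 <= t -> 0 < h ->
  2 * h ^+ 2 * above (t + 2 * h) u <= diff2 t h u <= 2 * h ^+ 2 * above t u.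
Proof.
move=> t0 h0; rewrite /diff2 /sqr_excess /above; move: `|u| => x.
have [a|a] := leP (x - t) 0; have [b|b] := leP (x - (t + h)) 0;
 have [c|c] := leP (x - (t + 2 * h)) 0; have [p|p] := ltP (t + 2 * h) x;
 have [q|q] := ltP t x; rewrite ?expr0n/=; try lra; apply/andP; split; nra.
Qed.

Section le.
Context d d' (T : measurableType d) (T' : measurableType d').
Variables (mu : probability T R) (X : T -> \bar R) (nu : probability T' R) (Y : T' -> \bar R).

(* For BMS channels this is degradation: X is degraded with respect to Y. *)
Definition llr_le := forall f, even_convex f -> llr_ex mu X f <= llr_ex nu Y f.

Hypotheses (mX : measurable_fun setT X) (mY : measurable_fun setT Y).
Hypotheses (le : llr_le) (Zeq : llr_ex mu X bhatt <= llr_ex nu Y bhatt).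

(** One inequality is the order itself. The order applied to 1 - [bhatt] - [sqr_excess] / 2 gives
    the reverse one, since [Zeq] bounds the difference of the [bhatt] terms. *)
Lemma ex_sqr_excess_eq t : 0 <= t -> llr_ex mu X (sqr_excess t) = llr_ex nu Y (sqr_excess t).
Proof.
move=> t0; apply/eqP; rewrite eq_le le/=; last exact: even_convex_sqr_excess.
have E d0 (S : measurableType d0) (m : probability S R) Z : measurable_fun setT Z ->
    llr_ex m Z (fun u => 1 - bhatt u - sqr_excess t u / 2) =
    1 - llr_ex m Z bhatt - llr_ex m Z (sqr_excess t) / 2.
  move=> mZ; have bb := @bounded_bhatt R; have be := bounded_sqr_excess t0.
  have b1 := bounded_fun11_cst (1 : R).
  transitivity (llr_ex m Z (fun u => 1 * (1 * 1 + (-1) * bhatt u) + (- 2^-1) * sqr_excess t u)).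
    by apply: eq_ex => u _; field.
  rewrite ex_lin//; last exact: (bounded_fun11_lin 1 (-1) b1 bb).
  by rewrite (ex_lin m mZ 1 (-1) b1 bb) ex_cst; field.
have h := le (even_convex_bhatt_excess t0).
by move: h Zeq; rewrite (E _ _ mu X mX) (E _ _ nu Y mY); lra.
Qed.

End le.

Lemma tail_ex d (T : measurableType d) (m : probability T R) (Z : T -> \bar R) t : measurable_fun setT Z ->
  m [set r | t < `|th (Z r)|] = (llr_ex m Z (above t))%:E.
Proof.
move=> mZ; rewrite -exE//; last exact: bounded_above.
have mA : measurable [set r | t < `|th (Z r)|].
  by apply: measurable_gt_fun; apply: measurableT_comp => //; exact: measurable_th_llr.
transitivity (\int[m]_r (\1_[set r | (t < `|th (Z r)|)%R] r)%:E)%E.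
  by rewrite (integral_indic _ measurableT mA) setIT.
apply: eq_integral => r _; congr EFin.
by rewrite indicE /above; case: ifPn => tu; [rewrite mem_set|rewrite memNset//; exact/negP].
Qed.

Section tails.
Context d d' (T : measurableType d) (T' : measurableType d').
Variables (mu : probability T R) (X : T -> \bar R) (nu : probability T' R) (Y : T' -> \bar R).
Hypotheses (mX : measurable_fun setT X) (mY : measurable_fun setT Y).
Hypothesis eqE : forall t, 0 <= t -> llr_ex mu X (sqr_excess t) = llr_ex nu Y (sqr_excess t).

Lemma ex_above_le t (h : R) : 0 <= t -> 0 < h -> llr_ex mu X (above (t + 2 * h)) <= llr_ex nu Y (above t).
Proof.
move=> t0 h0; have h2 : 0 < 2 * h ^+ 2 by rewrite mulr_gt0// exprn_gt0.
have th0 : 0 <= t + h by lra. have tth0 : 0 <= t + 2 * h by lra.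
have bd : bounded_fun11 (diff2 t h).
  have := bounded_fun11_lin 1 1 (bounded_fun11_lin 1 (-2) (bounded_sqr_excess t0) (bounded_sqr_excess th0)) (bounded_sqr_excess tth0).
  by congr bounded_fun11; apply/funext => u; rewrite /diff2 !mul1r.
have E d0 (S : measurableType d0) (m : probability S R) Z : measurable_fun setT Z ->
    llr_ex m Z (diff2 t h) = llr_ex m Z (sqr_excess t) - 2 * llr_ex m Z (sqr_excess (t + h)) + llr_ex m Z (sqr_excess (t + 2 * h)).
  move=> mZ.
  transitivity (llr_ex m Z (fun u => 1 * (1 * sqr_excess t u + (-2) * sqr_excess (t + h) u) + 1 * sqr_excess (t + 2 * h) u)).
    by apply: eq_ex => u _; rewrite /diff2 !mul1r.
  rewrite ex_lin//; [|exact: (bounded_fun11_lin 1 (-2) (bounded_sqr_excess t0) (bounded_sqr_excess th0))|exact: bounded_sqr_excess].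
  rewrite (ex_lin m mZ 1 (-2) (bounded_sqr_excess t0) (bounded_sqr_excess th0)); ring.
have b0 := bounded_fun11_cst (0 : R).
have S d0 (S : measurableType d0) (m : probability S R) Z s : measurable_fun setT Z ->
    llr_ex m Z (fun u => 2 * h ^+ 2 * above s u + 0 * 0) = 2 * h ^+ 2 * llr_ex m Z (above s).
  move=> mZ; rewrite (ex_lin m mZ (2 * h ^+ 2) 0 (bounded_above s) b0); ring.
rewrite -(ler_pM2l h2) -(S _ _ _ _ _ mX) -(S _ _ _ _ _ mY).
apply: (@le_trans _ _ (llr_ex mu X (diff2 t h))).
  apply: ex_le => //; first exact: (bounded_fun11_lin _ _ (bounded_above _) b0).
  by move=> u _; rewrite mulr0 addr0; have /andP[] := diff2_bounds u t0 h0.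
rewrite E// !eqE// -E//; apply: ex_le => //; first exact: (bounded_fun11_lin _ _ (bounded_above _) b0).
by move=> u _; rewrite mulr0 addr0; have /andP[] := diff2_bounds u t0 h0.
Qed.

(** Second differences compare tails at t + 2 h and at t. For h = 1 / (n + 1) the sets where |th X|
    > t + 2 h increase to the set where |th X| > t. *)
Lemma tail_le t : 0 <= t -> (mu [set r | (t < `|th (X r)|)%R] <= (llr_ex nu Y (above t))%:E)%E.
Proof.
move=> t0; pose F (n : nat) := [set r | t + 2 * n.+1%:R^-1 < `|th (X r)|].
have mF s : measurable [set r | s < `|th (X r)|].
  by apply: measurable_gt_fun; apply: measurableT_comp => //; exact: measurable_th_llr.
have UF : \bigcup_n F n = [set r | t < `|th (X r)|].
  apply/seteqP; split => r /=.
    move=> [n _]; apply: lt_trans; rewrite ltrDl mulr_gt0//.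
  move=> tr; exists (Num.trunc (2 / (`|th (X r)| - t))).+1 => //=.
  rewrite /F/= -ltrBrDl; set c := `|_| - t; have c0 : 0 < c by rewrite subr_gt0.
  have := truncnS_gt (2 / c); rewrite ltr_pdivrMr// => h.
  rewrite ltr_pdivrMr//; apply: (lt_trans h); rewrite mulrC ltr_pM2l// ltr_nat ltnS//.
have ndF : nondecreasing_seq F.
  move=> m n mn; apply/subsetPset => r /=; apply: le_lt_trans.
  by rewrite lerD2l ler_pM2l// lef_pV2 ?posrE// ler_nat ltnS.
have := @nondecreasing_cvg_mu _ _ _ mu F (fun n => mF _) (bigcup_measurable (fun n _ => mF _)) ndF.
rewrite UF => cv; rewrite -(cvg_lim _ cv)//; apply: lime_le.
  by apply/cvg_ex; exists (mu [set r | t < `|th (X r)|]).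
apply: nearW => n; rewrite /F/= tail_ex// lee_fin; exact: ex_above_le.
Qed.

End tails.

Section equality.

Let absth (r : \bar R) : R := `|th r|.

Let measurable_absth : measurable_fun setT absth.
Proof. by apply: measurableT_comp => //; exact: measurable_tanh_half. Qed.

HB.instance Definition _ := isMeasurableFun.Build _ _ _ _ absth measurable_absth.

Variables (mu nu : probability (\bar R) R).
Hypotheses (smu : symmetric_llr mu idfun) (snu : symmetric_llr nu idfun).

(** The squared excesses give the tails, hence the law, of |th r|; symmetry fixes the conditional
    law of the sign. *)
Lemma symmetric_llr_eq :
  (forall t, 0 <= t -> llr_ex mu idfun (sqr_excess t) = llr_ex nu idfun (sqr_excess t)) ->
  mu ≡μ nu.
Proof.
move=> eqE.
have tails t : 0 <= t -> mu [set r | t < `|th r|] = nu [set r | t < `|th r|].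
  move=> t0; have mid := @measurable_id _ (\bar R) setT.
  have Em := tail_ex mu t mid; have En := tail_ex nu t mid.
  apply/eqP; rewrite eq_le; apply/andP; split.
    by rewrite [leRHS]En; exact: (tail_le mid mid eqE).
  by rewrite [leRHS]Em; apply: (tail_le mid mid) => // s s0; rewrite eqE.
have push : distribution mu absth ≡μ distribution nu absth.
  apply: probability_rays_eq => t; have [t0|t0] := leP 0 t.
    rewrite /= /distribution /pushforward.
    have -> : absth @^-1` `]t, +oo[ = [set r | t < `|th r|].
      by apply/seteqP; split => r /=; rewrite in_itv/= andbT.
    exact: tails.
  have T (m : probability (\bar R) R) : distribution m absth `]t, +oo[%classic = 1%E.
    rewrite /= /distribution /pushforward.
    have -> : absth @^-1` `]t, +oo[ = setT; last exact: probability_setT.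
    apply/seteqP; split => r //= _; rewrite in_itv/= andbT.
    exact: (lt_le_trans t0 (normr_ge0 _)).
  exact: etrans (T mu) (esym (T nu)).
move=> A mA.
pose L (w : R) := @llr R ((1 - w) / 2).
(* The conditional probability of A given |th r| = w. Its weights are nonnegative for |w| <= 1 only,
   hence the absolute value below. *)
pose H (w : R) : R := (1 + w) / 2 * \1_A (L w) + (1 - w) / 2 * \1_A (- L w)%E.
have mL : measurable_fun setT L.
  apply: measurableT_comp; first exact: measurable_llr.
  by apply: measurable_funM => //; exact: measurable_funB.
have mI : measurable_fun setT (\1_A : \bar R -> R) by exact: measurable_indic.
have mH : measurable_fun setT (fun w => `|H w|).
  apply: measurableT_comp => //.
  apply: measurable_funD; apply: measurable_funM.
  - by apply: measurable_funM => //; exact: measurable_funD.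
  - exact: measurableT_comp.
  - by apply: measurable_funM => //; exact: measurable_funB.
  - by apply: (measurableT_comp mI); exact: measurableT_comp.
have E (m : probability (\bar R) R) : symmetric_llr m idfun ->
    m A = (\int[distribution m absth]_w (`|H w|)%:E)%E.
  move=> sm; transitivity (\int[m]_r (\1_A r)%:E)%E.
    by rewrite (integral_indic _ measurableT mA) setIT.
  have i0 (r : \bar R) : (0 <= \1_A r :> R) by [].
  rewrite [LHS](sm _ mI i0) ge0_integral_distribution//; last exact/measurable_EFinP.
  apply: eq_integral => r _ /=; congr EFin.
  have s0 := symmetrize_ge0 r i0.
  have -> : H (absth r) = symmetrize \1_A r; last by rewrite ger0_norm.
  rewrite /H /L /absth llr_tanh_half /symmetrize.
  have [r0|r0] := leP 0%E r.
    by rewrite gee0_abs// ger0_norm// tanh_half_ge0.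
  rewrite lte0_abs// oppeK ler0_norm ?opprK; first by rewrite addrC.
  by rewrite -oppr_ge0 -tanh_halfN tanh_half_ge0// oppe_ge0 ltW.
apply: (etrans (E mu smu)); apply: (etrans _ (esym (E nu snu))).
by apply: eq_measure_integral => B mB _; exact: push.
Qed.

End equality.

End separation.

(** * Sums of independent observations: products, order, second moments *)

Section sums.
Context {R : realType}.
Implicit Types (f : R -> R).

Notation th := (@tanh_half R).

Lemma ex_distribution d d' (T : measurableType d) (T' : measurableType d')
    (mu : probability T R) (h : {RV mu >-> T'}) (X : T' -> \bar R) f :
  measurable_fun setT X -> bounded_fun11 f -> (forall u : R, -1 <= u <= 1 -> 0 <= f u) ->
  llr_ex (distribution mu h) X f = llr_ex mu (X \o h) f.
Proof.
move=> mX bf f0; apply: EFin_inj; rewrite -!exE//; last exact: measurableT_comp.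
rewrite ge0_integral_distribution//; last by move=> y; rewrite lee_fin f0// tanh_half_le1.
by apply/measurable_EFinP; exact: (measurableT_comp bf.1 (measurable_th_llr mX)).
Qed.

Section add.
Context d1 d2 (T1 : measurableType d1) (T2 : measurableType d2).
Variables (mu1 : probability T1 R) (mu2 : probability T2 R).
Variables (X1 : T1 -> R) (X2 : T2 -> \bar R).
Hypotheses (mX1 : measurable_fun setT X1) (mX2 : measurable_fun setT X2).
Hypotheses (sX1 : symmetric_llr mu1 (EFin \o X1)) (sX2 : symmetric_llr mu2 X2).

Let X12 (z : T1 * T2) : \bar R := ((X1 z.1)%:E + X2 z.2)%E.
Let EX1 := EFin \o X1.

Let mEX1 : measurable_fun setT EX1.
Proof. exact/measurable_EFinP. Qed.

Let mX12 : measurable_fun setT X12.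
Proof. exact: measurable_llr_add. Qed.

Let th2 y : -1 <= th (X2 y) <= 1. Proof. exact: tanh_half_le1. Qed.

Let th1 x : -1 <= th (X1 x)%:E <= 1. Proof. exact: tanh_half_le1. Qed.

Lemma ex_add_bhatt :
  llr_ex (mu1 \x mu2)%E X12 bhatt = llr_ex mu1 EX1 bhatt * llr_ex mu2 X2 bhatt.
Proof.
have bb := @bounded_bhatt R; have b0 := bounded_fun11_cst (0 : R).
apply: EFin_inj; rewrite (ex_add2 mX1 mX2 sX1 sX2 bb (@bhattN R)); last by move=> *; exact: bhatt_ge0.
transitivity (\int[mu2]_y (llr_ex mu1 EX1 bhatt * bhatt (th (X2 y)) + 0 * 0)%:E)%E.
  apply: eq_integral => y _; congr EFin.
  transitivity (llr_ex mu1 EX1 (fun u => bhatt (th (X2 y)) * bhatt u + 0 * 0)).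
    by apply: eq_ex => u u11; rewrite bms_add_bhatt// mulr0 addr0 mulrC.
  by rewrite (ex_lin mu1 mEX1 _ 0 bb b0); ring.
rewrite (exE mu2 mX2 (bounded_fun11_lin (llr_ex mu1 EX1 bhatt) 0 bb b0)).
by rewrite (ex_lin mu2 mX2 _ 0 bb b0); congr EFin; ring.
Qed.

(** Jensen conditionally on X1: discarding the observation X2 can only lower the expectation of a
    convex function. *)
Lemma llr_le_addl : llr_le mu1 EX1 (mu1 \x mu2)%E X12.
Proof.
move=> f fc; have [_ fN f0 _] := fc; have bf := even_convex_bounded fc.
rewrite (Rintegral_ex_add1 mX1 mX2 sX1 sX2 bf fN f0).
rewrite [leLHS]exU; apply: le_Rintegral => //; first exact: integrable_ex.
  exact: (integrable_ex_add1 mX1 mX2 sX1 sX2 bf fN f0).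
move=> x _; rewrite -[leLHS](ex_cst mu2 X2); apply: ex_le => //.
- exact: bounded_fun11_cst.
- exact: bounded_bms_add.
- by move=> v v11; rewrite bms_addC//; exact: (even_convex_bms_ge fc (th1 x) v11).
Qed.

Lemma llr_le_addr : llr_le mu2 X2 (mu1 \x mu2)%E X12.
Proof.
move=> f fc; have [_ fN f0 _] := fc; have bf := even_convex_bounded fc.
rewrite (Rintegral_ex_add2 mX1 mX2 sX1 sX2 bf fN f0).
rewrite [leLHS]exU; apply: le_Rintegral => //; first exact: integrable_ex.
  exact: (integrable_ex_add2 mX1 mX2 sX1 sX2 bf fN f0).
move=> y _; rewrite -[leLHS](ex_cst mu1 EX1); apply: (ex_le mu1 mEX1).
- exact: bounded_fun11_cst.
- exact: (bounded_bms_add bf (th2 y)).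
- by move=> v v11; rewrite bms_addC//; exact: (even_convex_bms_ge fc (th2 y) v11).
Qed.

(** The pointwise bound for linear estimators, integrated. It is polynomial in u^2 and v^2, so by
    independence only the two second moments occur; the coefficients stay free. *)
Lemma ex_add_sqr_ge (a b : R) (sq := fun u : R => u ^+ 2) :
  2 * a * llr_ex mu1 EX1 sq + 2 * b * llr_ex mu2 X2 sq - a ^+ 2 * llr_ex mu1 EX1 sq
   - b ^+ 2 * llr_ex mu2 X2 sq - 2 * a * b * (llr_ex mu1 EX1 sq * llr_ex mu2 X2 sq)
  <= llr_ex (mu1 \x mu2)%E X12 sq.
Proof.
have sc := @even_convex_sqr R; have [_ fN f0 _] := sc.
have bs := even_convex_bounded sc; have b1 := bounded_fun11_cst (1 : R).
rewrite (Rintegral_ex_add2 mX1 mX2 sX1 sX2 bs fN f0).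
set x1 := llr_ex mu1 EX1 sq.
apply: (@le_trans _ _ (llr_ex mu2 X2 (fun v => (2 * a - a ^+ 2) * x1 * 1 + (2 * b - b ^+ 2 - 2 * a * b * x1) * v ^+ 2))).
  by rewrite (ex_lin mu2 mX2 _ _ b1 bs) ex_cst -/sq; lra.
rewrite [leLHS]exU; apply: le_Rintegral => //.
- exact: (integrable_ex mu2 mX2 (bounded_fun11_lin _ _ b1 bs)).
- exact: (integrable_ex_add2 mX1 mX2 sX1 sX2 bs fN f0).
move=> y _; set v := th (X2 y).
apply: (@le_trans _ _ (llr_ex mu1 EX1 (fun u => (2 * a - a ^+ 2 - 2 * a * b * v ^+ 2) * u ^+ 2 + (2 * b - b ^+ 2) * v ^+ 2 * 1))).
  by rewrite (ex_lin mu1 mEX1 _ _ bs b1) ex_cst -/sq -/x1; lra.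
apply: (ex_le mu1 mEX1).
- exact: bounded_fun11_lin.
- exact: (bounded_bms_add bs (th2 y)).
- by move=> u u11; have := bms_add_sqr_ge a b u11 (th2 y); rewrite -/v; lra.
Qed.

End add.

Section add_mono.
Context d1 d2 d3 (T1 : measurableType d1) (T2 : measurableType d2) (T3 : measurableType d3).

(** Given the common summand, the test function seen by the other one is again even convex
    ([even_convex_bms_add]). *)
Lemma llr_le_add_monol (mu1 : probability T1 R) (mu2 : probability T2 R)
    (mu3 : probability T3 R) (X1 : T1 -> R) (X2 : T2 -> \bar R) (X3 : T3 -> R) :
  measurable_fun setT X1 -> measurable_fun setT X2 -> measurable_fun setT X3 ->
  symmetric_llr mu1 (EFin \o X1) -> symmetric_llr mu2 X2 -> symmetric_llr mu3 (EFin \o X3) ->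
  llr_le mu1 (EFin \o X1) mu3 (EFin \o X3) ->
  llr_le (mu1 \x mu2)%E (fun z => (X1 z.1)%:E + X2 z.2)%E
         (mu3 \x mu2)%E (fun z => (X3 z.1)%:E + X2 z.2)%E.
Proof.
move=> mX1 mX2 mX3 sX1 sX2 sX3 le f fc; have [_ fN f0 _] := fc; have bf := even_convex_bounded fc.
rewrite (Rintegral_ex_add2 mX1 mX2 sX1 sX2 bf fN f0) (Rintegral_ex_add2 mX3 mX2 sX3 sX2 bf fN f0).
apply: le_Rintegral => //.
- exact: (integrable_ex_add2 mX1 mX2 sX1 sX2 bf fN f0).
- exact: (integrable_ex_add2 mX3 mX2 sX3 sX2 bf fN f0).
- by move=> y _; apply: le; apply: even_convex_bms_add => //; exact: tanh_half_le1.
Qed.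

Lemma llr_le_add_monor (mu1 : probability T1 R) (mu2 : probability T2 R)
    (mu3 : probability T3 R) (X1 : T1 -> R) (X2 : T2 -> \bar R) (X3 : T3 -> \bar R) :
  measurable_fun setT X1 -> measurable_fun setT X2 -> measurable_fun setT X3 ->
  symmetric_llr mu1 (EFin \o X1) -> symmetric_llr mu2 X2 -> symmetric_llr mu3 X3 ->
  llr_le mu2 X2 mu3 X3 ->
  llr_le (mu1 \x mu2)%E (fun z => (X1 z.1)%:E + X2 z.2)%E
         (mu1 \x mu3)%E (fun z => (X1 z.1)%:E + X3 z.2)%E.
Proof.
move=> mX1 mX2 mX3 sX1 sX2 sX3 le f fc; have [_ fN f0 _] := fc; have bf := even_convex_bounded fc.
rewrite (Rintegral_ex_add1 mX1 mX2 sX1 sX2 bf fN f0) (Rintegral_ex_add1 mX1 mX3 sX1 sX3 bf fN f0).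
apply: le_Rintegral => //.
- exact: (integrable_ex_add1 mX1 mX2 sX1 sX2 bf fN f0).
- exact: (integrable_ex_add1 mX1 mX3 sX1 sX3 bf fN f0).
- by move=> x _; apply: le; apply: even_convex_bms_add => //; exact: tanh_half_le1.
Qed.

End add_mono.

End sums.

(** * One BP step with a given number of summands *)

Section bp_operator.
Context {R : realType}.
Implicit Types (f : R -> R) (P Q PW : delta_dist R).

Notation th := (@tanh_half R).

Definition bms_ex P f : R := llr_ex (llr_law P) idfun f.

Lemma bms_exE P f : bounded_fun11 f -> (forall u, f (- u) = f u) ->
  (forall u : R, -1 <= u <= 1 -> 0 <= f u) ->
  ((bms_ex P f)%:E = \int[P]_(t in `[0%R, 2^-1%R]) (f (1 - 2 * t))%:E)%E.
Proof.
move=> bf fN f0; rewrite -exE//; last exact: measurable_id.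
rewrite (integral_llr_law P (f := f \o th)); last 2 first.
- exact: (measurableT_comp bf.1 (@measurable_tanh_half R)).
- by move=> r; apply: f0; exact: tanh_half_le1.
apply: eq_integral => t /[!inE]/=; rewrite in_itv/= => t01; congr EFin.
by rewrite tanh_halfN fN tanh_half_llr//; ring.
Qed.

Section edge.
Variable delta : R.
Hypotheses (delta0 : 0 < delta) (delta1 : delta <= 1 / 2).
Let theta := theta_of delta.

Lemma theta01 : 0 <= theta < 1.
Proof. by move: delta0 delta1 => d0 d1; rewrite /theta /theta_of; apply/andP; split; lra. Qed.

Let theta_le1 : 0 <= theta <= 1.
Proof. by have /andP[-> /ltW ->] := theta01. Qed.

Lemma F_thetaN (r : \bar R) : F_theta theta (- r)%E = - F_theta theta r.
Proof.
have /andP[t0 t1] := theta01; have /andP[h1 h2] := tanh_half_le1 r.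
rewrite /F_theta tanh_halfN /arctanh mulrN opprK.
have z1 : 0 < 1 + theta * th r by nra.
have z2 : 0 < 1 - theta * th r by nra.
have -> : (1 - theta * th r) / (1 + theta * th r) = ((1 + theta * th r) / (1 - theta * th r))^-1.
  by rewrite invf_div.
by rewrite lnV ?posrE ?divr_gt0//; field.
Qed.

Lemma measurable_F_theta : measurable_fun setT (@F_theta R theta).
Proof.
have mt := @measurable_tanh_half R.
have m1 : measurable_fun setT (fun r : \bar R => theta * th r) by exact: measurable_funM.
apply: measurable_funM => //; apply: measurable_funM => //.
apply: measurableT_comp => //; apply: measurable_funM.
  exact: measurable_funD.
apply: measurableT_comp; first exact: measurable_invr.
exact: measurable_funB.
Qed.

(** With u = th r, the two possible sign errors combine to (1 + theta u) / 2 as for binary symmetric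
    channels in series; by [tanh_half_F_theta] this is the weight that symmetry prescribes for the
    value of [F_theta]. *)
Lemma integral_edge_law P (phi : \bar R -> R) : measurable_fun setT phi ->
  (forall r, 0 <= phi r) ->
  (\int[edge_law delta P]_x (phi x%:E)%:E =
   \int[llr_law P]_r (symmetrize phi (F_theta theta r)%:E)%:E)%E.
Proof.
move=> mphi phi0; have mF := measurable_F_theta; move: (delta0) (delta1) => d0 d1.
have mphiE : measurable_fun setT (fun x : R => phi x%:E).
  by apply: measurableT_comp => //; exact/measurable_EFinP.
pose psi (r : \bar R) := (1 - delta) * phi (F_theta theta r)%:E + delta * phi (- F_theta theta r)%:E.
have mpsi : measurable_fun setT psi.
  apply: measurable_funD; apply: measurable_funM => //.
    exact: (measurableT_comp mphiE).
  by apply: (measurableT_comp mphiE); exact: measurableT_comp.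
have psi0 r : 0 <= psi r by apply: addr_ge0; apply: mulr_ge0 => //; lra.
rewrite ge0_integral_distribution; [|exact/measurable_EFinP|by move=> x; rewrite lee_fin].
rewrite fubini_tonelli1; last 2 first.
- apply/measurable_EFinP; apply: (measurableT_comp mphiE); exact: measurable_edge_message.
- by move=> z; rewrite lee_fin.
transitivity (\int[llr_law P]_r (psi r)%:E)%E.
  apply: eq_integral => r _; rewrite /fubini_F/=.
  rewrite integral_bernoulli_prob; last 2 first.
  - by apply/andP; split; lra.
  - by move=> b; rewrite lee_fin.
  rewrite /edge_message/= mul1r mulN1r -!EFinM -EFinD /psi -/theta.
  by congr EFin; congr (_ + _ * _); rewrite /unstable.onem; ring.
rewrite [LHS](symmetric_llr_llr_law P mpsi psi0); apply: eq_integral => r _; congr EFin.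
rewrite /symmetrize /psi F_thetaN opprK EFinN tanh_half_F_theta ?theta01//.
have -> : delta = (1 - theta) / 2 by rewrite /theta /theta_of; field.
by field.
Qed.

Lemma symmetric_llr_edge P : symmetric_llr (edge_law delta P) EFin.
Proof.
move=> phi mphi phi0; rewrite integral_edge_law// integral_edge_law.
- by apply: eq_integral => r _; rewrite symmetrize_idem.
- exact: measurable_symmetrize.
- by move=> r; exact: symmetrize_ge0.
Qed.

Lemma ex_edge P f : bounded_fun11 f -> (forall u, f (- u) = f u) ->
  (forall u : R, -1 <= u <= 1 -> 0 <= f u) ->
  llr_ex (edge_law delta P) EFin f = bms_ex P (fun u => f (theta * u)).
Proof.
move=> bf fN f0; apply: EFin_inj; rewrite /bms_ex -!exE//; last 2 first.
- exact: measurable_id.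
- exact: (bounded_scale theta_le1 bf).
rewrite (integral_edge_law P (phi := f \o th)); last 2 first.
- exact: (measurableT_comp bf.1 (@measurable_tanh_half R)).
- by move=> r; apply: f0; exact: tanh_half_le1.
apply: eq_integral => r _; congr EFin.
by rewrite /symmetrize /comp tanh_halfN fN tanh_half_F_theta ?theta01//; field.
Qed.

Lemma symmetric_llr_iid (nu : probability R R) n :
  symmetric_llr nu EFin -> symmetric_llr (iid_sum_law nu n) EFin.
Proof.
move=> snu; elim: n => [|n IH] /=.
  move=> phi mphi phi0; rewrite !integral_dirac//.
  - by rewrite /symmetrize oppe0 tanh_half0; congr (_ * EFin _)%E; field.
  - by apply/measurable_EFinP; apply: measurableT_comp; [exact: measurable_symmetrize|exact/measurable_EFinP].
  - by apply/measurable_EFinP; apply: measurableT_comp; [exact: mphi|exact/measurable_EFinP].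
apply: symmetric_llr_distribution; first exact/measurable_EFinP.
have mid : measurable_fun setT (idfun : R -> R) by exact: measurable_id.
have mE : measurable_fun setT (EFin : R -> \bar R) by exact/measurable_EFinP.
exact: (symmetric_llr_add mid mE IH snu).
Qed.

Let iid P n := iid_sum_law (edge_law delta P) n.

Let siid P n : symmetric_llr (iid P n) EFin.
Proof. by apply: symmetric_llr_iid; exact: symmetric_llr_edge. Qed.

Let mE : measurable_fun setT (EFin : R -> \bar R).
Proof. exact/measurable_EFinP. Qed.

Let mid : measurable_fun setT (idfun : R -> R).
Proof. exact: measurable_id. Qed.

Let mide : measurable_fun setT (idfun : \bar R -> \bar R).
Proof. exact: measurable_id. Qed.

Let ex_iidS P n f : bounded_fun11 f -> (forall u : R, -1 <= u <= 1 -> 0 <= f u) ->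
  llr_ex (iid P n.+1) EFin f =
  llr_ex (iid P n \x edge_law delta P)%E (fun z : R * R => z.1%:E + z.2%:E)%E f.
Proof. by move=> bf f0; rewrite /iid/= (ex_distribution _ mE bf f0). Qed.

Let ex_bp PW P n f : bounded_fun11 f -> (forall u : R, -1 <= u <= 1 -> 0 <= f u) ->
  llr_ex (bp_law delta PW P n) idfun f =
  llr_ex (iid P n \x llr_law PW)%E (fun z : R * \bar R => z.1%:E + z.2)%E f.
Proof. by move=> bf f0; rewrite /bp_law (ex_distribution _ mide bf f0). Qed.

Let ex_iid0 P f : bounded_fun11 f -> llr_ex (iid P 0) EFin f = f 0.
Proof.
move=> [mf _]; rewrite exU /Rintegral /iid/= integral_dirac//.
  by rewrite diracT mul1e tanh_half0.
apply/measurable_EFinP; apply: (measurableT_comp mf).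
exact: (measurable_th_llr mE).
Qed.

Let bh u : -1 <= u <= 1 -> 0 <= bhatt u :> R.
Proof. by move=> _; exact: bhatt_ge0. Qed.

Lemma symmetric_llr_bp PW P n : symmetric_llr (bp_law delta PW P n) idfun.
Proof.
apply: symmetric_llr_distribution => //.
exact: (symmetric_llr_add mid mide (siid P n) (symmetric_llr_llr_law PW)).
Qed.

Lemma bp_bhatt PW P n : llr_ex (bp_law delta PW P n) idfun bhatt =
  bms_ex P (fun u => bhatt (theta * u)) ^+ n * bms_ex PW bhatt.
Proof.
rewrite (ex_bp _ _ _ (@bounded_bhatt R) bh).
rewrite (ex_add_bhatt mid mide (siid P n) (symmetric_llr_llr_law PW)); congr (_ * _).
elim: n => [|n IH]; first by rewrite ex_iid0 ?expr0; [rewrite /bhatt expr0n subr0 sqrtr1|exact: bounded_bhatt].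
rewrite (ex_iidS _ _ (@bounded_bhatt R) bh).
rewrite (ex_add_bhatt mid mE (siid P n) (symmetric_llr_edge P)) [X in X * _]IH.
by rewrite (ex_edge _ (@bounded_bhatt R) (@bhattN R) bh) exprSr.
Qed.

Lemma llr_le_survey_bp PW P n : llr_le (llr_law PW) idfun (bp_law delta PW P n) idfun.
Proof.
move=> f fc; have [_ _ f0 _] := fc; rewrite (ex_bp _ _ _ (even_convex_bounded fc) f0).
exact: (llr_le_addr mid mide (siid P n) (symmetric_llr_llr_law PW) fc).
Qed.

Lemma llr_le_bp PW P Q n : llr_le (llr_law P) idfun (llr_law Q) idfun ->
  llr_le (bp_law delta PW P n) idfun (bp_law delta PW Q n) idfun.
Proof.
move=> PQ f fc; have [_ _ f0 _] := fc; have bf := even_convex_bounded fc.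
rewrite !(ex_bp _ _ _ bf f0).
apply: (llr_le_add_monol mid mide mid (siid P n) (symmetric_llr_llr_law PW) (siid Q n)) => //.
elim: n {f fc f0 bf} => [|n IH] f fc; have [_ fN f0 _] := fc; have bf := even_convex_bounded fc.
  by rewrite [leLHS]ex_iid0// [leRHS]ex_iid0.
rewrite [leLHS](ex_iidS _ _ bf f0) [leRHS](ex_iidS _ _ bf f0).
(* The intermediate law takes the first n summands from Q and the last one from P. *)
apply: (@le_trans _ _ (llr_ex (iid Q n \x edge_law delta P)%E (fun z : R * R => z.1%:E + z.2%:E)%E f)).
  exact: (llr_le_add_monol mid mE mid (siid P n) (symmetric_llr_edge P) (siid Q n) IH fc).
apply: (llr_le_add_monor mid mE mE (siid Q n) (symmetric_llr_edge P) (symmetric_llr_edge Q)) => //.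
move=> g gc; have [_ gN g0 _] := gc; have bg := even_convex_bounded gc.
rewrite !ex_edge//; apply: PQ; exact: (even_convex_scale theta_le1 gc).
Qed.

Let sq (u : R) := u ^+ 2.

(* The right-hand side is n y / (1 + (n - 1) y) after maximization over c. *)
Lemma bp_sqr_ge PW P n (c : R) (y := theta ^+ 2 * bms_ex P sq) :
  2 * c * (n%:R * y) - c ^+ 2 * (n%:R * y + n%:R * (n%:R - 1) * y ^+ 2) <=
  llr_ex (bp_law delta PW P n) idfun sq.
Proof.
have sc := @even_convex_sqr R; have [_ sN s0 _] := sc; have bs := even_convex_bounded sc.
have b1 := bounded_fun11_cst (1 : R); have b0 := bounded_fun11_cst (0 : R).
have /andP[t0 t1] := theta01.
have x0 : 0 <= bms_ex P sq by apply: ex_ge0.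
have x1 : bms_ex P sq <= 1.
  rewrite -[leRHS](ex_cst (llr_law P) idfun 1); apply: (ex_le _ mide) => //.
  by move=> u /andP[? ?]; rewrite /sq; nra.
have y0 : 0 <= y by rewrite mulr_ge0// sqr_ge0.
have y1 : y < 1.
  by rewrite (@le_lt_trans _ _ (theta ^+ 2))// ?ler_piMr ?sqr_ge0// expr_lt1.
have ey : llr_ex (edge_law delta P) EFin sq = y.
  rewrite (ex_edge _ bs sN s0) /bms_ex.
  transitivity (llr_ex (llr_law P) idfun (fun u => theta ^+ 2 * sq u + 0 * 0)).
    by apply: eq_ex => u _; rewrite /sq exprMn mul0r addr0.
  by rewrite (ex_lin _ mide _ _ bs b0) mul0r addr0.
have D0 k : 0 < 1 - y + k%:R * y by have := mulr_ge0 (ler0n R k) y0; lra.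
(* The left-hand side is the variance explained by the best linear estimator of the input from k
   messages, each of second moment y. *)
have iidge k : k%:R * y / (1 - y + k%:R * y) <= llr_ex (iid P k) EFin sq.
  elim: k => [|k IH]; first by rewrite ex_iid0// !mul0r /sq expr0n.
  rewrite [leRHS](ex_iidS _ _ bs s0).
  have C0 : 0 < 1 + k%:R * y by have := mulr_ge0 (ler0n R k) y0; lra.
  (* The stationary point of the quadratic bound when the sum of k messages has exactly the second
     moment of the induction hypothesis. *)
  pose b := (1 + k%:R * y)^-1; pose a := (1 - y + k%:R * y) * b.
  apply: le_trans (ex_add_sqr_ge mid mE (siid P k) (symmetric_llr_edge P) a b).
  rewrite ey; set p := k%:R * y / _ in IH; set x := llr_ex (iid P k) EFin sq in IH *.
  (* Through 1 - b y = a the coefficient of the second moment becomes a^2 >= 0, so the induction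
     hypothesis can be inserted. *)
  have ab : 1 - b * y = a by rewrite /a /b; field; rewrite gt_eqF.
  have E (z : R) : 2 * a * z + 2 * b * y - a ^+ 2 * z - b ^+ 2 * y - 2 * a * b * (z * y) =
    a ^+ 2 * z + 2 * b * y - b ^+ 2 * y by rewrite -ab; ring.
  apply: (@le_trans _ _ (a ^+ 2 * p + 2 * b * y - b ^+ 2 * y)).
    have Dk := D0 k; rewrite /p /a /b -natr1 le_eqVlt; apply/orP; left; apply/eqP.
    by field; rewrite !gt_eqF//; have := mulr_ge0 (ler0n R k) y0; lra.
  rewrite -E; have := ler_wpM2l (sqr_ge0 a) IH; have := E p; have := E x; lra.
have Dn := D0 n; have n0 : 0 <= n%:R * y by rewrite mulr_ge0.
apply: (@le_trans _ _ (n%:R * y / (1 - y + n%:R * y))).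
  rewrite ler_pdivlMr//; have := mulr_ge0 n0 (sqr_ge0 (1 - c * (1 - y + n%:R * y))); lra.
(* The survey is dropped: it can only raise the second moment. *)
apply: (le_trans (iidge n)); rewrite (ex_bp _ _ _ bs s0).
exact: (llr_le_addl mid mide (siid P n) (symmetric_llr_llr_law PW) sc).
Qed.

End edge.

End bp_operator.

(** * Antisymmetry of the order and the passage back to distributions of Delta *)

Section llr_order.
Context {R : realType}.
Implicit Types (f : R -> R) (P Q : delta_dist R) (mu nu : probability (\bar R) R).

Notation th := (@tanh_half R).

Let mide : measurable_fun setT (idfun : \bar R -> \bar R).
Proof. exact: measurable_id. Qed.

Lemma symmetric_llr_le_antisym mu nu :
  symmetric_llr mu idfun -> symmetric_llr nu idfun -> llr_le mu idfun nu idfun ->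
  llr_ex mu idfun bhatt <= llr_ex nu idfun bhatt -> mu ≡μ nu.
Proof.
move=> smu snu le Z; apply: symmetric_llr_eq => // t t0.
exact: (ex_sqr_excess_eq mide mide le Z t0).
Qed.

Definition crossover (r : \bar R) : R := (1 - `|th r|) / 2.

Lemma measurable_crossover : measurable_fun setT crossover.
Proof.
apply: measurable_funM => //; apply: measurable_funB => //.
by apply: measurableT_comp => //; exact: measurable_tanh_half.
Qed.

HB.instance Definition _ := isMeasurableFun.Build _ _ _ _ crossover measurable_crossover.

Lemma crossover_itv r : 0 <= crossover r <= 2^-1.
Proof.
have : `|th r| <= 1 by rewrite ler_norml tanh_half_le1.
by have := normr_ge0 (th r); rewrite /crossover => ? ?; apply/andP; split; lra.
Qed.

Let delta_of_supp mu : (distribution mu crossover : probability R R) `[0, 2^-1]%classic = 1%E.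
Proof.
rewrite /= /distribution /pushforward.
have -> : crossover @^-1` `[0, 2^-1] = setT; last exact: probability_setT.
by apply/seteqP; split => r //= _; rewrite in_itv/= crossover_itv.
Qed.

(** Keeps |th r| and forgets the sign, hence keeps the expectations of even functions. It turns the
    output of BP into a distribution of Delta, so that BP can be iterated. *)
Definition delta_of mu : delta_dist R := DeltaDist (delta_of_supp mu).

Lemma bms_ex_delta_of mu f : bounded_fun11 f -> (forall u, f (- u) = f u) ->
  (forall u : R, -1 <= u <= 1 -> 0 <= f u) -> bms_ex (delta_of mu) f = llr_ex mu idfun f.
Proof.
move=> bf fN f0; apply: EFin_inj; rewrite bms_exE// -(exE mu mide bf).
(* f is nonnegative on [-1, 1] only, whereas the change of variables wants a function nonnegative
   everywhere; on the support the absolute value changes nothing. *)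
have mf' : measurable_fun setT (fun t : R => `|f (1 - 2 * t)|).
  apply: measurableT_comp => //; apply: (measurableT_comp bf.1).
  by apply: measurable_funB => //; exact: measurable_funM.
transitivity (\int[delta_of mu]_(t in `[0%R, 2^-1%R]) (`|f (1 - 2 * t)|)%:E)%E.
  apply: eq_integral => t /[!inE]/=; rewrite in_itv/= => /andP[t0 t1].
  by rewrite ger0_norm// f0//; apply/andP; split; lra.
rewrite integral_delta_supp//; last exact/measurable_EFinP.
rewrite [LHS]ge0_integral_distribution//; last exact/measurable_EFinP.
apply: eq_integral => r _ /=; congr EFin.
have -> : 1 - 2 * crossover r = `|th r| by rewrite /crossover; field.
have h := tanh_half_le1 r; rewrite ger0_norm.
  by have [r0|r0] := leP 0 (th r); [rewrite ger0_norm|rewrite ltr0_norm// fN].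
by apply: f0; rewrite -ler_norml normr_id ler_norml.
Qed.

(** Both signs of the log-likelihood ratio have the same [crossover], namely Delta, so P can be read
    off from [llr_law P]. *)
Lemma llr_law_crossover P (A : set R) : measurable A ->
  llr_law P (crossover @^-1` A) = P A.
Proof.
move=> mA; have mI : measurable_fun setT (\1_A : R -> R) by exact: measurable_indic.
have mC : measurable (crossover @^-1` A).
  by rewrite -[X in measurable X]setTI; exact: measurable_crossover.
transitivity (\int[llr_law P]_r (\1_A (crossover r))%:E)%E.
  transitivity (\int[llr_law P]_r (\1_(crossover @^-1` A) r)%:E)%E.
    by rewrite (integral_indic _ measurableT mC) setIT.
  by apply: eq_integral => r _; rewrite !indicE; congr (_%:R)%:E; apply/idP/idP; rewrite !inE.
rewrite (integral_llr_law P (f := \1_A \o crossover))//; last first.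
  exact: (measurableT_comp mI measurable_crossover).
transitivity (\int[P]_(t in `[0%R, 2^-1%R]) (\1_A t)%:E)%E.
  apply: eq_integral => t /[!inE]/=; rewrite in_itv/= => t01; congr EFin.
  rewrite /crossover tanh_halfN normrN tanh_half_llr// ger0_norm; last by lra.
  have -> : (1 - (1 - 2 * t)) / 2 = t by field.
  by rewrite -mulrDl subrK mul1r.
rewrite integral_delta_supp//; last exact/measurable_EFinP.
by rewrite (integral_indic _ measurableT mA) setIT.
Qed.

Lemma llr_law_inj P Q : llr_law P ≡μ llr_law Q -> P ≡μ Q.
Proof.
move=> PQ A mA; rewrite -[LHS](llr_law_crossover P mA) -[RHS](llr_law_crossover Q mA).
by apply: PQ; rewrite -[X in measurable X]setTI; exact: measurable_crossover.
Qed.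

Lemma eq_ex_measure mu nu f : mu ≡μ nu -> llr_ex mu idfun f = llr_ex nu idfun f.
Proof.
by move=> e; rewrite !exU /Rintegral; congr fine; apply: eq_measure_integral => A mA _; exact: e.
Qed.

Lemma bms_ex_lin P a b f g : bounded_fun11 f -> bounded_fun11 g ->
  bms_ex P (fun u => a * f u + b * g u) = a * bms_ex P f + b * bms_ex P g.
Proof. exact: (ex_lin (llr_law P) mide). Qed.

Lemma bms_ex_le P f g : bounded_fun11 f -> bounded_fun11 g ->
  (forall u : R, -1 <= u <= 1 -> f u <= g u) -> bms_ex P f <= bms_ex P g.
Proof. exact: (ex_le (llr_law P) mide). Qed.

Lemma bms_ex_cst P c : bms_ex P (fun=> c) = c.
Proof. exact: ex_cst. Qed.

Lemma bms_ex_trivial f : bounded_fun11 f -> (forall u, f (- u) = f u) ->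
  (forall u : R, -1 <= u <= 1 -> 0 <= f u) -> bms_ex (trivial_delta R) f = f 0.
Proof.
move=> bf fN f0; apply: EFin_inj; rewrite bms_exE//=.
have mf : measurable_fun setT (fun t : R => (f (1 - 2 * t))%:E).
  apply/measurable_EFinP; apply: (measurableT_comp bf.1).
  by apply: measurable_funB => //; exact: measurable_funM.
rewrite integral_dirac//; last exact: measurable_funTS.
rewrite diracE mem_set; last by rewrite /= in_itv/= lexx invr_ge0 ler0n.
by rewrite mul1e divff// subrr.
Qed.

Lemma trivial_llr_le d (T : measurableType d) (mu : probability T R) (X : T -> \bar R) :
  measurable_fun setT X -> llr_le (llr_law (trivial_delta R)) idfun mu X.
Proof.
move=> mX f fc; have [_ fN f0 _] := fc; have bf := even_convex_bounded fc.
rewrite -/(bms_ex _ _) bms_ex_trivial// -(ex_cst mu X (f 0)); apply: ex_le => //.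
  exact: bounded_fun11_cst.
move=> u u11; rewrite -[f u](even_convex_norm u fc); apply: even_convex_mono => //.
by rewrite ler_norml.
Qed.

End llr_order.

(** * Mixtures over the number of summands *)

Section mixture.
Context {R : realType}.
Variables (p : nat -> R) (p0 : forall n, 0 <= p n).
Hypothesis p1 : (\sum_(0 <= n <oo) (p n)%:E = 1)%E.
Variable m : nat -> probability (\bar R) R.

Definition mixture_measure := mseries (fun n => mscale (NngNum (p0 n)) (m n)) 0.

HB.instance Definition _ := Measure.on mixture_measure.

Let mixture_setT : mixture_measure setT = 1%E.
Proof.
rewrite /mixture_measure/= /mseries -p1; apply: eq_eseriesr => n _.
transitivity ((p n)%:E * m n setT)%E => //.
by rewrite [X in (_ * X)%E](_ : _ = 1%E) ?mule1//; exact: probability_setT.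
Qed.

HB.instance Definition _ :=
  Measure_isProbability.Build _ _ _ mixture_measure mixture_setT.

Definition mixture : probability (\bar R) R := mixture_measure.

Lemma integral_mixture (f : \bar R -> R) : measurable_fun setT f ->
  (forall r, 0 <= f r) ->
  (\int[mixture]_r (f r)%:E = \sum_(0 <= n <oo) (p n)%:E * \int[m n]_r (f r)%:E)%E.
Proof.
move=> mf f0; have mEf : measurable_fun setT (EFin \o f) by exact/measurable_EFinP.
transitivity (\sum_(0 <= n <oo) \int[mscale (NngNum (p0 n)) (m n)]_r (f r)%:E)%E.
  by apply: ge0_integral_measure_series => // r _; rewrite lee_fin.
apply: eq_eseriesr => n _.
by apply: ge0_integral_mscale => // r _; rewrite lee_fin.
Qed.

Lemma symmetric_llr_mixture :
  (forall n, symmetric_llr (m n) idfun) -> symmetric_llr mixture idfun.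
Proof.
move=> sm phi mphi phi0; rewrite !integral_mixture//; last 2 first.
- exact: measurable_symmetrize.
- by move=> r; exact: symmetrize_ge0.
by apply: eq_eseriesr => n _; rewrite (sm n phi).
Qed.

Lemma ex_mixture (f : R -> R) : bounded_fun11 f ->
  (forall u : R, -1 <= u <= 1 -> 0 <= f u) ->
  ((llr_ex mixture idfun f)%:E = \sum_(0 <= n <oo) (p n * llr_ex (m n) idfun f)%:E)%E.
Proof.
move=> bf f0; have mide : measurable_fun setT (idfun : \bar R -> \bar R) by exact: measurable_id.
rewrite -(exE mixture mide bf).
rewrite (integral_mixture (f := f \o @tanh_half R)); last 2 first.
- exact: (measurableT_comp bf.1 (@measurable_tanh_half R)).
- by move=> r; apply: f0; exact: tanh_half_le1.
by apply: eq_eseriesr => n _; rewrite EFinM -(exE (m n) mide bf).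
Qed.

End mixture.

(** * Compactness: limits of decreasing sequences of laws *)

Section even_convex_continuity.
Context {R : realType}.

(** Upper bound: f increases up to a, and beyond a it lies below a chord ending at 1. Lower bound: a
    near-minorant at a, which works at a = 1 as well. *)
Lemma even_convex_near (f : R -> R) (a e : R) : even_convex f -> 0 <= a <= 1 -> 0 < e ->
  exists2 h : R, 0 < h & forall x : R, 0 <= x <= 1 -> `|x - a| <= h -> `|f x - f a| <= e.
Proof.
move=> fc /andP[a0 a1] e0; have [_ fN f0 fmin] := fc.
have a11 : -1 <= a <= 1 by apply/andP; split; lra.
have M0 : 0 <= f 1 by apply: f0; rewrite lexx andbT; lra.
have fa0 : 0 <= f a by apply: f0.
have e20 : 0 < e / 2 by lra.
have [c [s [h1 h2]]] := fmin a (e / 2) a11 e20.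
have s0 := normr_ge0 s.
have [h k0 hk] : exists2 k : R, 0 < k & forall x : R, 0 <= x <= 1 -> `|x - a| <= k -> f x - f a <= e.
  move: a1; rewrite le_eqVlt => /predU1P[->|a1].
    exists 1 => // x /andP[x0 x1] _.
    by have := even_convex_mono fc x0 x1 (lexx 1); lra.
  (* From the chord, f x - f a <= f 1 (x - a) / (1 - a); the summand 1 keeps the divisor
     positive. *)
  exists (e * (1 - a) / (f 1 + 1)); first by rewrite divr_gt0//; [rewrite mulr_gt0//; lra|lra].
  move=> x /andP[x0 x1]; rewrite ler_pdivlMr; last by lra.
  move=> xk; have [xa|ax] := leP x a.
    by have := even_convex_mono fc x0 xa (ltW a1); lra.
  have {}xk : (x - a) * (f 1 + 1) <= e * (1 - a).
    by move: xk; rewrite ger0_norm// subr_ge0 ltW.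
  suff : (1 - a) * (f x - f a) <= (x - a) * f 1.
    move=> H; rewrite -(ler_pM2l (_ : 0 < 1 - a)); last by lra.
    have xa0 : 0 <= x - a by lra.
    by apply: (le_trans H); lra.
  apply/ler_addgt0Pr => e' e'0.
  have x11 : -1 <= x <= 1 by apply/andP; split; lra.
  have [c' [s' [g1 g2]]] := fmin x (e') x11 e'0.
  have g3 := g2 a a11; have g4 := g2 1 (_ : -1 <= 1 <= 1).
  have {}g4 : c' + s' * 1 <= f 1 by apply: g4; rewrite lexx andbT; lra.
  have b1 : (1 - x) * (c' + s' * a) <= (1 - x) * f a by rewrite ler_wpM2l//; lra.
  have b2 : (x - a) * (c' + s' * 1) <= (x - a) * f 1 by rewrite ler_wpM2l//; lra.
  have b3 : (1 - a) * (f x - e') <= (1 - a) * (c' + s' * x) by rewrite ler_wpM2l//; lra.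
  have b4 : (x - a) * f a >= 0 by rewrite mulr_ge0//; lra.
  have b5 : (1 - a) * e' <= e' by nra.
  have : (1 - a) * (c' + s' * x) = (1 - x) * (c' + s' * a) + (x - a) * (c' + s' * 1) by ring.
  by move: b1 b2 b3 b4 b5; lra.
have k'0 : 0 < e / 2 / (`|s| + 1) by rewrite !divr_gt0//; lra.
exists (Num.min h (e / 2 / (`|s| + 1))); first by rewrite lt_min k0.
move=> x x01; rewrite le_min => /andP[/(hk _ x01) H]; rewrite ler_pdivlMr; last by lra.
move=> xk; rewrite ler_norml H andbT.
have x11 : -1 <= x <= 1 by move/andP: x01 => [? ?]; apply/andP; split; lra.
have := h2 x x11.
have : - (`|x - a| * (`|s| + 1)) <= s * (x - a).
  rewrite lerNl -mulrN (le_trans (ler_norm _))// normrM normrN mulrC.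
  by rewrite ler_wpM2l//; lra.
by lra.
Qed.

End even_convex_continuity.

Section quantile.
Context {R : realType}.
Implicit Types (f : R -> R).

(** Laws on [0, 1/2] as images of the uniform law under monotone functions: a limit of laws becomes
    a pointwise limit of functions. *)
Record quantile := Quantile {
  quantile_fun :> R -> R ;
  quantile_nd : {homo quantile_fun : s t / s <= t} ;
  quantile_itv : forall s, 0 <= quantile_fun s <= 2^-1 }.

Lemma measurable_quantile (q : quantile) : measurable_fun setT q.
Proof. by apply: nondecreasing_measurable => // s t; exact: quantile_nd. Qed.

HB.instance Definition _ (q : quantile) :=
  isMeasurableFun.Build _ _ _ _ (quantile_fun q) (measurable_quantile q).

Let quantile_supp (q : quantile) :
  (distribution (@unif01 R) (quantile_fun q) : probability R R) `[0, 2^-1]%classic = 1%E.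
Proof.
rewrite /= /distribution /pushforward.
have -> : quantile_fun q @^-1` `[0, 2^-1] = setT; last exact: probability_setT.
by apply/seteqP; split => r //= _; rewrite in_itv/= quantile_itv.
Qed.

Definition quantile_law (q : quantile) : delta_dist R := DeltaDist (quantile_supp q).

Lemma bms_ex_quantile (q : quantile) f : bounded_fun11 f -> (forall u, f (- u) = f u) ->
  (forall u : R, -1 <= u <= 1 -> 0 <= f u) ->
  ((bms_ex (quantile_law q) f)%:E = \int[unif01]_s (f (1 - 2 * q s))%:E)%E.
Proof.
move=> bf fN f0; rewrite bms_exE//.
have mf' : measurable_fun setT (fun t : R => `|f (1 - 2 * t)|).
  apply: measurableT_comp => //; apply: (measurableT_comp bf.1).
  by apply: measurable_funB => //; exact: measurable_funM.
transitivity (\int[quantile_law q]_(t in `[0%R, 2^-1%R]) (`|f (1 - 2 * t)|)%:E)%E.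
  apply: eq_integral => t /[!inE]/=; rewrite in_itv/= => /andP[t0 t1].
  by rewrite ger0_norm// f0//; apply/andP; split; lra.
rewrite integral_delta_supp//; last exact/measurable_EFinP.
rewrite [LHS]ge0_integral_distribution//; last exact/measurable_EFinP.
apply: eq_integral => s _ /=; congr EFin; rewrite ger0_norm// f0//.
by have /andP[? ?] := quantile_itv q s; apply/andP; split; lra.
Qed.

Section of_law.
Variable P : delta_dist R.

Let F t : R := fine (P `]-oo, t]%classic).

Let FE t : P `]-oo, t]%classic = (F t)%:E.
Proof. by rewrite fineK// fin_num_measure. Qed.

Let F_nd s t : s <= t -> F s <= F t.
Proof.
move=> st; rewrite -lee_fin -!FE; apply: le_measure; rewrite ?inE//.
by move=> x /=; rewrite !in_itv/= => /le_trans; apply.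
Qed.

Let F_ge0 t : 0 <= F t.
Proof. by rewrite -lee_fin -FE. Qed.

Let F_le1 t : F t <= 1.
Proof. by rewrite -lee_fin -FE; exact: probability_le1. Qed.

Let idR : R -> R := idfun.

HB.instance Definition _ := isMeasurableFun.Build _ _ _ _ idR (@measurable_id _ _ setT).

Let F_cont t s : (forall x, t < x -> x < 2^-1 -> s <= F x) -> t < 2^-1 -> s <= F t.
Proof.
move=> sF t1; pose X : {RV P >-> R} := idR.
have c := @cdf_right_continuous _ _ _ P X t.
have E x : cdf X x = (F x)%:E by rewrite -FE.
rewrite -lee_fin -E; apply: (cvge_ge (F := t^'+) _ c) => //.
near=> x; rewrite E lee_fin; apply: sF.
  by near: x; exact: nbhs_right_gt.
by near: x; exact: nbhs_right_lt.
Unshelve. all: by end_near. Qed.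

(** Its infimum is the generalized inverse of F. The clause t = 1/2 keeps the set nonempty for s >
    1, outside the support of the uniform law. *)
Let S s : set R := [set t | 0 <= t <= 2^-1 /\ (s <= F t \/ t = 2^-1)].

Let S_half s : S s 2^-1.
Proof. by split; [rewrite lexx invr_ge0 ler0n|right]. Qed.

Let q s : R := inf (S s).

Let S_inf s : has_inf (S s).
Proof.
split; first by exists 2^-1; exact: S_half.
by exists 0 => t [/andP[]].
Qed.

Let q_le s t : S s t -> q s <= t.
Proof. by apply: ge_inf; exact: (S_inf s).2. Qed.

Let q_nd : {homo q : s t / s <= t}.
Proof.
move=> s t st; apply: lb_le_inf; first by exists 2^-1; exact: S_half.
move=> x [x01 h]; apply: q_le; split => //.
by case: h => [h|]; [left; exact: le_trans st h|right].
Qed.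

Let q_itv s : 0 <= q s <= 2^-1.
Proof.
rewrite q_le// andbT; apply: lb_le_inf; first by exists 2^-1; exact: S_half.
by move=> t [/andP[]].
Qed.

(** Right continuity of F passes to the infimum. The event q <= t is then s <= F t, of uniform
    probability F t. *)
Let q_galois s t : 0 <= t -> t < 2^-1 -> (q s <= t) = (s <= F t).
Proof.
move=> t0 t1; apply/idP/idP => [qt|st]; last by apply: q_le; split; [rewrite t0 ltW|left].
apply: F_cont => // x tx x1.
have [|t' [t'01 h] t'x] := @inf_adherent _ (S s) (x - q s) _ (S_inf s).
  by rewrite subr_gt0; exact: le_lt_trans qt tx.
rewrite -/(q s) addrC subrK in t'x.
case: h => [h|h]; first by apply: (le_trans h); apply: F_nd; exact: ltW.
by move: t'x; rewrite h => /(lt_trans x1); rewrite ltxx.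
Qed.

Lemma quantile_exists : exists q' : quantile, P ≡μ quantile_law q'.
Proof.
exists (Quantile q_nd q_itv); apply: probability_rays_eq => t.
have C (Q : probability R R) x : Q `]x, +oo[%classic = (1 - Q `]-oo, x]%classic)%E.
  by rewrite -setCitvl; exact: probability_setC.
rewrite [LHS]C [RHS]C; congr (1 - _)%E; rewrite FE.
transitivity (unif01 (q @^-1` `]-oo, t])); last by [].
have [t0|t0] := ltP t 0.
  have -> : q @^-1` `]-oo, t] = set0.
    apply/seteqP; split => s //=; rewrite in_itv/= => qt.
    by have /andP[] := q_itv s; rewrite leNgt (le_lt_trans qt).
  rewrite measure0 -FE; apply/eqP; rewrite eq_le measure_ge0 andbT.
  have -> : 0%E = (1 - P `[0%R, 2^-1%R]%classic)%E by rewrite delta_law_supp subee.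
  have <- : P (~` `[0%R, 2^-1%R]%classic) = (1 - P `[0%R, 2^-1%R]%classic)%E by exact: probability_setC.
  apply: le_measure; rewrite ?inE//; first exact: measurableC.
  move=> x /=; rewrite !in_itv/= => xt; apply/negP; rewrite negb_and -ltNge.
  by rewrite (le_lt_trans xt).
have [t1|t1] := leP 2^-1 t.
  have -> : q @^-1` `]-oo, t] = setT.
    apply/seteqP; split => s //= _; rewrite in_itv/=.
    by have /andP[_ h] := q_itv s; exact: le_trans h t1.
  rewrite -FE; transitivity (1%E : \bar R); last by apply/esym; exact: probability_setT.
  apply/eqP; rewrite eq_le probability_le1//= -(delta_law_supp P).
  apply: le_measure; rewrite ?inE// => x /=; rewrite !in_itv/= => /andP[_ x1].
  exact: le_trans x1 t1.
have -> : q @^-1` `]-oo, t] = [set s | s <= F t].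
  by apply/seteqP; split => s /=; rewrite in_itv/= q_galois.
by rewrite unif01_le// F_ge0 F_le1.
Qed.

End of_law.

End quantile.

Section riemann_sums.
Context {R : realType}.
Implicit Types (G H : R -> R).

Lemma unif01_ico (a b : R) : 0 <= a -> a <= b -> b <= 1 -> unif01 `[a, b[%classic = (b - a)%:E.
Proof.
move=> a0 ab b1; rewrite unif01E//.
have -> : `[a, b[ `&` `[0, 1] = `[a, b[%classic.
  apply/seteqP; split => v /=; rewrite !in_itv/=; first by move=> [].
  by move=> /andP[av vb]; rewrite av vb (le_trans a0)//= (le_trans (ltW vb)).
rewrite lebesgue_measure_itv/= lte_fin; case: ltP => [_|ba]; first by rewrite -EFinD.
have -> : b = a by apply/eqP; rewrite eq_le ab ba.
by rewrite subrr.
Qed.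

Lemma integral_le_step H (M : R) (h : nat -> R) (N : nat) : measurable_fun setT H ->
  (forall s, 0 <= H s <= M) -> (forall j, 0 <= h j) ->
  (forall j s, (j < N.+1)%N -> j%:R / N.+1%:R <= s < j.+1%:R / N.+1%:R -> H s <= h j) ->
  (\int[unif01]_s (H s)%:E <= ((\sum_(j < N.+1) h j) / N.+1%:R)%:E)%E.
Proof.
move=> mH H01 h0 Hh; have N0 : 0 < N.+1%:R :> R by rewrite ltr0n.
have M0 : 0 <= M by have /andP[] := H01 0; exact: le_trans.
pose I j := `[j%:R / N.+1%:R, j.+1%:R / N.+1%:R[%classic : set R.
pose C := ~` `[0%R, 1%R[%classic : set R.
have mI j : measurable (I j) by exact: measurable_itv.
have mC : measurable C by apply: measurableC; exact: measurable_itv.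
have mind (A : set R) : measurable A -> measurable_fun setT (fun s => (\1_A s)%:E : \bar R).
  by move=> mA; apply/measurable_EFinP; exact: measurable_indic.
(* The last term dominates H off [0, 1[, a null set. *)
apply: (@le_trans _ _ (\int[unif01]_s (\sum_(j < N.+1) ((h j)%:E * (\1_(I j) s)%:E) + M%:E * (\1_C s)%:E))%E).
  apply: ge0_le_integral => //.
  - by move=> s _; rewrite lee_fin; have /andP[] := H01 s.
  - exact/measurable_EFinP.
  - apply: emeasurable_funD; last by apply: measurable_funeM; exact: mind.
    by apply: emeasurable_sum => j; apply: measurable_funeM; exact: mind.
  - move=> s _.
    have p0 (j : 'I_N.+1) : (0 <= (h j)%:E * (\1_(I j) s)%:E)%E by rewrite -EFinM lee_fin mulr_ge0.
    have [s01|s01] := boolP (s \in `[0%R, 1%R[); last first.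
      have -> : \1_C s = 1 :> R by rewrite indicE mem_set//; exact/negP.
      rewrite mule1 -[leLHS]add0e leeD ?sume_ge0// lee_fin.
      by have /andP[] := H01 s.
    move: s01; rewrite in_itv/= => /andP[s0 s1].
    have Ns0 : 0 <= s * N.+1%:R by rewrite mulr_ge0.
    have jN : (Num.trunc (s * N.+1%:R) < N.+1)%N.
      rewrite -(ltr_nat R); apply: (@le_lt_trans _ _ (s * N.+1%:R)).
        by rewrite truncn_le.
      by rewrite gtr_pMl.
    pose j := Ordinal jN.
    have Ij : j%:R / N.+1%:R <= s < j.+1%:R / N.+1%:R.
      apply/andP; split; first by rewrite ler_pdivrMr//=; have := truncn_le (s * N.+1%:R); rewrite Ns0.
      by rewrite ltr_pdivlMr//=; exact: truncnS_gt.
    have I1 : \1_(I j) s = 1 :> R by rewrite indicE mem_set//= /I /= in_itv.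
    rewrite (bigD1 j)//= I1 mule1 -addeA -[leLHS]adde0 leeD//; first by rewrite lee_fin; apply: Hh.
    by rewrite adde_ge0// ?sume_ge0// -EFinM lee_fin mulr_ge0.
rewrite ge0_integralD//; last 4 first.
- by move=> s _; apply: sume_ge0 => j _; rewrite -EFinM lee_fin mulr_ge0.
- by apply: emeasurable_sum => j; apply: measurable_funeM; exact: mind.
- by move=> s _; rewrite -EFinM lee_fin mulr_ge0.
- by apply: measurable_funeM; exact: mind.
rewrite ge0_integralZl_EFin//; last exact: mind.
have EC : (\int[unif01]_s (\1_C s)%:E = 0)%E.
  rewrite (integral_indic _ measurableT mC) setIT.
  have E1 : @unif01 R `[0%R, 1%R[%classic = 1%E by rewrite unif01_ico// subr0.
  transitivity (1 - @unif01 R `[0%R, 1%R[%classic)%E; first exact: probability_setC.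
  by rewrite [X in (1 - X)%E]E1 subee.
rewrite EC mule0 adde0 ge0_integral_sum//; last 2 first.
- by move=> j; apply: measurable_funeM; exact: mind.
- by move=> j s _; rewrite -EFinM lee_fin mulr_ge0.
rewrite mulr_suml -sumEFin le_eqVlt; apply/orP; left; apply/eqP.
apply: eq_bigr => j _; rewrite ge0_integralZl_EFin//; last exact: mind.
rewrite (integral_indic _ measurableT (mI j)) setIT EFinM; congr (_ * _)%E.
apply: (etrans (unif01_ico _ _ _)).
- by rewrite divr_ge0.
- by rewrite ler_pM2r ?invr_gt0// ler_nat.
- by rewrite ler_pdivrMr// mul1r ler_nat.
- by rewrite -mulrBl -natrB// subSnn mul1r.
Qed.

End riemann_sums.

Section decreasing_limit.
Context {R : realType}.
Implicit Types (f G : R -> R).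

Lemma sum_shift (g : nat -> R) n : \sum_(j < n) g j = \sum_(j < n) g j.+1 + (g 0%N - g n).
Proof.
elim: n => [|n IH]; first by rewrite !big_ord0 subrr addr0.
by rewrite big_ord_recr/= IH [in RHS]big_ord_recr/=; ring.
Qed.

(** For nonincreasing functions upper and lower Riemann sums differ by at most M / (N + 1), so
    closeness at N + 2 grid points controls the integrals. This replaces dominated convergence,
    which concerns sequences and not the ultrafilter used below. *)
Lemma integral_nonincreasing_close G G' (M e I I' : R) (N : nat) :
  {homo G : s t / s <= t >-> t <= s} -> {homo G' : s t / s <= t >-> t <= s} ->
  (forall s, 0 <= G s <= M) -> (forall s, 0 <= G' s <= M) ->
  (forall j, (j <= N.+1)%N -> `|G (j%:R / N.+1%:R) - G' (j%:R / N.+1%:R)| <= e) ->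
  (\int[unif01]_s (G s)%:E = I%:E)%E -> (\int[unif01]_s (G' s)%:E = I'%:E)%E ->
  I <= I' + e + M / N.+1%:R.
Proof.
move=> Gn G'n G0 G'0 GG' EI EI'; have N0 : 0 < N.+1%:R :> R by rewrite ltr0n.
have mG : measurable_fun setT G by apply: nonincreasing_measurable => // s t; exact: Gn.
have mG' : measurable_fun setT G' by apply: nonincreasing_measurable => // s t; exact: G'n.
pose x j : R := j%:R / N.+1%:R.
have h1 : I <= (\sum_(j < N.+1) G (x j)) / N.+1%:R.
  rewrite -lee_fin -EI; apply: (integral_le_step (h := fun j => G (x j)) mG G0).
    by move=> j; have /andP[] := G0 (x j).
  by move=> j s _ /andP[js _]; exact: Gn.
have EM : (\int[unif01]_s (M - G' s)%:E = (M - I')%:E)%E.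
  have : (\int[unif01]_s (M - G' s)%:E + \int[unif01]_s (G' s)%:E = M%:E)%E.
    rewrite -ge0_integralD//; last 4 first.
    - by move=> s _; rewrite lee_fin subr_ge0; have /andP[] := G'0 s.
    - by apply/measurable_EFinP; exact: measurable_funB.
    - by move=> s _; rewrite lee_fin; have /andP[] := G'0 s.
    - exact/measurable_EFinP.
    rewrite (eq_integral (cst M%:E)); last by move=> s _; rewrite -EFinD subrK.
    rewrite integral_cst// [X in (_ * X)%E](_ : _ = 1%E) ?mule1//.
    exact: probability_setT.
  rewrite EI'; case: (\int[unif01]_s (M - G' s)%:E)%E => [y||]//.
  by rewrite -EFinD => -[<-]; rewrite addrK.
(* A lower Riemann sum for G', obtained as an upper one for M - G'. *)
have h2 : M - I' <= (\sum_(j < N.+1) (M - G' (x j.+1))) / N.+1%:R.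
  rewrite -lee_fin -EM; apply: (integral_le_step (M := M) (h := fun j => M - G' (x j.+1))).
  - exact: measurable_funB.
  - by move=> s; have /andP[? ?] := G'0 s; apply/andP; split; lra.
  - by move=> j; have /andP[? ?] := G'0 (x j.+1); lra.
  - by move=> j s _ /andP[_ js]; rewrite lerD2l lerN2; apply: G'n; exact: ltW.
have h3 : \sum_(j < N.+1) G (x j) <= \sum_(j < N.+1) G' (x j) + N.+1%:R * e.
  have -> : N.+1%:R * e = \sum_(j < N.+1) e by rewrite sumr_const card_ord mulr_natl.
  rewrite -big_split/=; apply: ler_sum => j _.
  have := GG' j (ltnW (ltn_ord j)); rewrite ler_norml => /andP[_]; rewrite -/(x j); lra.
have h4 : \sum_(j < N.+1) G' (x j) <= \sum_(j < N.+1) G' (x j.+1) + M.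
  rewrite (sum_shift (fun j => G' (x j))) lerD2l.
  by have /andP[_ ?] := G'0 (x 0%N); have /andP[? _] := G'0 (x N.+1); lra.
rewrite sumrB sumr_const card_ord -mulr_natl in h2.
move: h1 h2; rewrite !ler_pdivlMr// => h1 h2.
rewrite -(ler_pM2r N0) mulrDl mulfVK ?gt_eqF//.
have -> : (I' + e) * N.+1%:R = I' * N.+1%:R + N.+1%:R * e by ring.
have : (M - I') * N.+1%:R = N.+1%:R * M - I' * N.+1%:R by ring.
by lra.
Qed.

Lemma eq_bms_ex (P Q : delta_dist R) f : bounded_fun11 f -> (forall u, f (- u) = f u) ->
  (forall u : R, -1 <= u <= 1 -> 0 <= f u) -> P ≡μ Q -> bms_ex P f = bms_ex Q f.
Proof.
move=> bf fN f0 PQ; apply: EFin_inj; rewrite !bms_exE//.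
by apply: eq_measure_integral => A mA _; exact: PQ.
Qed.

Lemma dist_le_halves (a b m e : R) :
  a <= b + e / 2 + m -> b <= a + e / 2 + m -> m <= e / 2 -> `|a - b| <= e.
Proof. by move=> *; rewrite ler_norml; apply/andP; split; lra. Qed.

(** Quantile functions take values in [0, 1/2], so they converge pointwise along an ultrafilter,
    without extracting a subsequence. As the expectation of f along P n is nonincreasing, its limit
    along the ultrafilter is its infimum. *)
Lemma decreasing_llr_limit (P : nat -> delta_dist R) :
  (forall n f, even_convex f -> bms_ex (P n.+1) f <= bms_ex (P n) f) ->
  exists L : delta_dist R, forall f, even_convex f ->
    (forall n, bms_ex L f <= bms_ex (P n) f) /\
    (forall e : R, 0 < e -> exists n, bms_ex (P n) f <= bms_ex L f + e).
Proof.
move=> dec; have [q Pq] := choice (fun n => quantile_exists (P n)).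
have [U [UU Uoo]] := @ultraFilterLemma nat \oo _.
(* The supremum of the numbers that are eventually below q n s is the limit along U. *)
pose A s : set R := [set x | \forall n \near U, x <= q n s].
have Uex (B : set nat) : U B -> exists n, B n by apply: filter_ex.
have A0 s : A s 0 by apply: nearW => n; have /andP[] := quantile_itv (q n) s.
have Aub s : ubound (A s) 2^-1.
  move=> x /Uex[n xn]; apply: (le_trans xn).
  by have /andP[] := quantile_itv (q n) s.
have Asup s : has_sup (A s) by split; [exists 0|exists 2^-1].
pose l s : R := sup (A s).
have l_itv s : 0 <= l s <= 2^-1.
  by rewrite ub_le_sup//=; [apply: ge_sup => //; exists 0|exact: (Asup s).2].
have l_nd : {homo l : s t / s <= t}.
  move=> s t st; apply: ge_sup; first by exists 0.
  move=> x Ax; apply: ub_le_sup; first exact: (Asup t).2.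
  by apply: filterS Ax => n xs; apply: (le_trans xs); exact: quantile_nd.
pose ql := Quantile l_nd l_itv.
have near_l s (h : R) : 0 < h -> \forall n \near U, `|q n s - l s| <= h.
  move=> h0.
  have B1 : \forall n \near U, l s - h <= q n s.
    have [x Ax xl] := sup_adherent h0 (Asup s).
    by apply: filterS Ax => n; apply: le_trans; exact: ltW.
  have B2 : \forall n \near U, q n s <= l s + h.
    (* An ultrafilter decides every set: if l s + h were below q n s for U-almost all n, it would
       belong to A s and exceed its supremum. *)
    have [C|C] := in_ultra_setVsetC [set n | l s + h <= q n s] UU.
      have := ub_le_sup (Asup s).2 (C : A s (l s + h)); rewrite -/(l s); lra.
    by apply: filterS C => n /= /negP; rewrite -ltNge => /ltW.
  by apply: filterS2 B1 B2 => n b1 b2; rewrite ler_norml; apply/andP; split; lra.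
exists (quantile_law ql) => f fc; have [_ fN f0 _] := fc; have bf := even_convex_bounded fc.
have M0 : 0 <= f 1 by apply: f0; rewrite lexx andbT; lra.
have itv11 (Q : @quantile R) s : 0 <= 1 - 2 * Q s <= 1.
  by have /andP[? ?] := quantile_itv Q s; apply/andP; split; lra.
have E (Q : @quantile R) := bms_ex_quantile Q bf fN f0.
pose G (Q : @quantile R) s := f (1 - 2 * Q s).
have Gn Q : {homo G Q : s t / s <= t >-> t <= s}.
  move=> s t st; have /andP[a1 a2] := itv11 Q s; have /andP[b1 b2] := itv11 Q t.
  have qst : Q s <= Q t by exact: quantile_nd.
  by apply: (even_convex_mono fc b1 _ a2); rewrite lerD2l lerN2 ler_pM2l.
have G01 Q s : 0 <= G Q s <= f 1.
  have /andP[a1 a2] := itv11 Q s.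
  rewrite /G f0; last by apply/andP; split; lra.
  by rewrite even_convex_le1//; apply/andP; split; lra.
have nearE (e : R) : 0 < e -> \forall n \near U,
    `|bms_ex (P n) f - bms_ex (quantile_law ql) f| <= e.
  move=> e0; pose N := Num.trunc (f 1 / (e / 2)).
  have N0 : 0 < N.+1%:R :> R by rewrite ltr0n.
  have e20 : 0 < e / 2 by lra.
  have MN : f 1 / N.+1%:R <= e / 2.
    rewrite ler_pdivrMr// mulrC -ler_pdivrMr//; apply: ltW; exact: truncnS_gt.
  have nG s : \forall n \near U, `|G (q n) s - G ql s| <= e / 2.
    have [h h0 hf] := even_convex_near fc (itv11 ql s) e20.
    have h20 : 0 < h / 2 by lra.
    apply: filterS (near_l s _ h20) => n qn; apply: hf; first exact: itv11.
    have -> : 1 - 2 * q n s - (1 - 2 * ql s) = - (2 * (q n s - l s)) by rewrite /ql/=; ring.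
    by rewrite normrN normrM (ger0_norm (_ : 0 <= 2))//; lra.
  (* Finitely many grid points, so a single member of U serves them all. *)
  have nall : \forall n \near U, forall j : 'I_N.+2,
      `|G (q n) (j%:R / N.+1%:R) - G ql (j%:R / N.+1%:R)| <= e / 2.
    by apply: filter_forall => j; exact: nG.
  apply: filterS nall => n hn.
  have hn' j : (j <= N.+1)%N -> `|G (q n) (j%:R / N.+1%:R) - G ql (j%:R / N.+1%:R)| <= e / 2.
    by move=> jN; exact: (hn (Ordinal (jN : (j < N.+2)%N))).
  have hn'' j : (j <= N.+1)%N -> `|G ql (j%:R / N.+1%:R) - G (q n) (j%:R / N.+1%:R)| <= e / 2.
    by move=> jN; rewrite distrC; exact: hn'.
  rewrite (eq_bms_ex bf fN f0 (Pq n)).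
  have c1 := integral_nonincreasing_close (Gn (q n)) (Gn ql) (G01 (q n)) (G01 ql) hn' (esym (E (q n))) (esym (E ql)).
  have c2 := integral_nonincreasing_close (Gn ql) (Gn (q n)) (G01 ql) (G01 (q n)) hn'' (esym (E ql)) (esym (E (q n))).
  exact: (dist_le_halves c1 c2 MN).
have anti m n : (m <= n)%N -> bms_ex (P n) f <= bms_ex (P m) f.
  move=> /subnK <-; elim: (n - m)%N => [|k IH]//.
  by apply: le_trans IH; exact: dec.
split.
  move=> m; apply/ler_addgt0Pr => e e0.
  have big : U [set n | (m <= n)%N] by apply: Uoo; exists m.
  have [n [/= mn]] := Uex _ (filterI big (nearE e e0)).
  by rewrite ler_norml => /andP[a1 a2]; have := anti m n mn; lra.
move=> e e0; have [n /=] := Uex _ (nearE e e0).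
by rewrite ler_norml => /andP[a1 a2]; exists n; lra.
Qed.

End decreasing_limit.

(** * BP with a random number of summands and its fixed points *)

Lemma le_nneseries_fin {R : realType} (a c : R) (u v : nat -> \bar R) :
  (a%:E = \sum_(0 <= n <oo) u n)%E -> (c%:E = \sum_(0 <= n <oo) v n)%E ->
  (forall n, 0 <= u n)%E -> (forall n, u n <= v n)%E -> a <= c.
Proof. by move=> au cv u0 uv; rewrite -lee_fin au cv; exact: lee_nneseries. Qed.

Section mixture_bp.
Context {R : realType}.
Implicit Types (f : R -> R) (P Q : delta_dist R).
Variables (delta : R).
Hypotheses (delta0 : 0 < delta) (delta1 : delta <= 1 / 2).
Variable PW : delta_dist R.
Variables (p : nat -> R) (p0 : forall n, 0 <= p n).
Hypothesis p1 : (\sum_(0 <= n <oo) (p n)%:E = 1)%E.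

Let theta := theta_of delta.
Let sq (u : R) := u ^+ 2.

Let theta_bounds : 0 <= theta < 1. Proof. exact: theta01. Qed.
Let theta_le1 : 0 <= theta <= 1.
Proof. by have /andP[-> /ltW ->] := theta_bounds. Qed.
Let mide : measurable_fun setT (idfun : \bar R -> \bar R).
Proof. exact: measurable_id. Qed.
Let bsq : bounded_fun11 sq.
Proof. by apply: even_convex_bounded; exact: even_convex_sqr. Qed.
Let bb : bounded_fun11 (@bhatt R). Proof. exact: bounded_bhatt. Qed.
Let bbt : bounded_fun11 (fun u => bhatt (theta * u)).
Proof. exact: (bounded_scale theta_le1 bb). Qed.
Let b0 : bounded_fun11 (fun=> 0 : R). Proof. exact: bounded_fun11_cst. Qed.
Let b1 : bounded_fun11 (fun=> 1 : R). Proof. exact: bounded_fun11_cst. Qed.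
Let bh (u : R) : -1 <= u <= 1 -> 0 <= bhatt u. Proof. by move=> _; exact: bhatt_ge0. Qed.

Definition bp_mixture P : probability (\bar R) R := mixture p0 p1 (bp_law delta PW P).

Let Z P := bms_ex P bhatt.
Let b P := bms_ex P (fun u => bhatt (theta * u)).
Let x P := bms_ex P sq.
Let ZW := Z PW.

Lemma ex_bp_mixture P f : bounded_fun11 f -> (forall u : R, -1 <= u <= 1 -> 0 <= f u) ->
  ((llr_ex (bp_mixture P) idfun f)%:E =
   \sum_(0 <= n <oo) (p n * llr_ex (bp_law delta PW P n) idfun f)%:E)%E.
Proof. exact: ex_mixture. Qed.

Lemma symmetric_llr_bp_mixture P : symmetric_llr (bp_mixture P) idfun.
Proof. by apply: symmetric_llr_mixture => n; exact: symmetric_llr_bp. Qed.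

Definition pgf (a : R) : R := fine (\sum_(0 <= n <oo) (p n * a ^+ n)%:E)%E.

Lemma pgfE a : 0 <= a <= 1 -> (\sum_(0 <= n <oo) (p n * a ^+ n)%:E = (pgf a)%:E)%E.
Proof.
move=> /andP[a0 a1]; have t0 n : (0 <= (p n * a ^+ n)%:E)%E.
  by rewrite lee_fin mulr_ge0// exprn_ge0.
rewrite fineK// ge0_fin_numE; last exact: nneseries_ge0.
apply: (@le_lt_trans _ _ 1%E); last by rewrite ltry.
rewrite -p1; apply: lee_nneseries => // n _.
by rewrite lee_fin ler_piMr// exprn_ile1.
Qed.

Lemma pgf1 : pgf 1 = 1.
Proof.
apply: EFin_inj; rewrite -pgfE ?ler01 ?lexx// -[RHS]p1.
by apply: eq_eseriesr => n _; rewrite expr1n mulr1.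
Qed.

Let Z01 P : 0 <= Z P <= 1.
Proof.
apply/andP; split; first exact: ex_ge0.
by rewrite -[leRHS](bms_ex_cst P 1); apply: bms_ex_le => // u _; exact: bhatt_le1.
Qed.

Let b01 P : 0 <= b P <= 1.
Proof.
apply/andP; split; first by apply: ex_ge0 => u _; exact: bhatt_ge0.
by rewrite -[leRHS](bms_ex_cst P 1); apply: bms_ex_le => // u _; exact: bhatt_le1.
Qed.

Let x01 P : 0 <= x P <= 1.
Proof.
apply/andP; split; first by apply: ex_ge0 => u _; exact: sqr_ge0.
rewrite -[leRHS](bms_ex_cst P 1); apply: bms_ex_le => // u /andP[? ?].
by rewrite /sq; nra.
Qed.

Lemma bp_mixture_bhatt P : llr_ex (bp_mixture P) idfun bhatt = pgf (b P) * ZW.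
Proof.
apply: EFin_inj; rewrite (ex_bp_mixture P bb bh) mulrC EFinM -pgfE ?b01//.
have /andP[ZW0 _] := Z01 PW; have /andP[bP0 _] := b01 P.
rewrite -nneseriesZl//; last by move=> n _; rewrite lee_fin mulr_ge0// exprn_ge0.
apply: eq_eseriesr => n _; rewrite bp_bhatt//= -EFinM; congr EFin.
by rewrite -/theta -/(b P) -/(Z PW) -/ZW; ring.
Qed.

Lemma llr_le_bp_mixture P Q : llr_le (llr_law P) idfun (llr_law Q) idfun ->
  llr_le (bp_mixture P) idfun (bp_mixture Q) idfun.
Proof.
move=> PQ f fc; have [_ _ f0 _] := fc; have bf := even_convex_bounded fc.
apply: (le_nneseries_fin (ex_bp_mixture P bf f0) (ex_bp_mixture Q bf f0)) => n.
  by rewrite lee_fin mulr_ge0// ex_ge0.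
by rewrite lee_fin ler_wpM2l//; exact: llr_le_bp.
Qed.

Lemma llr_le_survey_bp_mixture P : llr_le (llr_law PW) idfun (bp_mixture P) idfun.
Proof.
move=> f fc; have [_ _ f0 _] := fc; have bf := even_convex_bounded fc.
set e := llr_ex (llr_law PW) idfun f.
have e0 : 0 <= e by exact: ex_ge0.
have E : (e%:E = \sum_(0 <= n <oo) (e%:E * (p n)%:E))%E by rewrite nneseriesZl ?p1 ?mule1// => n _; rewrite lee_fin.
apply: (le_nneseries_fin E (ex_bp_mixture P bf f0)) => n.
  by rewrite -EFinM lee_fin mulr_ge0.
by rewrite -EFinM lee_fin mulrC ler_wpM2l//; exact: llr_le_survey_bp.
Qed.

Definition bp_fixed P := bp_mixture P ≡μ llr_law P.

Let fixedE P f : bp_fixed P -> bms_ex P f = llr_ex (bp_mixture P) idfun f.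
Proof. by move=> PP; apply/esym; exact: eq_ex_measure. Qed.

Section moments.
Variables (D kappa : R) (pgf' : R -> R).
Hypotheses (D0 : 0 < D) (kappa0 : 0 <= kappa).
Hypothesis mean : (\sum_(0 <= n <oo) (p n * n%:R)%:E = D%:E)%E.
Hypothesis fact_moment :
  (\sum_(0 <= n <oo) (p n * (n%:R * (n%:R - 1)))%:E = (D * kappa)%:E)%E.

(** With the same c for all n, the bound of [bp_sqr_ge] is linear in n and n (n - 1), so its mean
    needs only D and D kappa; c is optimized after averaging. *)
Lemma bp_mixture_sqr_ge P (y := theta ^+ 2 * x P) :
  D * y / (1 + kappa * y) <= llr_ex (bp_mixture P) idfun sq.
Proof.
have /andP[x0 _] := x01 P.
have y0 : 0 <= y by rewrite mulr_ge0// sqr_ge0.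
have ky0 : 0 <= kappa * y by rewrite mulr_ge0.
(* The maximizer of 2 c D y - c^2 (D y + D kappa y^2). *)
pose c := (1 + kappa * y)^-1.
have c0 : 0 <= c by rewrite invr_ge0; lra.
have nn0 n : 0 <= n%:R * (n%:R - 1) :> R.
  by case: n => [|n]; rewrite ?mul0r// mulr_ge0// -natr1 addrK.
have sq0 (u : R) : -1 <= u <= 1 -> 0 <= sq u by move=> _; exact: sqr_ge0.
have t1 n : (0 <= (p n * n%:R)%:E)%E by rewrite lee_fin mulr_ge0.
have t2 n : (0 <= (p n * (n%:R * (n%:R - 1)))%:E)%E by rewrite lee_fin mulr_ge0.
have t3 n : (0 <= (p n * llr_ex (bp_law delta PW P n) idfun sq)%:E)%E.
  by rewrite lee_fin mulr_ge0// ex_ge0.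
have c1 n : (0 <= (c ^+ 2 * y)%:E * (p n * n%:R)%:E)%E.
  by rewrite mule_ge0// lee_fin mulr_ge0// sqr_ge0.
have c2 n : (0 <= (c ^+ 2 * y ^+ 2)%:E * (p n * (n%:R * (n%:R - 1)))%:E)%E.
  by rewrite mule_ge0// lee_fin mulr_ge0// sqr_ge0.
have h : 2 * c * y * D <= llr_ex (bp_mixture P) idfun sq + (c ^+ 2 * y * D + c ^+ 2 * y ^+ 2 * (D * kappa)).
  have E1 : ((2 * c * y * D)%:E = \sum_(0 <= n <oo) ((2 * c * y)%:E * (p n * n%:R)%:E))%E.
    by rewrite nneseriesZl// mean.
  have E2 : ((llr_ex (bp_mixture P) idfun sq + (c ^+ 2 * y * D + c ^+ 2 * y ^+ 2 * (D * kappa)))%:E =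
    \sum_(0 <= n <oo) ((p n * llr_ex (bp_law delta PW P n) idfun sq)%:E +
      ((c ^+ 2 * y)%:E * (p n * n%:R)%:E +
       (c ^+ 2 * y ^+ 2)%:E * (p n * (n%:R * (n%:R - 1)))%:E)))%E.
    rewrite nneseriesD//; last by move=> n _ _; rewrite adde_ge0.
    rewrite nneseriesD//= !nneseriesZl// mean fact_moment -(ex_bp_mixture P bsq sq0).
    by rewrite -!EFinM -!EFinD.
  apply: (le_nneseries_fin E1 E2) => n; first by rewrite mule_ge0// lee_fin (mulr_ge0 _ y0)// mulr_ge0.
  rewrite -!EFinM -!EFinD lee_fin.
  have := ler_wpM2l (p0 n) (bp_sqr_ge delta0 delta1 PW P n c).
  rewrite -/theta -/sq -/(x P) -/y; lra.
have -> : D * y / (1 + kappa * y) = 2 * c * y * D - (c ^+ 2 * y * D + c ^+ 2 * y ^+ 2 * (D * kappa)).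
  by rewrite /c; field; rewrite gt_eqF//; lra.
by rewrite lerBlDr.
Qed.

Hypothesis pgf_le : forall a c, 0 <= a -> a <= c -> c <= 1 ->
  pgf c - pgf a <= pgf' c * (c - a).
Hypothesis pgf'_mono : forall a c, 0 <= a -> a <= c -> c <= 1 -> pgf' a <= pgf' c.
Hypothesis pgf'1 : pgf' 1 = D.

Let sqc : even_convex sq. Proof. exact: even_convex_sqr. Qed.

Let sq0 (u : R) : -1 <= u <= 1 -> 0 <= sq u. Proof. by move=> _; exact: sqr_ge0. Qed.

Let sqN (u : R) : sq (- u) = sq u. Proof. exact: sqrrN. Qed.

(** The case t = 1 of [even_convex_bhatt_excess], since [sqr_excess 1] vanishes on [-1, 1]. *)
Lemma even_convex_subr_bhatt : even_convex (fun u : R => 1 - bhatt u).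
Proof.
have [m1 m2 m3 m4] := even_convex_bhatt_excess (ler01 : 0 <= 1 :> R).
have E u : -1 <= u <= 1 -> sqr_excess 1 u = 0.
  rewrite -ler_norml => u1; rewrite /sqr_excess.
  have -> : Num.max 0 (`|u| - 1) = 0 by apply: max_idPl; lra.
  by rewrite expr0n.
split.
- by apply: measurable_funB => //; exact: measurable_bhatt.
- by move=> u; rewrite bhattN.
- by move=> u _; rewrite subr_ge0 bhatt_le1.
- move=> a e a11 e0; have [c [s [h1 h2]]] := m4 a e a11 e0.
  exists c, s; split; first by move: h1; rewrite E// mul0r subr0.
  by move=> u u11; have := h2 u u11; rewrite E// mul0r subr0.
Qed.

Let subZ P : bms_ex P (fun u => 1 - bhatt u) = 1 - Z P.
Proof.
transitivity (bms_ex P (fun u => 1 * 1 + (-1) * bhatt u)).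
  by apply: eq_ex => u _; ring.
by rewrite (bms_ex_lin P 1 (-1) b1 bb) bms_ex_cst -/(Z P); ring.
Qed.

Let subb P : bms_ex P (fun u => 1 - bhatt (theta * u)) = 1 - b P.
Proof.
transitivity (bms_ex P (fun u => 1 * 1 + (-1) * bhatt (theta * u))).
  by apply: eq_ex => u _; ring.
by rewrite (bms_ex_lin P 1 (-1) b1 bbt) bms_ex_cst -/(b P); ring.
Qed.

Let le P Q := forall f, even_convex f -> bms_ex P f <= bms_ex Q f.

Let le_Z P Q : le P Q -> Z Q <= Z P.
Proof. by move=> /(_ _ even_convex_subr_bhatt); rewrite !subZ; lra. Qed.

Let le_b P Q : le P Q -> b Q <= b P.
Proof.
by move=> /(_ _ (even_convex_scale theta_le1 even_convex_subr_bhatt)); rewrite !subb; lra.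
Qed.

Let le_bZ P Q : le P Q -> b P - b Q <= theta ^+ 2 * (Z P - Z Q).
Proof.
move=> /(_ _ (even_convex_bhatt_scale theta_bounds)).
have E S : bms_ex S (fun u => bhatt (theta * u) - theta ^+ 2 * bhatt u) = b S - theta ^+ 2 * Z S.
  transitivity (bms_ex S (fun u => 1 * bhatt (theta * u) + (- theta ^+ 2) * bhatt u)).
    by apply: eq_ex => u _; ring.
  by rewrite (bms_ex_lin S 1 (- theta ^+ 2) bbt bb) -/(b S) -/(Z S); ring.
by rewrite !E; lra.
Qed.

Let le_antisym P Q : le P Q -> Z P <= Z Q -> P ≡μ Q.
Proof.
move=> PQ ZPQ; apply: llr_law_inj; apply: symmetric_llr_le_antisym => //;
  exact: symmetric_llr_llr_law.
Qed.

Let y P := theta ^+ 2 * x P.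

Let y01 P : 0 <= y P < 1.
Proof.
have /andP[x0 x1] := x01 P; have /andP[t0 t1] := theta_bounds.
rewrite mulr_ge0 ?sqr_ge0//= (@le_lt_trans _ _ (theta ^+ 2))// ?expr_lt1//.
by rewrite ler_piMr// sqr_ge0.
Qed.

(** Jensen for the square root in linear form: U <= (U^2 + B^2) / (2 B), with B the claimed bound,
    positive because y < 1. *)
Let b_le P : b P <= Num.sqrt (1 - y P).
Proof.
have /andP[y0 y1] := y01 P; set B := Num.sqrt _.
have B0 : 0 < B by rewrite sqrtr_gt0; lra.
have BB : B ^+ 2 = 1 - y P by rewrite sqr_sqrtr//; lra.
suff : b P <= (2 * B)^-1 * (1 - y P) + B / 2.
  rewrite -BB => /le_trans; apply; rewrite le_eqVlt; apply/orP; left; apply/eqP.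
  by field; rewrite gt_eqF.
have -> : (2 * B)^-1 * (1 - y P) + B / 2 =
    bms_ex P (fun u => ((2 * B)^-1 + B / 2) * 1 + (- ((2 * B)^-1 * theta ^+ 2)) * sq u).
  by rewrite (bms_ex_lin P _ _ b1 bsq) bms_ex_cst -/(x P) /y; ring.
apply: bms_ex_le => //; first exact: bounded_fun11_lin.
move=> u u11; have := bhatt_sqr (scale11 theta_le1 u11); set U := bhatt _ => hU.
have -> : ((2 * B)^-1 + B / 2) * 1 + (- ((2 * B)^-1 * theta ^+ 2)) * sq u =
    (2 * B)^-1 * (U ^+ 2 + B ^+ 2) by rewrite hU /sq; field; rewrite gt_eqF.
rewrite -(ler_pM2l (_ : 0 < 2 * B)); last by lra.
rewrite mulrA divff ?mul1r; last by rewrite gt_eqF//; lra.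
by have := sqr_ge0 (U - B); lra.
Qed.

Let fixedZ P : bp_fixed P -> Z P = pgf (b P) * ZW.
Proof. by move=> PP; rewrite /Z (fixedE _ PP) bp_mixture_bhatt. Qed.

(** At a fixed point x >= D theta^2 x / (1 + kappa theta^2 x); dividing by x > 0 leaves the lower
    bound on y that [bp_contraction] asks for. *)
Let fixedx P : bp_fixed P -> 0 < x P -> D * theta ^+ 2 - 1 <= kappa * y P.
Proof.
move=> PP xP.
have : D * y P / (1 + kappa * y P) <= x P by rewrite [leRHS](fixedE _ PP); exact: bp_mixture_sqr_ge.
have /andP[y0 _] := y01 P; have ky0 : 0 <= kappa * y P by rewrite mulr_ge0.
rewrite ler_pdivrMr; last by lra.
rewrite /y => h; have : x P * (D * theta ^+ 2) <= x P * (1 + kappa * (theta ^+ 2 * x P)).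
  by move: h; lra.
by rewrite ler_pM2l//; lra.
Qed.

Let ZW0 : 0 <= ZW <= 1. Proof. exact: Z01. Qed.

(* z stands for theta^2 E (1 - 2 Delta)^2 at a fixed point; for the smallest
   admissible z, the left-hand side of the conclusion is C1 or C2. *)
Definition bp_contraction := forall z, 0 <= z < 1 -> D * theta ^+ 2 - 1 <= kappa * z ->
  ZW * theta ^+ 2 * pgf' (Num.sqrt (1 - z)) < 1.

Let unique P L : bp_contraction -> bp_fixed P -> bp_fixed L -> le P L ->
  D * theta ^+ 2 - 1 <= kappa * y P -> P ≡μ L.
Proof.
move=> C PP LL PL hy; apply: le_antisym => //; rewrite leNgt; apply/negP => ZLP.
have /andP[b0' b1'] := b01 P; have /andP[bL0 bL1] := b01 L.
have bLP := le_b PL; have bZ := le_bZ PL.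
have /andP[z0 z1] := ZW0; have y0 := y01 P; have bB := b_le P.
have B1 : Num.sqrt (1 - y P) <= 1.
  by rewrite -[leRHS]sqrtr1 ler_wsqrtr//; have /andP[? _] := y0; lra.
have g1 := pgf_le bL0 bLP b1'; have g2 := pgf'_mono b0' bB B1.
have g3 := C _ y0 hy.
have E : Z P - Z L = ZW * (pgf (b P) - pgf (b L)) by rewrite (fixedZ PP) (fixedZ LL); ring.
have h1 : Z P - Z L <= ZW * (pgf' (Num.sqrt (1 - y P)) * (b P - b L)).
  rewrite E ler_wpM2l// (le_trans g1)// ler_wpM2r// subr_ge0//.
(* A negative value of pgf' at this point would contradict h1 and Z L < Z P. *)
have g0 : 0 <= pgf' (Num.sqrt (1 - y P)).
  rewrite leNgt; apply/negP => gneg.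
  have : ZW * (pgf' (Num.sqrt (1 - y P)) * (b P - b L)) <= 0.
    apply: mulr_ge0_le0 => //; apply: mulr_le0_ge0; first exact: ltW.
    by rewrite subr_ge0.
  have dd0 : 0 < Z P - Z L by rewrite subr_gt0.
  by move=> h1'; have := le_trans h1 h1'; rewrite leNgt dd0.
have h2 : ZW * (pgf' (Num.sqrt (1 - y P)) * (b P - b L)) <=
    ZW * theta ^+ 2 * pgf' (Num.sqrt (1 - y P)) * (Z P - Z L).
  have -> : ZW * theta ^+ 2 * pgf' (Num.sqrt (1 - y P)) * (Z P - Z L) =
    ZW * (pgf' (Num.sqrt (1 - y P)) * (theta ^+ 2 * (Z P - Z L))) by ring.
  by rewrite ler_wpM2l// ler_wpM2l.
have d0 : 0 < Z P - Z L by rewrite subr_gt0.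
have : ZW * theta ^+ 2 * pgf' (Num.sqrt (1 - y P)) * (Z P - Z L) < 1 * (Z P - Z L).
  by rewrite ltr_pM2r.
by lra.
Qed.

Let perfect : delta_dist R := delta_of (\d_(+oo%E) : probability (\bar R) R).

Let ex_perfect f : even_convex f -> bms_ex perfect f = f 1.
Proof.
move=> fc; have [mf fN f0 _] := fc; have bf := even_convex_bounded fc.
rewrite bms_ex_delta_of// exU /Rintegral integral_dirac//.
  by rewrite diracT mul1e.
by apply/measurable_EFinP; exact: (measurableT_comp mf (measurable_th_llr mide)).
Qed.

Let step P := delta_of (bp_mixture P).

Let ex_step P f : even_convex f -> bms_ex (step P) f = llr_ex (bp_mixture P) idfun f.
Proof.
by move=> fc; have [_ fN f0 _] := fc; apply: bms_ex_delta_of => //; exact: even_convex_bounded.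
Qed.

Let Pn n := iter n step perfect.

Let step_mono P Q : le P Q -> le (step P) (step Q).
Proof. by move=> PQ f fc; rewrite !ex_step//; exact: llr_le_bp_mixture. Qed.

Let le_perfect P : le P perfect.
Proof.
move=> f fc; have bf := even_convex_bounded fc.
rewrite ex_perfect// -(bms_ex_cst P (f 1)); apply: bms_ex_le => //; first exact: bounded_fun11_cst.
by move=> u u11; exact: even_convex_le1.
Qed.

Let Pn_dec n : le (Pn n.+1) (Pn n).
Proof. by elim: n => [|n IH]; [exact: le_perfect|exact: step_mono]. Qed.

Let fixed_le_Pn P n : bp_fixed P -> le P (Pn n).
Proof.
move=> PP; elim: n => [|n IH]; first exact: le_perfect.
by move=> f fc; rewrite (fixedE _ PP) -(ex_step P fc); exact: step_mono.
Qed.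

(** The last clause is a barrier: s -> D theta^2 s / (1 + kappa theta^2 s) is nondecreasing and
    sends x0 to at least x0, so the second moments of the iterates never fall below x0. It serves to
    show that L is non-trivial. *)
Lemma greatest_fixed_point : exists L, [/\ bp_fixed L,
  forall P, bp_fixed P -> le P L &
  forall x0, 0 <= x0 <= 1 -> x0 * (1 + kappa * (theta ^+ 2 * x0)) <= D * theta ^+ 2 * x0 -> x0 <= x L].
Proof.
have [L HL] := decreasing_llr_limit (fun n f fc => @Pn_dec n f fc).
have LPn n : le L (Pn n) by move=> f fc; exact: (HL f fc).1.
have Lglb f (c : R) : even_convex f -> (forall n, c <= bms_ex (Pn n) f) -> c <= bms_ex L f.
  move=> fc h; apply/ler_addgt0Pr => e e0; have [n] := (HL f fc).2 e e0.
  exact: le_trans (h n).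
exists L; split.
- have stepL : le (step L) L.
    move=> f fc; apply: Lglb => // -[|n]; first exact: le_perfect.
    exact: (step_mono (LPn n)).
  (* [step L] is below L by monotonicity; equality then follows from Z (step L) <= Z L, so only this
     one number has to pass to the limit. *)
  apply: symmetric_llr_le_antisym.
  + exact: symmetric_llr_bp_mixture.
  + exact: symmetric_llr_llr_law.
  + by move=> f fc; rewrite -(ex_step L fc); exact: stepL.
  rewrite bp_mixture_bhatt -/(bms_ex L bhatt) -/(Z L).
  have /andP[z0 z1] := ZW0; have /andP[bL0 bL1] := b01 L.
  have ZPn n : pgf (b (Pn n)) * ZW <= Z L.
    have := le_Z (LPn n.+1); have -> : Z (Pn n.+1) = pgf (b (Pn n)) * ZW.
      rewrite -bp_mixture_bhatt; exact: (bms_ex_delta_of _ bb (@bhattN R) bh).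
    by [].
  apply/ler_addgt0Pr => e e0.
  (* The generating function is D-Lipschitz on [0, 1], its slopes being at most pgf' 1 = D. *)
  have eD : 0 < e / D by rewrite divr_gt0.
  have [n] := (HL _ (even_convex_scale theta_le1 even_convex_subr_bhatt)).2 _ eD.
  rewrite !subb => hn; have bn := le_b (LPn n); have /andP[bn0 bn1] := b01 (Pn n).
  have g := pgf_le bn0 bn bL1.
  have g2 := pgf'_mono bL0 bL1 (lexx 1); rewrite pgf'1 in g2.
  have g3 : pgf (b L) - pgf (b (Pn n)) <= e.
    apply: (le_trans g); apply: (@le_trans _ _ (D * (b L - b (Pn n)))).
      by rewrite ler_wpM2r// subr_ge0.
    by rewrite -ler_pdivlMl// mulrC; lra.
  have := ZPn n; have : (pgf (b L) - pgf (b (Pn n))) * ZW <= e * ZW by rewrite ler_wpM2r.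
  have : e * ZW <= e by rewrite ler_piMr// ltW.
  by lra.
- by move=> P PP f fc; apply: Lglb => // n; exact: fixed_le_Pn.
- move=> x0 /andP[x00 x01'] hx0; apply: (Lglb _ _ sqc); elim=> [|n IH].
    by rewrite [leRHS](ex_perfect sqc); have -> : sq 1 = 1 by exact: expr1n.
  rewrite (ex_step _ sqc); apply: le_trans (bp_mixture_sqr_ge _).
  rewrite -/(y (Pn n)); have /andP[yn0 _] := y01 (Pn n).
  have ky0 : 0 <= kappa * y (Pn n) by rewrite mulr_ge0.
  rewrite ler_pdivlMr; last by lra.
  have {}IH : x0 <= x (Pn n) by [].
  move: x00; rewrite le_eqVlt => /predU1P[<-|x00]; first by rewrite mul0r mulr_ge0// ltW.
  have H : 1 + kappa * (theta ^+ 2 * x0) <= D * theta ^+ 2.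
    by rewrite -(ler_pM2l x00); lra.
  have h1 : x (Pn n) * (1 + kappa * (theta ^+ 2 * x0)) <= x (Pn n) * (D * theta ^+ 2).
    by rewrite ler_wpM2l//; exact: le_trans (ltW x00) IH.
  by rewrite /y; lra.
Qed.

Let triv := trivial_delta R.

Let triv_le P : le triv P.
Proof. by move=> f fc; exact: (trivial_llr_le (llr_law P) mide fc). Qed.

Let bhatt0 : bhatt 0 = 1 :> R.
Proof. by rewrite /bhatt expr0n subr0 sqrtr1. Qed.

Let Z_triv : Z triv = 1.
Proof. by rewrite /Z (bms_ex_trivial bb (@bhattN R) bh). Qed.

Let subZ_le P : 1 - Z P <= x P.
Proof.
rewrite -subZ; apply: (bms_ex_le P (even_convex_bounded even_convex_subr_bhatt) bsq).
by move=> u /bhatt_sub_le1/andP[].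
Qed.

Let x0_triv P : x P <= 0 -> P ≡μ triv.
Proof.
move=> xP A mA; apply/esym; apply: (le_antisym (triv_le P)) => //.
by rewrite Z_triv; have := subZ_le P; lra.
Qed.

(** The trivial law is below every law, so only its Z has to be compared with that of its image,
    which is pgf 1 times Z(W), that is 1. *)
Let fixed_triv : ZW = 1 -> bp_fixed triv.
Proof.
move=> ZW1 A mA; apply/esym; apply: symmetric_llr_le_antisym => //.
- exact: symmetric_llr_llr_law.
- exact: symmetric_llr_bp_mixture.
- exact: (trivial_llr_le _ mide).
rewrite bp_mixture_bhatt ZW1 mulr1 -/(bms_ex triv bhatt) -/(Z triv) Z_triv.
have -> : b triv = 1; last by rewrite pgf1.
rewrite /b (bms_ex_trivial bbt); first by rewrite mulr0.
- by move=> u; rewrite mulrN bhattN.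
- by move=> u _; exact: bhatt_ge0.
Qed.

Let x_ge_W P : bp_fixed P -> x PW <= x P.
Proof. by move=> PP; rewrite [x P]/x (fixedE _ PP); exact: (llr_le_survey_bp_mixture P sqc). Qed.

(** A non-trivial survey keeps the second moment of every fixed point positive, so [fixedx] applies
    to all of them. *)
Lemma exactly_one_bp_fixed : 0 < x PW -> bp_contraction -> exactly_one bp_fixed.
Proof.
move=> xW C; have [L [LL Lmax _]] := greatest_fixed_point.
exists L => // Q QQ; apply: unique => //; first exact: Lmax.
by apply: fixedx => //; exact: lt_le_trans xW (x_ge_W QQ).
Qed.

Lemma trivial_and_one_nontrivial_bp_fixed : ZW = 1 -> 1 < D * theta ^+ 2 ->
  bp_contraction -> trivial_and_one_nontrivial bp_fixed.
Proof.
move=> ZW1 D1 C; split; first exact: fixed_triv.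
have [L [LL Lmax Lx]] := greatest_fixed_point.
have xL : 0 < x L.
  have k1 : 0 < kappa * theta ^+ 2 + 1 by have := mulr_ge0 kappa0 (sqr_ge0 theta); lra.
  (* Any w in ]0, 1] with 1 + kappa theta^2 w <= D theta^2 is a barrier; the summand 1 keeps the
     divisor positive when kappa = 0. *)
  pose w := Num.min 1 ((D * theta ^+ 2 - 1) / (kappa * theta ^+ 2 + 1)).
  have w0 : 0 < w by rewrite lt_min ltr01 divr_gt0// subr_gt0.
  have w1 : w <= 1 by rewrite ge_min lexx.
  have : w <= (D * theta ^+ 2 - 1) / (kappa * theta ^+ 2 + 1) by rewrite ge_min lexx orbT.
  rewrite ler_pdivlMr// => w2; apply: (lt_le_trans w0); apply: Lx; first by rewrite ltW.
  rewrite mulrC; apply: ler_wpM2r; first exact: ltW.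
  by move: w2; lra.
exists L; split => //.
  move=> Lt; have := eq_bms_ex bsq sqN sq0 Lt.
  by rewrite -/(x L) (bms_ex_trivial bsq sqN sq0) {1}/sq expr0n/= => xL0; rewrite xL0 ltxx in xL.
move=> Q QQ; have [xQ|xQ] := leP (x Q) 0; [left; exact: x0_triv|right].
by apply: unique => //; [exact: Lmax|exact: fixedx].
Qed.

(** Convexity of the generating function gives 1 - Z <= D (1 - b), and [bhatt_scale_gap] gives D (1
    - b) <= 1 - Z - D k E u^4. Hence E u^4 <= 0 even when D theta^2 = 1, and Z = 1 follows. *)
Lemma only_trivial_bp_fixed : ZW = 1 -> D * theta ^+ 2 <= 1 -> only_trivial bp_fixed.
Proof.
move=> ZW1 D1; split; first exact: fixed_triv.
move=> Q QQ A mA; apply/esym; apply: (le_antisym (triv_le Q)) => //.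
rewrite Z_triv; have ZQ := fixedZ QQ; rewrite ZW1 mulr1 in ZQ.
have /andP[bQ0 bQ1] := b01 Q.
have g := pgf_le bQ0 bQ1 (lexx 1); rewrite pgf1 pgf'1 -ZQ in g.
pose k := theta ^+ 2 * (1 - theta ^+ 2) / 8.
pose x4 := bms_ex Q (fun u => u ^+ 4).
have b4 : bounded_fun11 (fun u : R => u ^+ 4).
  split; first exact: measurable_funX.
  by exists 1 => u; rewrite -ler_norml normrX => u1; rewrite exprn_ile1.
have bsub := even_convex_bounded even_convex_subr_bhatt.
have bsubt := even_convex_bounded (even_convex_scale theta_le1 even_convex_subr_bhatt).
have gap : k * x4 <= theta ^+ 2 * (1 - Z Q) - (1 - b Q).
  have -> : k * x4 = bms_ex Q (fun u => k * u ^+ 4 + 0 * 0) by rewrite (bms_ex_lin Q k 0 b4 b0) mul0r addr0.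
  have -> : theta ^+ 2 * (1 - Z Q) - (1 - b Q) =
    bms_ex Q (fun u => theta ^+ 2 * (1 - bhatt u) + (-1) * (1 - bhatt (theta * u))).
    by rewrite (bms_ex_lin Q (theta ^+ 2) (-1) bsub bsubt) subZ subb; ring.
  apply: (bms_ex_le Q (bounded_fun11_lin k 0 b4 b0) (bounded_fun11_lin _ _ bsub bsubt)).
  by move=> u u11; rewrite mul0r addr0 mulN1r; exact: (bhatt_scale_gap theta_le1 u11).
have /andP[t0 t1] := theta_bounds.
have x40 : 0 <= x4 by apply: ex_ge0 => u _; rewrite (exprM u 2 2) sqr_ge0.
have /andP[ZQ0 ZQ1] := Z01 Q.
(* The constant k vanishes at theta = 0, but then b Q = 1 and convexity alone gives Z = 1. *)
move: t0; rewrite le_eqVlt => /predU1P[t0|t0].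
  have : b Q = 1.
    rewrite -(bms_ex_cst Q 1); apply: eq_ex => u _.
    by rewrite -t0 mul0r bhatt0.
  by move=> bQ; rewrite bQ subrr mulr0 in g; lra.
have k0 : 0 < k.
  rewrite divr_gt0// mulr_gt0 ?exprn_gt0// subr_gt0 expr_lt1// ltW//.
have x4le : x4 <= 0.
  rewrite -(pmulr_rle0 _ k0) -(pmulr_rle0 _ D0).
  have h1 : D * (k * x4) <= D * (theta ^+ 2 * (1 - Z Q) - (1 - b Q)) by rewrite ler_wpM2l// ltW.
  have h2 : D * theta ^+ 2 * (1 - Z Q) <= 1 * (1 - Z Q) by rewrite ler_wpM2r// subr_ge0.
  by move: h1 h2 g; lra.
apply/ler_addgt0Pr => e e0.
(* The inequality of means, in place of Cauchy-Schwarz, passes from E u^4 <= 0 to E u^2 <= e. *)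
have h : x Q <= e + (4 * e)^-1 * x4.
  have -> : e + (4 * e)^-1 * x4 = bms_ex Q (fun u => e * 1 + (4 * e)^-1 * u ^+ 4).
    by rewrite (bms_ex_lin Q e (4 * e)^-1 b1 b4) bms_ex_cst mulr1.
  apply: (bms_ex_le Q bsq (bounded_fun11_lin e (4 * e)^-1 b1 b4)).
  move=> u _; rewrite (exprM u 2 2) -/(sq u) mulr1.
  have e4 : 0 < 4 * e by lra.
  rewrite -(ler_pM2l e4).
  have -> : 4 * e * (e + (4 * e)^-1 * sq u ^+ 2) = 4 * e * e + sq u ^+ 2.
    by field; rewrite gt_eqF.
  by have := sqr_ge0 (sq u - 2 * e); lra.
have : (4 * e)^-1 * x4 <= 0 by rewrite mulr_ge0_le0// invr_ge0; lra.
by have := subZ_le Q; lra.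
Qed.

End moments.

End mixture_bp.

(** * Error probability and Bhattacharyya parameter of the survey *)

Section survey.
Context {R : realType}.
Implicit Types (PW : delta_dist R).

Lemma Bhattacharyya_bms_ex PW : Bhattacharyya PW = bms_ex PW bhatt.
Proof.
apply: EFin_inj; rewrite (bms_exE PW (@bounded_bhatt R) (@bhattN R)); last first.
  by move=> u _; exact: bhatt_ge0.
have m : measurable_fun setT (fun t : R => bhatt (1 - 2 * t)).
  apply: (measurableT_comp (@measurable_bhatt R)).
  by apply: measurable_funB => //; exact: measurable_funM.
have b0 (t : R) : (0 <= (bhatt (1 - 2 * t))%:E)%E by rewrite lee_fin bhatt_ge0.
have h : \int[PW]_t (2 * Num.sqrt (t * (1 - t))) = \int[PW]_t bhatt (1 - 2 * t).
  apply: eq_Rintegral => t _; rewrite /bhatt.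
  have -> : 1 - (1 - 2 * t) ^+ 2 = 2 ^+ 2 * (t * (1 - t)) by ring.
  by rewrite [RHS]sqrtrM ?sqr_ge0// sqrtr_sqr ger0_norm.
rewrite /Bhattacharyya h integral_delta_supp//; last exact/measurable_EFinP.
rewrite /Rintegral fineK// ge0_fin_numE; last exact: integral_ge0.
apply: (@le_lt_trans _ _ (\int[PW]_t (cst 1 t))%E).
  apply: ge0_le_integral => //; first exact/measurable_EFinP.
  by move=> t _; rewrite lee_fin bhatt_le1.
by rewrite integral_cst// mul1e (le_lt_trans (probability_le1 _ measurableT))// ltry.
Qed.

Lemma bounded_fun11_norm : bounded_fun11 (fun u : R => `|u|).
Proof.
split; first exact: normr_measurable.
by exists 1 => u; rewrite normr_id ler_norml.
Qed.

Lemma Pe_bms_ex PW : bms_ex PW (fun u => `|u|) = 1 - 2 * Pe PW.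
Proof.
apply: EFin_inj; rewrite (bms_exE PW bounded_fun11_norm (@normrN _ _)); last first.
  by move=> u _; exact: normr_ge0.
pose I : set R := `[0, 2^-1]%classic.
have mI : measurable I by exact: measurable_itv.
have PI : PW I = 1%E := delta_law_supp PW.
have int (f : R -> R) : measurable_fun setT f -> (forall t, I t -> `|f t| <= 1) ->
    PW.-integrable I (EFin \o f).
  move=> mf f1; apply: measurable_bounded_integrable => //.
  - exact: (le_lt_trans (probability_le1 _ mI) (ltry _)).
  - exact: measurable_funTS.
  - exists 1; split => // M M1 t It /=.
    exact: le_trans (f1 t It) (ltW M1).
have int1 := int (cst 1) (measurable_cst _) (fun _ _ => ltac:(by rewrite normr1)).
have I01 t : I t -> 0 <= t <= 2^-1 by rewrite /I/= in_itv.
have idI : PW.-integrable I (EFin \o (fun t : R => t)).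
  apply: int => // t /I01 t01; rewrite ger0_norm; lra.
have id2I : PW.-integrable I (EFin \o (fun t : R => 2 * t)).
  by apply: int => [|t /I01 t01]; [exact: measurable_funM|rewrite ger0_norm; lra].
have -> : Pe PW = \int[PW]_(t in I) t.
  by rewrite /Pe /Rintegral integral_delta_supp//; exact/measurable_EFinP.
transitivity (\int[PW]_(t in I) (1 - 2 * t)%:E)%E.
  by apply: eq_integral => t /set_mem/I01 t01; rewrite ger0_norm//; lra.
have <- : \int[PW]_(t in I) (1 - 2 * t) = 1 - 2 * \int[PW]_(t in I) t.
  rewrite -(RintegralZl 2 mI idI) (RintegralB mI int1 id2I); congr (_ - _).
  rewrite Rintegral_cst// mul1r -[RHS]/(fine 1%E); congr fine; exact: PI.
rewrite /Rintegral fineK//; apply: integrable_fin_num => //.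
apply: int => [|t /I01 t01]; first by apply: measurable_funB => //; exact: measurable_funM.
by rewrite ger0_norm; lra.
Qed.

(** The hypothesis says x1 = E |u| > 0; integrating |u| <= x1 / 2 + u^2 / (2 x1) gives E u^2 > 0. *)
Lemma Pe_lt_half PW : Pe PW < 1 / 2 -> 0 < bms_ex PW (fun u => u ^+ 2).
Proof.
have bn := bounded_fun11_norm.
have bq : bounded_fun11 (fun u : R => u ^+ 2).
  by apply: even_convex_bounded; exact: even_convex_sqr.
move=> h; have := Pe_bms_ex PW; set x1 := bms_ex _ _ => e1.
set x2 := bms_ex _ _.
have x1p : 0 < x1 by lra.
have : x1 <= x1 / 2 + (2 * x1)^-1 * x2.
  have -> : x1 / 2 + (2 * x1)^-1 * x2 =
      bms_ex PW (fun u => x1 / 2 * 1 + (2 * x1)^-1 * u ^+ 2).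
    by rewrite (bms_ex_lin PW _ _ (bounded_fun11_cst 1) bq) bms_ex_cst mulr1.
  apply: (bms_ex_le PW bn (bounded_fun11_lin _ _ (bounded_fun11_cst 1) bq)) => u _.
  rewrite -(ler_pM2l (_ : 0 < 2 * x1)); last by lra.
  rewrite -[u ^+ 2]real_normK ?num_real//.
  have -> : 2 * x1 * (x1 / 2 * 1 + (2 * x1)^-1 * `|u| ^+ 2) = x1 ^+ 2 + `|u| ^+ 2.
    by field; rewrite gt_eqF.
  by have := sqr_ge0 (`|u| - x1); lra.
move=> h1; have : 0 < (2 * x1)^-1 * x2 by lra.
by rewrite pmulr_rgt0// invr_gt0; lra.
Qed.

(** Here E |u| = 0, and 1 <= [bhatt] u + |u| on [-1, 1]. *)
Lemma Pe_half_bhatt PW : Pe PW = 1 / 2 -> bms_ex PW bhatt = 1.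
Proof.
have bn := bounded_fun11_norm; have bb := @bounded_bhatt R.
move=> h; have := Pe_bms_ex PW; rewrite h => e1.
apply/eqP; rewrite eq_le; apply/andP; split.
  rewrite -[leRHS](bms_ex_cst PW 1).
  by apply: (bms_ex_le PW bb (bounded_fun11_cst 1)) => u _; exact: bhatt_le1.
have : 1 <= bms_ex PW (fun u => 1 * bhatt u + 1 * `|u|).
  rewrite -[leLHS](bms_ex_cst PW 1).
  apply: (bms_ex_le PW (bounded_fun11_cst 1) (bounded_fun11_lin 1 1 bb bn)) => u u11.
  have u1 : `|u| <= 1 by rewrite ler_norml.
  have /andP[_] := bhatt_sub_le1 u11; rewrite -[u ^+ 2]real_normK ?num_real//.
  have : `|u| ^+ 2 <= `|u| by rewrite expr2 ler_piMr.
  by lra.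
by rewrite (bms_ex_lin PW 1 1 bb bn) e1; lra.
Qed.

End survey.

(** * Offspring weights: series, moments and generating functions *)

Section offspring_weights.
Context {R : realType}.
Implicit Types (u : nat -> \bar R) (a c d z : R).

Lemma nneseries_single u k : (forall n, (0 <= u n)%E) ->
  (forall n, n != k -> u n = 0%E) -> (\sum_(0 <= n <oo) u n = u k)%E.
Proof.
move=> u0 uk; rewrite (@nneseriesD1 _ u k xpredT)//= eseries0 ?adde0// => n _ /=.
exact: uk.
Qed.

Lemma nneseries_shift u : (forall n, (0 <= u n)%E) -> u 0 = 0%E ->
  (\sum_(0 <= n <oo) u n = \sum_(0 <= n <oo) u n.+1)%E.
Proof.
move=> u0 u00; rewrite nneseries_recl// u00 add0e -(nneseries_addn _ u0).
by apply: eq_eseriesr => n _; rewrite addn1.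
Qed.

Lemma ler_subXX a c n : 0 <= a -> a <= c ->
  c ^+ n.+1 - a ^+ n.+1 <= n.+1%:R * c ^+ n * (c - a).
Proof.
move=> a0 ac; have c0 := le_trans a0 ac.
elim: n => [|n IH]; first by rewrite expr0 !expr1 !mul1r.
have h0 : 0 <= c ^+ n.+1 - a ^+ n.+1 by rewrite subr_ge0 lerXn2r.
have h1 : a * (c ^+ n.+1 - a ^+ n.+1) <= c * (c ^+ n.+1 - a ^+ n.+1).
  exact: ler_wpM2r.
have h2 := ler_wpM2l c0 IH.
have -> : c ^+ n.+2 - a ^+ n.+2 = c ^+ n.+1 * (c - a) + a * (c ^+ n.+1 - a ^+ n.+1).
  by rewrite !(exprS _ n.+1); ring.
have -> : n.+2%:R * c ^+ n.+1 * (c - a) =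
    c ^+ n.+1 * (c - a) + c * (n.+1%:R * c ^+ n * (c - a)).
  by rewrite -natr1 exprS; ring.
by lra.
Qed.

Lemma sqrt_expn_powR a n : 0 <= a -> Num.sqrt a ^+ n = a `^ (n%:R / 2).
Proof.
by move=> a0; rewrite -powR_mulrn ?sqrtr_ge0// -powR12_sqrt// -powRrM mulrC.
Qed.

Lemma expR_series a : 0 <= a ->
  (\sum_(0 <= n <oo) (a ^+ n / n`!%:R)%:E = (expR a)%:E)%E.
Proof.
move=> a0; rewrite expRE -EFin_lim; last first.
  rewrite /pseries/=; under eq_fun do rewrite mulrC.
  exact: is_cvg_series_exp_coeff.
apply/congr_lim/funext => n/=; rewrite /pseries/= /series/= -sumEFin//.
by under eq_bigr do rewrite mulrC.
Qed.

Lemma poisson_pmfE d n : 0 < d -> poisson_pmf d n = d ^+ n / n`!%:R * expR (- d).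
Proof. by rewrite /poisson_pmf => ->. Qed.

(** The size-biasing identity of the Poisson law: after a shift of the index it lowers a factorial
    moment by one order at the price of a factor d. *)
Lemma poisson_pmfS d n : 0 < d -> poisson_pmf d n.+1 * n.+1%:R = d * poisson_pmf d n.
Proof.
move=> d0; rewrite !poisson_pmfE// factS natrM exprS; field.
by rewrite nat1r !pnatr_eq0 -lt0n fact_gt0.
Qed.

Lemma poisson_pgf d a : 0 < d -> 0 <= a ->
  (\sum_(0 <= n <oo) (poisson_pmf d n * a ^+ n)%:E = (expR (- (d * (1 - a))))%:E)%E.
Proof.
move=> d0 a0; have da0 : 0 <= d * a by rewrite mulr_ge0// ltW.
have -> : - (d * (1 - a)) = - d + d * a by ring.
rewrite expRD EFinM -(expR_series da0).
transitivity (\sum_(0 <= n <oo) ((expR (- d))%:E * ((d * a) ^+ n / n`!%:R)%:E))%E.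
  by apply: eq_eseriesr => n _; rewrite poisson_pmfE// -EFinM exprMn; congr EFin; ring.
rewrite nneseriesZl// => n _.
by rewrite lee_fin divr_ge0// exprn_ge0.
Qed.

Lemma poisson_sum1 d : 0 < d -> (\sum_(0 <= n <oo) (poisson_pmf d n)%:E = 1)%E.
Proof.
move=> d0; transitivity (\sum_(0 <= n <oo) (poisson_pmf d n * 1 ^+ n)%:E)%E.
  by apply: eq_eseriesr => n _; rewrite expr1n mulr1.
by rewrite poisson_pgf// subrr mulr0 oppr0 expR0.
Qed.

Lemma poisson_mean d : 0 < d ->
  (\sum_(0 <= n <oo) (poisson_pmf d n * n%:R)%:E = d%:E)%E.
Proof.
move=> d0; rewrite nneseries_shift ?mulr0//; last first.
  by move=> n; rewrite lee_fin mulr_ge0// poisson_pmf_ge0.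
transitivity (\sum_(0 <= n <oo) (d%:E * (poisson_pmf d n)%:E))%E.
  by apply: eq_eseriesr => n _; rewrite poisson_pmfS.
rewrite nneseriesZl ?poisson_sum1 ?mule1// => n _.
by rewrite lee_fin poisson_pmf_ge0.
Qed.

Lemma poisson_fact_moment d : 0 < d ->
  (\sum_(0 <= n <oo) (poisson_pmf d n * (n%:R * (n%:R - 1)))%:E = (d * d)%:E)%E.
Proof.
move=> d0; rewrite nneseries_shift ?mul0r ?mulr0//; last first.
  move=> [|n]; first by rewrite mul0r mulr0.
  by rewrite lee_fin !mulr_ge0// ?poisson_pmf_ge0// -natr1 addrK.
transitivity (\sum_(0 <= n <oo) (d%:E * (poisson_pmf d n * n%:R)%:E))%E.
  apply: eq_eseriesr => n _; rewrite mulrA poisson_pmfS// -EFinM; congr EFin.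
  by rewrite -natr1 addrK mulrA.
rewrite nneseriesZl ?poisson_mean// => n _.
by rewrite lee_fin mulr_ge0// poisson_pmf_ge0.
Qed.

End offspring_weights.

Lemma ltr_le_factor {R : realType} (Z t D g h : R) : 0 <= Z -> 0 <= t -> 0 <= D ->
  g <= h -> D * t * h * Z < 1 -> Z * t * (D * g) < 1.
Proof.
move=> Z0 t0 D0 gh; apply: le_lt_trans.
have -> : D * t * h * Z = Z * t * (D * h) by ring.
by rewrite ler_wpM2l ?mulr_ge0// ler_wpM2l.
Qed.

(** For k = d - 1 = 0 division by zero gives 0, in agreement with the convention of [C1] at d =
    1. *)
Lemma pos_part_div_le {R : realType} (x k z : R) : 0 <= k -> 0 <= z -> x <= k * z ->
  pos_part x / k <= z.
Proof.
rewrite le_eqVlt => /predU1P[<-|k0] z0 xz; first by rewrite invr0 mulr0.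
by rewrite ler_pdivrMr// ge_max mulrC xz mulr_ge0// ltW.
Qed.

(** * The regular tree and the Poisson tree *)

Section regular_tree.
Context {R : realType} (delta : R).
Hypotheses (delta0 : 0 < delta) (delta1 : delta <= 1 / 2).
Variables (PW : delta_dist R) (d : nat).
Hypothesis d0 : (0 < d)%N.

Let theta := theta_of delta.
Let p (n : nat) : R := (n == d)%:R.

Let p0 n : 0 <= p n. Proof. exact: ler0n. Qed.

Let single (u : nat -> \bar R) : (forall n, 0 <= u n)%E ->
  (\sum_(0 <= n <oo) ((p n)%:E * u n) = u d)%E.
Proof.
move=> u0; rewrite (@nneseries_single _ _ d); first by rewrite /p eqxx mul1e.
- by move=> n; rewrite mule_ge0// lee_fin.
- by move=> n /negbTE nd; rewrite /p nd mul0e.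
Qed.

Let singleR (u : nat -> R) : (forall n, 0 <= u n) ->
  (\sum_(0 <= n <oo) (p n * u n)%:E = (u d)%:E)%E.
Proof.
by move=> u0; rewrite -(single (u := fun n => (u n)%:E)).
Qed.

Let p1 : (\sum_(0 <= n <oo) (p n)%:E = 1)%E.
Proof.
rewrite -[RHS](singleR (u := fun=> 1))//.
by apply: eq_eseriesr => n _; rewrite mulr1.
Qed.

Let pgfX (a : R) : 0 <= a -> pgf p a = a ^+ d.
Proof. by move=> a0; rewrite /pgf singleR// => n; exact: exprn_ge0. Qed.

Let pgf' (a : R) := d%:R * a ^+ d.-1.

Let D0 : 0 < d%:R :> R. Proof. by rewrite ltr0n. Qed.

Let kappa0 : 0 <= d%:R - 1 :> R. Proof. by rewrite subr_ge0 ler1n. Qed.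

Let mean : (\sum_(0 <= n <oo) (p n * n%:R)%:E = (d%:R)%:E)%E.
Proof. exact: singleR. Qed.

Let fact_moment : (\sum_(0 <= n <oo) (p n * (n%:R * (n%:R - 1)))%:E =
  (d%:R * (d%:R - 1))%:E)%E.
Proof.
apply: (singleR (u := fun n => n%:R * (n%:R - 1))) => -[|n]; first by rewrite mul0r.
by rewrite mulr_ge0// -natr1 addrK.
Qed.

Let pgf_le (a c : R) : 0 <= a -> a <= c -> c <= 1 -> pgf p c - pgf p a <= pgf' c * (c - a).
Proof.
move=> a0 ac _; rewrite (pgfX a0) (pgfX (le_trans a0 ac)) /pgf' -(prednK d0) /=.
exact: ler_subXX.
Qed.

Let pgf'_mono (a c : R) : 0 <= a -> a <= c -> c <= 1 -> pgf' a <= pgf' c.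
Proof. by move=> a0 ac _; rewrite ler_wpM2l// lerXn2r// nnegrE// (le_trans a0). Qed.

Let pgf'1 : pgf' 1 = d%:R. Proof. by rewrite /pgf' expr1n mulr1. Qed.

Let bp_fixedE : bp_fixed_point d delta PW = bp_fixed delta PW p0 p1.
Proof.
apply/funext => P; apply/propext.
have E A : bp_mixture delta PW p0 p1 P A = bp_law delta PW P d A by exact: single.
by split=> h A mA; [apply: etrans (E A) (h A mA)|apply: etrans (esym (E A)) (h A mA)].
Qed.

(** d a^(d - 1) at a = sqrt (1 - z) is nonincreasing in z, and z is at least the positive part of d
    theta^2 - 1 over d - 1. *)
Let bp_contraction_C1 : C1 d theta PW < 1 ->
  bp_contraction delta PW d%:R (d%:R - 1) pgf'.
Proof.
rewrite /C1 Bhattacharyya_bms_ex => C z /andP[z0 z1] hz.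
apply: ltr_le_factor C => //.
- by apply: ex_ge0 => u _; exact: bhatt_ge0.
- exact: sqr_ge0.
have d1 : d%:R - 1 = d.-1%:R :> R by rewrite -(prednK d0) -natr1 addrK.
have q := pos_part_div_le kappa0 z0 hz.
have u0 : 0 <= 1 - z by lra.
rewrite sqrt_expn_powR// d1; apply: ge0_ler_powR.
- by rewrite divr_ge0.
- by rewrite nnegrE.
- by rewrite nnegrE -d1; move: q u0; rewrite -/theta; lra.
- by rewrite -d1; move: q; rewrite -/theta; lra.
Qed.

Lemma regular_bp_fixed_points :
  [/\ Pe PW < 1 / 2 -> C1 d theta PW < 1 -> exactly_one (bp_fixed_point d delta PW),
      Pe PW = 1 / 2 -> d%:R * theta ^+ 2 <= 1 -> only_trivial (bp_fixed_point d delta PW) &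
      Pe PW = 1 / 2 -> 1 < d%:R * theta ^+ 2 -> C1 d theta PW < 1 ->
        trivial_and_one_nontrivial (bp_fixed_point d delta PW)].
Proof.
rewrite bp_fixedE; split.
- move=> /Pe_lt_half x0 /bp_contraction_C1.
  exact: (exactly_one_bp_fixed delta0 delta1 p0 p1 D0 kappa0 mean fact_moment).
- move=> /Pe_half_bhatt; exact: (only_trivial_bp_fixed delta0 delta1 p0 p1 D0 pgf_le).
- move=> /Pe_half_bhatt Z1 D1 /bp_contraction_C1.
  exact: (trivial_and_one_nontrivial_bp_fixed delta0 delta1 p0 p1 D0 kappa0 mean fact_moment).
Qed.

End regular_tree.

Section poisson_tree.
Context {R : realType} (delta : R).
Hypotheses (delta0 : 0 < delta) (delta1 : delta <= 1 / 2).
Variables (PW : delta_dist R) (d : R).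
Hypothesis d0 : 0 < d.

Let theta := theta_of delta.
Let p (n : nat) : R := poisson_pmf d n.

Let p0 n : 0 <= p n. Proof. exact: poisson_pmf_ge0. Qed.

Let p1 : (\sum_(0 <= n <oo) (p n)%:E = 1)%E. Proof. exact: poisson_sum1. Qed.

Let pgfP (a : R) : 0 <= a -> pgf p a = expR (- (d * (1 - a))).
Proof. by move=> a0; rewrite /pgf poisson_pgf. Qed.

Let pgf' (a : R) := d * expR (- (d * (1 - a))).

(** The exponential lies above its tangent at c. *)
Let pgf_le (a c : R) : 0 <= a -> a <= c -> c <= 1 -> pgf p c - pgf p a <= pgf' c * (c - a).
Proof.
move=> a0 ac _; rewrite (pgfP a0) (pgfP (le_trans a0 ac)) /pgf'.
have -> : - (d * (1 - a)) = - (d * (1 - c)) + - (d * (c - a)) by ring.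
rewrite expRD; set e := expR (- (d * (1 - c))).
have e0 : 0 <= e by exact: expR_ge0.
have := ler_wpM2l e0 (expR_ge1Dx (- (d * (c - a)))).
by lra.
Qed.

Let pgf'_mono (a c : R) : 0 <= a -> a <= c -> c <= 1 -> pgf' a <= pgf' c.
Proof.
move=> _ ac _; have d0' := ltW d0.
by rewrite ler_wpM2l// ler_expR lerN2 ler_wpM2l// lerD2l lerN2.
Qed.

Let pgf'1 : pgf' 1 = d. Proof. by rewrite /pgf' subrr mulr0 oppr0 expR0 mulr1. Qed.

Let bp_fixedE : poisson_bp_fixed_point d delta PW = bp_fixed delta PW p0 p1.
Proof. by []. Qed.

Let bp_contraction_C2 : C2 d theta PW < 1 -> bp_contraction delta PW d d pgf'.
Proof.
have d0' := ltW d0; rewrite /C2 Bhattacharyya_bms_ex => C z /andP[z0 z1] hz.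
apply: ltr_le_factor C => //.
- by apply: ex_ge0 => u _; exact: bhatt_ge0.
- exact: sqr_ge0.
have q := pos_part_div_le d0' z0 hz.
by rewrite ler_expR lerN2 ler_wpM2l// lerD2l lerN2 ler_wsqrtr// lerD2l lerN2.
Qed.

Lemma poisson_bp_fixed_points :
  [/\ Pe PW < 1 / 2 -> C2 d theta PW < 1 -> exactly_one (poisson_bp_fixed_point d delta PW),
      Pe PW = 1 / 2 -> d * theta ^+ 2 <= 1 ->
        only_trivial (poisson_bp_fixed_point d delta PW) &
      Pe PW = 1 / 2 -> 1 < d * theta ^+ 2 -> C2 d theta PW < 1 ->
        trivial_and_one_nontrivial (poisson_bp_fixed_point d delta PW)].
Proof.
have mean := poisson_mean d0; have fact_moment := poisson_fact_moment d0.
rewrite bp_fixedE; split.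
- move=> /Pe_lt_half x0 /bp_contraction_C2.
  exact: (exactly_one_bp_fixed delta0 delta1 p0 p1 d0 (ltW d0) mean fact_moment).
- move=> /Pe_half_bhatt; exact: (only_trivial_bp_fixed delta0 delta1 p0 p1 d0 pgf_le).
- move=> /Pe_half_bhatt Z1 D1 /bp_contraction_C2.
  exact: (trivial_and_one_nontrivial_bp_fixed delta0 delta1 p0 p1 d0 (ltW d0) mean fact_moment).
Qed.

End poisson_tree.

Theorem proposition6 (R : realType) (delta : R)
    (dY : measure_display) (Y : measurableType dY) (W : R.-pker bool ~> Y)
    (PW : delta_dist R) :
  0 < delta -> delta <= 1 / 2 ->
  is_BMS W -> channel_equiv W (delta_kernel PW) ->
  (forall d : nat, (0 < d)%N ->
    [/\ Pe PW < 1 / 2 -> C1 d (theta_of delta) PW < 1 ->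
          exactly_one (bp_fixed_point d delta PW),
        Pe PW = 1 / 2 -> d%:R * theta_of delta ^+ 2 <= 1 ->
          only_trivial (bp_fixed_point d delta PW) &
        Pe PW = 1 / 2 -> 1 < d%:R * theta_of delta ^+ 2 ->
          C1 d (theta_of delta) PW < 1 ->
          trivial_and_one_nontrivial (bp_fixed_point d delta PW)]) /\
  (forall d : R, 0 < d ->
    [/\ Pe PW < 1 / 2 -> C2 d (theta_of delta) PW < 1 ->
          exactly_one (poisson_bp_fixed_point d delta PW),
        Pe PW = 1 / 2 -> d * theta_of delta ^+ 2 <= 1 ->
          only_trivial (poisson_bp_fixed_point d delta PW) &
        Pe PW = 1 / 2 -> 1 < d * theta_of delta ^+ 2 ->
          C2 d (theta_of delta) PW < 1 ->
          trivial_and_one_nontrivial (poisson_bp_fixed_point d delta PW)]).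
Proof.
move=> delta0 delta1 _ _; split=> d d0.
  exact: regular_bp_fixed_points.
exact: poisson_bp_fixed_points.
Qed.
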